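(* Let $\mathbb C\xi=2\mu\xi_D+\kappa(\mathrm{tr}\,\xi)I$ with constants $\mu>0$, $\kappa>0$; let $K:=\{(\sigma,\zeta)\in\mathbb M^{2\times2}_D\times\mathbb R:|\sigma|^2+\zeta^2\le1\}$, $V(\theta):=\frac12-\frac12\sqrt{1+\theta^2}$, $\Gamma_0:=\partial\Omega$. Let $\theta_0>0$ and let $\xi_0$ be a $2\times2$ matrix with $\mathrm{tr}\,\xi_0=0$ whose symmetric part $\xi_0^s$ is different from $0$. Let $w(t,x):=t\xi_0x$, $p_0(x):=0$, $z_0(x):=\theta_0$ for $x\in\Omega$. Let $$t_0:=\frac{\sqrt3}{4\mu|\xi_0^s|},$$ $$\alpha(t):=\begin{cases}t&t\in[0,t_0],\\t_0&t\in[t_0,+\infty),\end{cases}\qquad\beta(t):=\begin{cases}0&t\in[0,t_0],\\t-t_0&t\in[t_0,+\infty),\end{cases}$$ $$u(t,x):=t\xi_0x,\quad e(t,x):=\alpha(t)\xi_0^s,\quad p(t,x):=\beta(t)\xi_0^s,\quad z_\infty(t,x):=\tfrac1{\sqrt3}|p(t,x)|,$$ and let $\boldsymbol\mu\in SGY([0,+\infty),\overline\Omega;\mathbb M^{2\times2}_D\times\mathbb R)$ be the system defined by $$\boldsymbol\mu_{t_1\dots t_m}:=\delta_{((p_0,z_0),\dots,(p_0,z_0))}+\tfrac12\omega^{\mathcal L^2}_{((p(t_1),z_\infty(t_1)),\dots,(p(t_m),z_\infty(t_m)))}+\tfrac12\omega^{\mathcal L^2}_{((p(t_1),-z_\infty(t_1)),\dots,(p(t_m),-z_\infty(t_m)))}$$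 for every finite sequence $0\le t_1<\dots<t_m$. Then $(u,e,\boldsymbol\mu)$ is a globally stable quasistatic evolution of Young measures with boundary datum $w$ and initial condition $\boldsymbol\mu_0=\delta_{(p_0,z_0)}$.
   Context: **Matrices, domain.** $\mathbb M^{2\times2}_{sym}$ is the space of real symmetric $2\times2$ matrices, $\mathbb M^{2\times2}_D$ its subspace of trace-free matrices, with Euclidean product $\sigma:\xi=\sum_{ij}\sigma_{ij}\xi_{ij}$; $\xi_D=\xi-\frac12(\mathrm{tr}\,\xi)I$. $\Omega\subset\mathbb R^2$ is a bounded connected open set with $C^2$ boundary; $n$ is the outward unit normal, $\odot$ the symmetrized tensor product, $\mathcal H^1$ the one-dimensional Hausdorff measure. $M_b$ denotes bounded Radon measures; for a measure, the superscripts $a$ (identified with its density) and $s$ denote the absolutely continuous and singular parts with respect to Lebesgue measure $\mathcal L^2$. $Eu$ is the symmetrized distributional gradient. **Dissipation, softening, elastic energy.** $H(\xi,\theta):=\sup_{(\sigma,\zeta)\in K}\{\sigma:\xi+\zeta\theta\}$. $V^\infty(\theta):=\lim_{t\to+\infty}V(t\theta)/t$, $\{V\}(\theta,\eta):=\eta V(\theta/\eta)$ if $\eta>0$, $\{V\}(\theta,\eta):=V^\infty(\theta)$ if $\eta\le0$. For integrable $p,z$: $\mathcal H(p,z):=\int_\Omega H(p,z)\,dx$. $\mathcal Q(e):=\frac12\int_\Omega\mathbb Ce:e\,dx$. **Admissible sets.** For $w\in H^1(\Omega;\mathbb R^2)$, $A(w)$ is the set of $(u,e,p)\in BD(\Omega)\times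 L^2(\Omega;\mathbb M^{2\times2}_{sym})\times M_b(\overline\Omega;\mathbb M^{2\times2}_D)$ with $Eu=e+p$ in $\Omega$ and $p=(w-u)\odot n\,\mathcal H^1$ on $\Gamma_0$. $A_{reg}(w)$ is the set of $(u,e,p)\in A(w)$ with $u\in W^{1,1}_{loc}(\Omega;\mathbb R^2)$ and $p\in L^1(\Omega;\mathbb M^{2\times2}_D)$ (equivalently $Eu=e+p$ a.e. in $\Omega$, $u=w$ $\mathcal H^1$-a.e. on $\Gamma_0$). $AC_{loc}([0,+\infty);H^1)$ denotes functions absolutely continuous on every $[0,T]$. **Generalized Young measures.** Let $\Xi$ be a finite dimensional Hilbert space. $C^{hom}(\overline\Omega\times\Xi\times\mathbb R)$ is the space of continuous $f(x,\xi,\eta)$ positively homogeneous of degree one in $(\xi,\eta)$, normed by $\max\{|f|:|\xi|^2+\eta^2=1\}$; $M_*(\overline\Omega\times\Xi\times\mathbb R)$ is its dual, with pairing written $\langle f,\mu\rangle$ or $\langle f(x,\xi,\eta),\mu(x,\xi,\eta)\rangle$. $GY(\overline\Omega;\Xi)$ is the set of $\mu\in M_*(\overline\Omega\times\Xi\times\mathbb R)$ which are positive, supported in $\{\eta\ge0\}$, and satisfy $\langle\varphi(x)\eta,\mu\rangle=\int_\Omega\varphi\,dx$ for all $\varphi\in C(\overline\Omega)$; weak$^*$ convergence in $GY$ is that of $M_*$. Each $\mu\in GY(\overline\Omega;\Xi)$ is represented by a nonnegative measure on $\{|\xi|^2+\eta^2=1\}$, and the pairing is thereby extended to Borel $f$,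 positively homogeneous of degree one in $(\xi,\eta)$, with $|f|\le a|\xi|+b(x)|\eta|$, $a$ constant and $b\in L^1(\Omega)$. For $q\in M_b(\overline\Omega;\Xi)$, $\delta_q\in GY(\overline\Omega;\Xi)$ is $\langle f,\delta_q\rangle:=\int_\Omega f(x,q^a,1)\,dx+\int_{\overline\Omega}f(x,\frac{dq^s}{d|q^s|},0)\,d|q^s|$. For $q\in L^1(\Omega;\Xi)$, $\omega^{\mathcal L^2}_q\in M_*(\overline\Omega\times\Xi\times\mathbb R)$ is $\langle f,\omega^{\mathcal L^2}_q\rangle:=\int_\Omega f(x,q(x),0)\,dx$. When $\Xi=\mathbb M^{2\times2}_D\times\mathbb R$ the variable in $\Xi$ is written $(\xi,\theta)$. **Systems.** For $\Theta\subset\mathbb R$, $SGY(\Theta,\overline\Omega;\Xi)$ is the set of families $\boldsymbol\mu=(\boldsymbol\mu_{t_1\dots t_m})$, indexed by finite sequences $t_1<\dots<t_m$ in $\Theta$, with $\boldsymbol\mu_{t_1\dots t_m}\in GY(\overline\Omega;\Xi^m)$, such that if $s_1<\dots<s_n$ is a subsequence of $t_1<\dots<t_m$, then $\boldsymbol\mu_{s_1\dots s_n}$ is the image of $\boldsymbol\mu_{t_1\dots t_m}$ under the corresponding projection $\overline\Omega\times\Xi^m\times\mathbb R\to\overline\Omega\times\Xi^n\times\mathbb R$ (image: $\langle f,\psi(\mu)\rangle=\langle f\circ\psi,\mu\rangle$). $\boldsymbol\mu$ is weakly$^*$ left-continuous if $\boldsymbol\mu_{s_1\dots s_m}\rightharpoonup\boldsymbol\mu_{t_1\dots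 t_m}$ weakly$^*$ as $s_i\to t_i$ with $s_i\le t_i$, for all $t_1<\dots<t_m$. For $\boldsymbol\mu\in SGY([0,+\infty),\overline\Omega;\mathbb M^{2\times2}_D\times\mathbb R)$, $$\mathcal D_H(\boldsymbol\mu;a,b):=\sup\sum_{i=1}^k\langle H(\xi_i-\xi_{i-1},\theta_i-\theta_{i-1}),\boldsymbol\mu_{t_{i-1}t_i}(x,\xi_{i-1},\theta_{i-1},\xi_i,\theta_i,\eta)\rangle,$$ the supremum being over finite families $a=t_0<t_1<\dots<t_k=b$; $\mathrm{Var}(\boldsymbol\mu;a,b)$ is defined in the same way with $\sqrt{|\xi|^2+\theta^2}$ in place of $H(\xi,\theta)$. **$AY(\Theta,w)$.** For $w:\Theta\to H^1(\Omega;\mathbb R^2)$, $AY(\Theta,w)$ is the set of triples $(u,e,\boldsymbol\mu)$, $u:\Theta\to BD(\Omega)$, $e:\Theta\to L^2(\Omega;\mathbb M^{2\times2}_{sym})$, $\boldsymbol\mu\in SGY(\Theta,\overline\Omega;\mathbb M^{2\times2}_D\times\mathbb R)$, such that for every $t_1<\dots<t_m$ in $\Theta$ there exist, for $i=1,\dots,m$, sequences $(u^i_k,e^i_k,p^i_k)\in A(w(t_i))$ and $z^i_k\in M_b(\overline\Omega)$ with $u^i_k\rightharpoonup u(t_i)$ weakly$^*$ in $BD(\Omega)$, $e^i_k\to e(t_i)$ strongly in $L^2$, and $\delta_{((p^1_k,z^1_k),\dots,(p^m_k,z^m_k))}\rightharpoonup\boldsymbol\mu_{t_1\dots t_m}$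 weakly$^*$ in $GY(\overline\Omega;(\mathbb M^{2\times2}_D\times\mathbb R)^m)$. **Globally stable quasistatic evolution.** Given $w\in AC_{loc}([0,+\infty);H^1(\Omega;\mathbb R^2))$, a globally stable quasistatic evolution of Young measures with boundary datum $w$ is a triple $(u,e,\boldsymbol\mu)\in AY([0,+\infty),w)$, with $u,e,\boldsymbol\mu$ weakly$^*$ left-continuous, such that: (ev1) for every $t\ge0$, $\mathcal Q(e(t))+\langle\{V\}(\theta,\eta),\boldsymbol\mu_t\rangle\le\mathcal Q(e(t)+\tilde e)+\mathcal H(\tilde p,\tilde z)+\langle\{V\}(\theta+\eta\tilde z(x),\eta),\boldsymbol\mu_t\rangle$ for every $(\tilde u,\tilde e,\tilde p)\in A_{reg}(0)$ and $\tilde z\in L^1(\Omega)$; (ev2) for every $T>0$, $\mathrm{Var}(\boldsymbol\mu;0,T)<+\infty$ and, with $\sigma(t):=\mathbb Ce(t)$, $$\mathcal Q(e(T))+\mathcal D_H(\boldsymbol\mu;0,T)+\langle\{V\}(\theta,\eta),\boldsymbol\mu_T\rangle=\mathcal Q(e(0))+\langle\{V\}(\theta,\eta),\boldsymbol\mu_0\rangle+\int_0^T\langle\sigma(t),E\dot w(t)\rangle\,dt.$$ *)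

(* Defs.v *)
From HB Require Import structures.
From mathcomp Require Import all_boot all_order all_algebra.
From mathcomp Require Import all_classical all_reals all_analysis.

Set Implicit Arguments.
Unset Strict Implicit.
Unset Printing Implicit Defensive.

Import Order.TTheory GRing.Theory Num.Theory numFieldNormedType.Exports.

Local Open Scope classical_set_scope.
Local Open Scope ring_scope.

Notation plane R := (R * R)%type (only parsing).
(* The plane with its product (= Borel) sigma-algebra. *)
Notation mplane R := (measurableTypeR R * measurableTypeR R)%type (only parsing).

Section linear_algebra.
Variable R : realType.

Definition coord2 (v : plane R) (i : 'I_2) : R := if i == ord0 then v.1 else v.2.

Definition canon2 (i : 'I_2) : plane R := ((i == ord0)%:R, (i != ord0)%:R).

Definition dot2 (v w : plane R) : R := v.1 * w.1 + v.2 * w.2.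

(* The library norm on [R * R] is the sup norm; this is the Euclidean one. *)
Definition enorm (v : plane R) : R := Num.sqrt (dot2 v v).

Definition matvec (A : 'M[R]_2) (x : plane R) : plane R :=
  (\sum_j A ord0 j * coord2 x j, \sum_j A ord_max j * coord2 x j).

Definition inner (A B : 'M[R]_2) : R := \sum_i \sum_j A i j * B i j.

Definition fnorm (A : 'M[R]_2) : R := Num.sqrt (inner A A).

Definition Msym : set 'M[R]_2 := [set A | A^T = A].

Definition MD : set 'M[R]_2 := [set A | A^T = A /\ \tr A = 0].

Definition sympart (A : 'M[R]_2) : 'M[R]_2 := 2^-1 *: (A + A^T).

Definition devpart (A : 'M[R]_2) : 'M[R]_2 := A - (2^-1 * \tr A)%:M.

Definition odot (v w : plane R) : 'M[R]_2 :=
  \matrix_(i, j) (2^-1 * (coord2 v i * coord2 w j + coord2 v j * coord2 w i)).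

Definition elasticity (mu kappa : R) (A : 'M[R]_2) : 'M[R]_2 :=
  (2 * mu) *: devpart A + (kappa * \tr A)%:M.

End linear_algebra.

Section hausdorff.
Variable R : realType.
Local Open Scope ereal_scope.
Implicit Types A : set (plane R).

Definition ediam A : \bar R :=
  ereal_sup ([set 0] `|` [set (enorm (x - y)%R)%:E | x in A & y in A]).

Definition hausdorff_pre (delta : R) A : \bar R :=
  ereal_inf [set \sum_(k <oo) ediam (F k) | F in
    [set F : (set (plane R))^nat | A `<=` \bigcup_k F k /\
                                   forall k, ediam (F k) <= delta%:E]].

(* One-dimensional Hausdorff outer measure; the usual constant
   omega_1 / 2 is equal to 1. *)
Definition hausdorff1 A : \bar R :=
  ereal_sup [set hausdorff_pre delta A | delta in [set delta : R | (0 < delta)%R]].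

Lemma ediam_ge0 A : 0 <= ediam A.
Proof. by apply: ereal_sup_ubound; left. Qed.

Lemma ediam0 : ediam set0 = 0.
Proof.
rewrite /ediam (_ : [set _ | _ in _ & _ in _] = set0) ?setU0 ?ereal_sup1//.
by apply/seteqP; split => // t [x].
Qed.

Lemma hausdorff_pre_ge0 delta A : 0 <= hausdorff_pre delta A.
Proof.
apply: le_ereal_inf_tmp => _ [F _ <-].
by apply: nneseries_ge0 => k _ _; exact: ediam_ge0.
Qed.

Lemma hausdorff_pre_subadditive delta : (0 < delta)%R ->
  sigma_subadditive (hausdorff_pre delta).
Proof.
move=> delta0 A.
have [[i ioo]|] := pselect (exists i, hausdorff_pre delta (A i) = +oo).
  rewrite (eseries_pinfty _ _ ioo) ?leey// => n _.
  by rewrite -ltNye (lt_le_trans _ (hausdorff_pre_ge0 _ _)).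
rewrite -forallNE => Aoo.
suff add2e (e : {posnum R}) : hausdorff_pre delta (\bigcup_n A n) <=
    \sum_(i <oo) hausdorff_pre delta (A i) + e%:num%:E.
  by apply/lee_addgt0Pr => _/posnumP[].
rewrite (le_trans _ (epsilon_trick _ _ _))//; last first.
  by move=> n; exact: hausdorff_pre_ge0.
pose P n (B : (set (plane R))^nat) :=
  (A n `<=` \bigcup_k B k /\ forall k, ediam (B k) <= delta%:E) /\
  \sum_(k <oo) ediam (B k) <=
    hausdorff_pre delta (A n) + (e%:num / (2 ^ n.+1)%:R)%:E.
have [G PG] : {G : ((set (plane R))^nat)^nat & forall n, P n (G n)}.
  apply: (@choice _ _ P) => n; rewrite /P /hausdorff_pre.
  set S := (X in ereal_inf X); move infS : (ereal_inf S) => iS.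
  case: iS infS => [r Sr|Soo|Soo].
  - have en1 : (0 < e%:num / (2 ^ n.+1)%:R)%R by [].
    have /(lb_ereal_inf_adherent en1) : ereal_inf S \is a fin_num by rewrite Sr.
    move=> [x [B [AnB dB] muBx] xS].
    by exists B; split => //; rewrite muBx -Sr; exact/ltW.
  - by have := Aoo n; rewrite /hausdorff_pre Soo.
  - suff : lbound S 0 by move/le_ereal_inf_tmp; rewrite Soo.
    move=> /= _ [B _ <-]; apply: nneseries_ge0 => k _ _; exact: ediam_ge0.
have muG_ge0 x : 0 <= (@ediam \o uncurry G) x by exact: ediam_ge0.
apply: (@le_trans _ _ (\esum_(i in setT) (@ediam \o uncurry G) i)).
  rewrite /hausdorff_pre; apply: ereal_inf_lbound => /=.
  have /card_esym/ppcard_eqP[f] := card_nat2.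
  exists (uncurry G \o f).
    split => [t [i _ Ait]|k /=].
      have [[/(_ _ Ait) [j _ Gijt] _] _] := PG i.
      by exists (f^-1%FUN (i, j)) => //=; rewrite invK ?inE.
    by rewrite /uncurry/=; case: (f k) => a b; exact: (PG a).1.2.
  rewrite -(esum_pred_image (@ediam \o uncurry G) _ xpredT) ?[fun=> _]set_true//.
  by rewrite image_eq.
rewrite (_ : esum _ _ = \sum_(i <oo) \sum_(j <oo ) ediam (G i j)); last first.
  pose J : nat -> set (nat * nat) := fun i => [set (i, j) | j in setT].
  rewrite (_ : setT = \bigcup_k J k); last first.
    by rewrite predeqE => -[a b]; split => // _; exists a => //; exists b.
  rewrite esum_bigcupT /=; last 2 first.
    - apply/trivIsetP => i j _ _ ij.
      rewrite predeqE => -[n m] /=; split => //= -[] [_] _ [<-{n} _].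
      by move=> [m' _] [] /esym/eqP; rewrite (negbTE ij).
    - by move=> /= [n m]; exact: ediam_ge0.
  rewrite -(image_id [set: nat]) -fun_true esum_pred_image//; last first.
    by move=> n _; apply: esum_ge0 => *; exact: ediam_ge0.
  apply: eq_eseriesr => /= j _.
  rewrite -(esum_pred_image (@ediam \o uncurry G) (pair j) predT)//=; last first.
    by move=> ? ? _ _; exact: (@can_inj _ _ _ snd).
  - by move=> *; exact: ediam_ge0.
  by congr esum; rewrite predeqE => -[a b]; split; move=> [i _ <-]; exists i.
apply: lee_lim.
- apply: is_cvg_nneseries => n *.
  by apply: nneseries_ge0 => m *; exact: (muG_ge0 (n, m)).
- by apply: is_cvg_nneseries => n *; apply: adde_ge0 => //; exact: hausdorff_pre_ge0.
- by near=> n; apply: lee_sum => i _; exact: (PG i).2.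
Unshelve. all: by end_near. Qed.

Lemma hausdorff_pre0 delta : (0 < delta)%R -> hausdorff_pre delta set0 = 0.
Proof.
move=> delta0; apply/eqP; rewrite eq_le hausdorff_pre_ge0 andbT.
apply: ereal_inf_lbound; exists (fun=> set0).
  by split => // k; rewrite ediam0 lee_fin ltW.
by apply: eseries0 => k _ _; rewrite ediam0.
Qed.

Lemma hausdorff1_set0 : hausdorff1 set0 = 0.
Proof.
apply/eqP; rewrite eq_le; apply/andP; split.
  by apply: ge_ereal_sup => _ [d d0 <-]; rewrite hausdorff_pre0.
apply: ereal_sup_ubound; exists 1%R => /=; first exact: ltr01.
by rewrite hausdorff_pre0.
Qed.

Lemma hausdorff1_ge0 A : 0 <= hausdorff1 A.
Proof.
apply: (le_trans (hausdorff_pre_ge0 1%R A)).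
by apply: ereal_sup_ubound; exists 1%R => /=; [exact: ltr01|by []].
Qed.

Lemma hausdorff1_le : {homo hausdorff1 : A B / A `<=` B >-> A <= B}.
Proof.
move=> A B AB; apply: ge_ereal_sup => _ [d d0 <-].
apply: (@le_trans _ _ (hausdorff_pre d B)); last first.
  by apply: ereal_sup_ubound; exists d.
apply: ereal_inf_le_tmp => _ [F [BF dF] <-]; exists F => //; split => //.
exact: subset_trans BF.
Qed.

Lemma hausdorff1_sigma_subadditive : sigma_subadditive hausdorff1.
Proof.
move=> F; apply: ge_ereal_sup => _ [d d0 <-].
apply: (le_trans (hausdorff_pre_subadditive d0 F)).
apply: lee_nneseries => [k _ _|k _]; first exact: hausdorff_pre_ge0.
by apply: ereal_sup_ubound; exists d.
Qed.

HB.instance Definition _ := isOuterMeasure.Build R (plane R) hausdorff1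
  hausdorff1_set0 hausdorff1_ge0 hausdorff1_le hausdorff1_sigma_subadditive.

(* The measure obtained by restricting the outer measure to the Caratheodory
   measurable sets, among which are the Borel sets. *)
Definition hausdorff1_measure :
    {measure set (caratheodory_type hausdorff1) -> \bar R} :=
  (hausdorff1 : {outer_measure set (plane R) -> \bar R}).

End hausdorff.

Section domains.
Variable R : realType.
Implicit Types (Omega : set (plane R)) (phi : plane R -> R).

Definition lebesgue2 : {measure set (mplane R) -> \bar R} :=
  (@lebesgue_measure R \x @lebesgue_measure R)%E.

Definition partial (i : 'I_2) phi : plane R -> R :=
  fun x => 'D_(canon2 R i) phi x.

Definition grad phi (x : plane R) : plane R :=
  (partial ord0 phi x, partial ord_max phi x).

Definition C1fun phi := continuous phi /\
  forall i, (forall x, derivable phi x (canon2 R i)) /\ continuous (partial i phi).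

Definition C2fun phi := C1fun phi /\ forall i, C1fun (partial i phi).

Definition smooth phi := forall s : seq 'I_2, C1fun (foldr partial phi s).

Definition test_fun Omega phi := smooth phi /\
  exists2 K : set (plane R), compact K /\ K `<=` Omega &
    forall x, ~ K x -> phi x = 0.

(* C_0(Omega), each function being extended by 0 outside Omega. *)
Definition C0fun Omega phi := continuous phi /\ forall x, ~ Omega x -> phi x = 0.

Definition bdry Omega : set (plane R) := closure Omega `\` Omega^°.

Definition local_defining Omega (x : plane R) (U : set (plane R)) (g : plane R -> R) :=
  [/\ open U, U x, C2fun g, grad g x != 0 &
      forall y, U y -> (Omega y <-> g y < 0)].

Definition C2boundary Omega :=
  forall x, bdry Omega x -> exists U g, local_defining Omega x U g.

Definition outward_normal Omega (x : plane R) : plane R :=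
  xget 0 [set nu | exists U g, local_defining Omega x U g /\
                     nu = (enorm (grad g x))^-1 *: grad g x].

End domains.

Section function_spaces.
Variable R : realType.
Implicit Types (Omega A : set (plane R)) (u v w T : plane R -> plane R)
  (e g : plane R -> 'M[R]_2) (f z : plane R -> R).

Local Notation L2 := (lebesgue2 R).

Definition L1fun Omega f := L2.-integrable Omega (EFin \o f).

Definition L1vec Omega u := forall i, L1fun Omega (fun x => coord2 (u x) i).

Definition L1mat Omega g := forall i j, L1fun Omega (fun x => g x i j).

Definition L2fun Omega f :=
  measurable_fun (Omega : set (mplane R)) (f : mplane R -> R) /\
  L1fun Omega (fun x => f x ^+ 2).

Definition L2vec Omega u := forall i, L2fun Omega (fun x => coord2 (u x) i).

Definition L2mat Omega g := forall i j, L2fun Omega (fun x => g x i j).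

Definition L2sym Omega e :=
  L2mat Omega e /\ {ae L2, forall x : plane R, Omega x -> Msym (e x)}.

Definition weak_grad Omega u g := forall phi, test_fun Omega phi -> forall i j,
  \int[L2]_(x in Omega) (coord2 (u x) i * partial j phi x) =
  - \int[L2]_(x in Omega) (g x i j * phi x).

Definition W11loc Omega u := exists2 g, weak_grad Omega u g &
  forall C : set (plane R), compact C -> C `<=` Omega -> L1vec C u /\ L1mat C g.

(* [u] belongs to H^1(Omega; R^2), with weak gradient [g]. *)
Definition H1vec Omega u g := [/\ L2vec Omega u, L2mat Omega g & weak_grad Omega u g].

Definition H1norm Omega u g : R :=
  Num.sqrt (\int[L2]_(x in Omega) (dot2 (u x) (u x) + inner (g x) (g x))).

(* Bounded scalar measures are charges; integrals against them are defined by
    the Jordan decomposition, which does not depend on the chosen Hahn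
    decomposition. *)
Local Notation measR := (charge (mplane R) R).

Lemma hahn_exists (nu : measR) :
  exists PN : set (mplane R) * set (mplane R), hahn_decomposition nu PN.1 PN.2.
Proof. by have [P [N PN]] := Hahn_decomposition nu; exists (P, N). Qed.

Definition charge_integral (nu : measR) A f : R :=
  let nuPN := svalP (cid (hahn_exists nu)) in
  \int[jordan_pos nuPN]_(x in A) f x - \int[jordan_neg nuPN]_(x in A) f x.

Definition measmat := 'I_2 -> 'I_2 -> measR.

Definition concentrated (nu : measR) A :=
  forall B : set (mplane R), measurable B -> B `&` A = set0 -> nu B = 0.

Definition Mb Omega (z : measR) := concentrated z (closure Omega).

Definition MbD Omega (p : measmat) :=
  [/\ forall i j, concentrated (p i j) (closure Omega),
      forall i j (B : set (mplane R)), measurable B -> p i j B = p j i B &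
      forall B : set (mplane R), measurable B -> \sum_i p i i B = 0]%E.

(* [E] is the symmetrized distributional gradient of [u] in Omega; only the
   values of [E] on subsets of Omega matter. *)
Definition sym_grad Omega u (E : measmat) :=
  forall phi, test_fun Omega phi -> forall i j,
  charge_integral (E i j) Omega phi =
  - \int[L2]_(x in Omega)
      (2^-1 * (coord2 (u x) i * partial j phi x + coord2 (u x) j * partial i phi x)).

Definition BD Omega u := L1vec Omega u /\ exists E, sym_grad Omega u E.

Definition BD_weakstar Omega (us : nat -> plane R -> plane R) u :=
  [/\ forall k, L1vec Omega (us k), L1vec Omega u,
   (fun k => \int[L2]_(x in Omega) enorm (us k x - u x)) @ \oo --> (0 : R) &
   exists (Es : nat -> measmat) (E : measmat),
   [/\ forall k, sym_grad Omega (us k) (Es k), sym_grad Omega u E &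
       forall phi, C0fun Omega phi -> forall i j,
         (fun k => charge_integral (Es k i j) Omega phi) @ \oo -->
         charge_integral (E i j) Omega phi]].

Definition L2_strong Omega (es : nat -> plane R -> 'M[R]_2) e :=
  (fun k => \int[L2]_(x in Omega) inner (es k x - e x) (es k x - e x)) @ \oo
    --> (0 : R).

Definition L2_weak Omega (es : nat -> plane R -> 'M[R]_2) e :=
  forall g, L2mat Omega g ->
  (fun k => \int[L2]_(x in Omega) inner (es k x) (g x)) @ \oo -->
  \int[L2]_(x in Omega) inner (e x) (g x).

(* [T] is the trace on the boundary of the BD function [v], i.e. the function in
   L^1(boundary, H^1) given by the Green formula. *)
Definition BD_trace Omega v T :=
  [/\ L1vec Omega v,
   forall i, (@hausdorff1_measure R).-integrable (bdry Omega)
     (fun x => (coord2 (T x) i)%:E) &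
   exists2 E, sym_grad Omega v E & forall phi, C1fun phi -> forall i j,
   charge_integral (E i j) Omega phi +
   \int[L2]_(x in Omega)
      (2^-1 * (coord2 (v x) i * partial j phi x + coord2 (v x) j * partial i phi x)) =
   \int[@hausdorff1_measure R]_(x in bdry Omega)
      (phi x * odot (T x) (outward_normal Omega x) i j)].

(* A(w). On the Dirichlet part, w - u stands for the trace of the BD
   function w - u. *)
Definition admissible Omega (Gamma0 : set (plane R)) w u e (p : measmat) :=
  [/\ BD Omega u, L2sym Omega e, MbD Omega p,
   (exists2 E, sym_grad Omega u E &
      forall A : set (mplane R), measurable A -> A `<=` Omega -> forall i j,
      E i j A = (\int[L2]_(x in A) (e x i j)%:E + p i j A)%E) &
   (exists2 T, BD_trace Omega (fun x => w x - u x) T &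
      forall A : set (mplane R), measurable A -> A `<=` Gamma0 -> forall i j,
      p i j A = (\int[@hausdorff1_measure R]_(x in A)
                   (odot (T x) (outward_normal Omega x) i j)%:E)%E)].

(* A_reg(w); the measure with density [q] is extended by 0 to the closure. *)
Definition admissible_reg Omega (Gamma0 : set (plane R)) w u e
    (q : plane R -> 'M[R]_2) :=
  [/\ L1mat Omega q, W11loc Omega u &
   exists2 p : measmat, admissible Omega Gamma0 w u e p &
     forall A : set (mplane R), measurable A -> forall i j,
     p i j A = (\int[L2]_(x in A `&` Omega) (q x i j)%:E)%E].

End function_spaces.

Notation Xi R := ('M[R]_2 * R)%type (only parsing).
(* Points (x, xi, eta) with xi in Xi^m. *)
Notation gypoint R m := (plane R * 'rV[Xi R]_m * R)%type (only parsing).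

Section young.
Variable R : realType.
Variable Omega : set (plane R).

Local Notation L2 := (lebesgue2 R).
Local Notation measR := (charge (mplane R) R).
Local Notation measmat := (measmat R).

(* An element of M_* is its action on functions; only its action on C^hom is
   relevant. *)
Definition functional m := (gypoint R m -> R) -> R.

Definition gydom m : set (gypoint R m) :=
  [set y : gypoint R m | closure Omega y.1.1 /\ forall i, MD (y.1.2 ord0 i).1].

Definition gyscale m (s : R) (y : gypoint R m) : gypoint R m :=
  (y.1.1, \row_i (s *: (y.1.2 ord0 i).1, s * (y.1.2 ord0 i).2), s * y.2).

Definition Xinorm2 m (q : 'rV[Xi R]_m) : R :=
  \sum_i (inner (q ord0 i).1 (q ord0 i).1 + (q ord0 i).2 ^+ 2).

Definition gysphere m : set (gypoint R m) :=
  [set y : gypoint R m | gydom y /\ Xinorm2 y.1.2 + y.2 ^+ 2 = 1].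

Definition Chom m (f : gypoint R m -> R) :=
  {within @gydom m, continuous f} /\
  forall s y, 0 <= s -> gydom y -> f (gyscale s y) = s * f y.

Definition Mstar m (F : functional m) :=
  (forall a f g, Chom f -> Chom g -> F (fun y => a * f y + g y) = a * F f + F g) /\
  exists2 C : R, 0 <= C & forall f, Chom f -> forall M : R, 0 <= M ->
    (forall y, gysphere y -> `|f y| <= M) -> `|F f| <= C * M.

Definition GY m (F : functional m) :=
  [/\ Mstar F,
      forall f, Chom f -> (forall y, gydom y -> 0 <= f y) -> 0 <= F f,
      forall f, Chom f -> (forall y, gydom y -> 0 <= y.2 -> f y = 0) -> F f = 0 &
      forall phi : plane R -> R, {within closure Omega, continuous phi} ->
        F (fun y => phi y.1.1 * y.2) = \int[L2]_(x in Omega) phi x].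

Definition gy_cvg m (Fs : nat -> functional m) (F : functional m) :=
  forall f, Chom f -> (fun k => Fs k f) @ \oo --> F f.

Definition represents m
    (lambda : {measure set (g_sigma_algebraType (@open (gypoint R m))) -> \bar R})
    (F : functional m) :=
  [/\ (lambda setT < +oo)%E, lambda (~` @gysphere m) = 0%E &
      forall f, Chom f -> F f = \int[lambda]_(y in @gysphere m) f y].

(* Extension of the pairing to homogeneous Borel functions. *)
Definition pairing m (F : functional m) (f : gypoint R m -> R) : R :=
  xget 0 [set r | exists2 lambda, represents lambda F &
                    r = \int[lambda]_(y in @gysphere m) f y].

(* delta_q and omega_q^{L^2} for a function q in L^1. *)
Definition delta m (q : plane R -> 'rV[Xi R]_m) : functional m :=
  fun f => \int[L2]_(x in Omega) f (x, q x, 1).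

Definition omega m (q : plane R -> 'rV[Xi R]_m) : functional m :=
  fun f => \int[L2]_(x in Omega) f (x, q x, 0).

(* The measure ((p_1, z_1), ..., (p_m, z_m)) has absolutely continuous part
   [qa], total variation [nu] of the singular part, and [h] is the density of
   the singular part with respect to [nu]. *)
Definition lebesgue_decomposition m (p : 'I_m -> measmat) (z : 'I_m -> measR)
    (qa h : plane R -> 'rV[Xi R]_m) (nu : {measure set (mplane R) -> \bar R}) :=
  [/\ forall i, L1mat Omega (fun x => (qa x ord0 i).1) /\
                L1fun Omega (fun x => (qa x ord0 i).2),
      [/\ (nu setT < +oo)%E, nu (~` closure Omega) = 0%E &
          exists N : set (mplane R), [/\ measurable N, L2 N = 0%E & nu (~` N) = 0%E]],
      (forall i (a b : 'I_2), measurable_fun setT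
          ((fun x => (h x ord0 i).1 a b) : mplane R -> R)) /\
      (forall i, measurable_fun setT ((fun x => (h x ord0 i).2) : mplane R -> R)),
      {ae nu, forall x : mplane R, Xinorm2 (h x) = 1} &
      forall A : set (mplane R), measurable A -> A `<=` closure Omega -> forall i,
        (forall a b : 'I_2, p i a b A =
           \int[L2]_(x in A `&` Omega) ((qa x ord0 i).1 a b)%:E +
           \int[nu]_(x in A) ((h x ord0 i).1 a b)%:E)%E /\
        (z i A = \int[L2]_(x in A `&` Omega) ((qa x ord0 i).2)%:E +
           \int[nu]_(x in A) ((h x ord0 i).2)%:E)%E].

(* [F] is delta_q for the bounded measure q = ((p_1, z_1), ..., (p_m, z_m)). *)
Definition is_delta m (p : 'I_m -> measmat) (z : 'I_m -> measR) (F : functional m) :=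
  exists qa h nu, lebesgue_decomposition p z qa h nu /\
    forall f, Chom f ->
      F f = delta qa f + \int[nu]_(x in closure Omega) f (x, h x, 0).

Definition system := forall m, m.-tuple R -> functional m.

Definition times (Theta : set R) m (ts : m.-tuple R) :=
  [/\ (0 < m)%N, sorted <%R ts & forall i, Theta (tnth ts i)].

Definition gyproj m n (j : 'I_n -> 'I_m) (y : gypoint R m) : gypoint R n :=
  (y.1.1, \row_i y.1.2 ord0 (j i), y.2).

Definition SGY (Theta : set R) (mu : system) :=
  (forall m (ts : m.-tuple R), times Theta ts -> GY (mu m ts)) /\
  (forall m n (ts : m.-tuple R) (j : 'I_n -> 'I_m), times Theta ts ->
     let ss := [tuple tnth ts (j i) | i < n] in times Theta ss ->
     forall f, Chom f -> mu n ss f = mu m ts (f \o gyproj j)).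

(* Supremum over a = t_0 < ... < t_k = b of the sums of
   <g(xi_i - xi_{i-1}, theta_i - theta_{i-1}), mu_{t_{i-1} t_i}>. *)
Definition variation_of (g : Xi R -> R) (mu : system) (a b : R) : \bar R :=
  ereal_sup [set x | exists s : seq R, [/\ path <%R a s, last a s = b &
    x = (\sum_(i < size s)
           mu 2%N [tuple nth 0 (a :: s) i; nth 0 s i]
             (fun y => g (y.1.2 ord0 ord_max - y.1.2 ord0 ord0)))%:E]].

Definition AY (Gamma0 : set (plane R)) (Theta : set R)
    (w u : R -> plane R -> plane R) (e : R -> plane R -> 'M[R]_2) (mu : system) :=
  [/\ forall t, Theta t -> BD Omega (u t), forall t, Theta t -> L2sym Omega (e t),
      SGY Theta mu &
      forall m (ts : m.-tuple R), times Theta ts ->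
      exists (us : 'I_m -> nat -> plane R -> plane R)
        (es : 'I_m -> nat -> plane R -> 'M[R]_2)
        (ps : 'I_m -> nat -> measmat) (zs : 'I_m -> nat -> measR)
        (Fs : nat -> functional m),
      [/\ forall i k, admissible Omega Gamma0 (w (tnth ts i)) (us i k) (es i k) (ps i k)
                      /\ Mb Omega (zs i k),
          forall i, BD_weakstar Omega (us i) (u (tnth ts i)),
          forall i, L2_strong Omega (es i) (e (tnth ts i)),
          forall k, is_delta (ps ^~ k) (zs ^~ k) (Fs k) &
          gy_cvg Fs (mu m ts)]].

End young.

Section evolution.
Variable R : realType.
Variables (Omega Gamma0 : set (plane R)) (C : 'M[R]_2 -> 'M[R]_2).
Variables (K : set (Xi R)) (V : R -> R).

Local Notation L2 := (lebesgue2 R).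

Definition Hdiss (v : Xi R) : R :=
  sup [set inner s.1 v.1 + s.2 * v.2 | s in K].

Definition Hcal (p : plane R -> 'M[R]_2) (z : plane R -> R) : R :=
  \int[L2]_(x in Omega) Hdiss (p x, z x).

Definition Vinfty (theta : R) : R := lim (V (t * theta) / t @[t --> +oo]).

Definition Vpersp (theta eta : R) : R :=
  if 0 < eta then eta * V (theta / eta) else Vinfty theta.

Definition Qel (e : plane R -> 'M[R]_2) : R :=
  2^-1 * \int[L2]_(x in Omega) inner (C (e x)) (e x).

Definition DH (mu : system R) a b := variation_of Hdiss mu a b.

Definition Var (mu : system R) a b :=
  variation_of (fun v : Xi R => Num.sqrt (inner v.1 v.1 + v.2 ^+ 2)) mu a b.

(* <{V}(theta, eta), mu_t> *)
Definition softening (mu : system R) (t : R) : R :=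
  mu 1%N [tuple t] (fun y => Vpersp (y.1.2 ord0 ord0).2 y.2).

(* <{V}(theta + eta z(x), eta), mu_t> *)
Definition softening_shift (mu : system R) (t : R) (z : plane R -> R) : R :=
  pairing Omega (mu 1%N [tuple t])
    (fun y => Vpersp ((y.1.2 ord0 ord0).2 + y.2 * (z \_ Omega) y.1.1) y.2).

Definition nonneg : set R := [set t | 0 <= t].

Definition left_continuous (u : R -> plane R -> plane R)
    (e : R -> plane R -> 'M[R]_2) (mu : system R) :=
  (forall t (s : nat -> R), (forall k, 0 <= s k <= t) -> s @ \oo --> t ->
     BD_weakstar Omega (fun k => u (s k)) (u t) /\
     L2_weak Omega (fun k => e (s k)) (e t)) /\
  (forall m (t : m.-tuple R) (s : nat -> m.-tuple R), times nonneg t ->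
     (forall k, times nonneg (s k)) -> (forall k i, tnth (s k) i <= tnth t i) ->
     (forall i, (fun k => tnth (s k) i) @ \oo --> tnth t i) ->
     gy_cvg Omega (fun k => mu m (s k)) (mu m t)).

(* [w] belongs to AC_loc([0, +oo); H^1(Omega; R^2)), and [Dw t] is the weak
   gradient of [w t]. *)
Definition ACloc_H1 (w : R -> plane R -> plane R) (Dw : R -> plane R -> 'M[R]_2) :=
  (forall t, 0 <= t -> H1vec Omega (w t) (Dw t)) /\
  forall T eps : R, 0 < T -> 0 < eps -> exists2 del : R, 0 < del &
  forall n (a b : 'I_n -> R), (forall i, 0 <= a i <= b i /\ b i <= T) ->
    (forall i j, i != j -> `]a i, b i[ `&` `]a j, b j[ = set0) ->
    \sum_i (b i - a i) < del ->
    \sum_i H1norm Omega (fun x => w (b i) x - w (a i) x)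
                        (fun x => Dw (b i) x - Dw (a i) x) < eps.

(* [wd t] is the derivative of [w] in H^1 for a.e. t > 0, and [Dwd t] is its
   weak gradient. *)
Definition H1_derivative (w wd : R -> plane R -> plane R)
    (Dw Dwd : R -> plane R -> 'M[R]_2) :=
  {ae @lebesgue_measure R, forall t : R, 0 < t ->
    H1vec Omega (wd t) (Dwd t) /\
    (fun h => H1norm Omega
       (fun x => h^-1 *: (w (t + h) x - w t x) - wd t x)
       (fun x => h^-1 *: (Dw (t + h) x - Dw t x) - Dwd t x)) @ 0^' --> (0 : R)}.

Definition global_stability (e : R -> plane R -> 'M[R]_2) (mu : system R) :=
  forall t, 0 <= t ->
  forall (tu : plane R -> plane R) (te tp : plane R -> 'M[R]_2) (tz : plane R -> R),
  admissible_reg Omega Gamma0 (fun=> 0) tu te tp -> L1fun Omega tz ->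
  Qel (e t) + softening mu t <=
  Qel (fun x => e t x + te x) + Hcal tp tz + softening_shift mu t tz.

Definition energy_balance (Dwd : R -> plane R -> 'M[R]_2)
    (e : R -> plane R -> 'M[R]_2) (mu : system R) :=
  forall T, 0 < T -> (Var mu 0 T < +oo)%E /\
  ((Qel (e T))%:E + DH mu 0 T + (softening mu T)%:E =
   (Qel (e 0) + softening mu 0 +
    \int[@lebesgue_measure R]_(t in `[0, T])
      \int[L2]_(x in Omega) inner (C (e t x)) (sympart (Dwd t x)))%:E)%E.

Definition quasistatic_evolution (w u : R -> plane R -> plane R)
    (e : R -> plane R -> 'M[R]_2) (mu : system R) :=
  [/\ AY Omega Gamma0 nonneg w u e mu,
      left_continuous u e mu,
      global_stability e mu &
      exists Dw wd Dwd, [/\ ACloc_H1 w Dw, H1_derivative w wd Dw Dwd &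
                            energy_balance Dwd e mu]].

End evolution.

Section example.
Variable R : realType.

Definition Kball : set (Xi R) :=
  [set s | MD s.1 /\ inner s.1 s.1 + s.2 ^+ 2 <= 1].

Definition Vsoft (theta : R) : R := 2^-1 - 2^-1 * Num.sqrt (1 + theta ^+ 2).

Definition alpha (t0 t : R) : R := if t <= t0 then t else t0.

Definition beta (t0 t : R) : R := if t <= t0 then 0 else t - t0.

End example.

(* Main.v *)
Require Import Defs.
From HB Require Import structures.
From mathcomp Require Import all_boot all_order all_algebra.
From mathcomp Require Import all_classical all_reals all_analysis.
From mathcomp Require Import measurable_realfun ring lra.

Import Order.TTheory GRing.Theory Num.Theory numFieldNormedType.Exports.
Local Open Scope classical_set_scope.
Local Open Scope ring_scope.

Set Implicit Arguments.
Unset Strict Implicit.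
Unset Printing Implicit Defensive.

(** The matrix [sympart xi0], being symmetric and trace-free, is a simple shear
    [odot v1 v2].  The plastic strain [beta t *: sympart xi0] is therefore the limit
    of displacements [w + (beta t * g * psi) v1], where [psi] is a cutoff and [g] is a
    small function of [dot2 v2 x] with slope [r+ + r- - 1], the functions [r+] and
    [r-] being large on two disjoint families of thin bands.  The internal variable is
    [theta0 +- zinf * psi * r+-] on these bands, so that softening compensates.  By
    homogeneity [f (x, r q + c, 1) - f (x, c, 1)] is [r * f (x, q, 0)] up to an error
    which is small with respect to [r] for large [r], hence each family
    produces one half of the measure [omega].

    Stability: shifting [theta] by [z] lowers the softening energy by at most
    [|z| / 2], while [Hdiss (p, z) >= 2 mu alpha (A : p) + |z| / 2] because
    [2 mu alpha |A| <= sqrt 3 / 2]; the elastic energy contributes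
    [2 mu alpha (A : e)], and the mean of [e + p] vanishes by the Green formula.
    The shift being only integrable, the pairing is computed with the projection on
    Omega of [|eta|] times the representing measure, which is Lebesgue measure.

    Energy balance: the loading is proportional, so all variation sums telescope. *)

(** * Lebesgue measure on the plane *)

(** The constants come from the slope of [Vsoft] at infinity, which is 1/2 in absolute value. On the
    concentrated parts the internal force is therefore 1/2 in absolute value, and a stress of norm s
    is compatible with [Kball] as long as s^2 + 1/4 <= 1. With A for [sympart xi0], the elastic
    stress 2 mu t |A| reaches the bound sqrt 3 / 2 exactly at t0. The normal to the ball at (sqrt 3
    / 2, 1/2) has slope 1 / sqrt 3, whence [zinf]. The slip must not disturb the boundary datum,
    hence the cutoff, whose gradient may blow up near the boundary. This dictates the order of the
    choices: the cutoff, then the frequency of the bands, then their thinness. Each of r+ and r- has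
    mean 1/2, so r+ + r- - 1 has mean zero and admits a small primitive g. In the stability
    inequality the representing measure chosen by [pairing] is unknown, so the lower bound has to be
    proved for every representing measure. *)

Section plane_measure.
Variable R : realType.
Implicit Types (U D : set (plane R)) (f g : plane R -> R).
Local Notation L2 := (lebesgue2 R).

Definition rational_box (n : nat) : (plane R * R)%type :=
  if unpickle n is Some (a, b, r) then ((ratr a, ratr b), ratr (r : rat))
  else ((0, 0), 0).

Lemma ball_meas (x r : R) : measurable (ball x r).
Proof.
rewrite (_ : ball x r = `]x - r, x + r[%classic); first exact: measurable_itv.
by apply/seteqP; split => y; rewrite /ball/= in_itv/= ltr_norml; lra.
Qed.

(** The square of doubled radius has to lie in [U] because in [smooth_cutoff] the bump that is
    positive on the square has a larger support, which must still be inside the open set. *)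
Lemma rational_box_in U (x : plane R) : open U -> U x ->
  exists n, let b := rational_box n in
    [/\ 0 < b.2, ball b.1 b.2 x & ball b.1 (2 * b.2) `<=` U].
Proof.
move=> oU Ux.
have /nbhs_ballP[e /= e0 eU] : nbhs x U by exact: open_nbhs_nbhs.
have e40 : 0 < e / 4 by rewrite divr_gt0.
have [r] := @rat_in_itvoo R 0 (e/4) e40.
rewrite in_itv/= => /andP[r0 re].
have xlt (t : R) : t - ratr r < t + ratr r by lra.
have [a] := @rat_in_itvoo R _ _ (xlt x.1).
have [b] := @rat_in_itvoo R _ _ (xlt x.2).
rewrite !in_itv/= => /andP[b1 b2] /andP[a1 a2].
exists (pickle (a, b, r)); rewrite /rational_box pickleK /=; split => //.
  by split => /=; rewrite /ball /= ltr_norml; lra.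
move=> y [/= y1 y2]; apply: eU; split => /=; move: y1 y2;
  rewrite /ball/= !ltr_norml; lra.
Qed.

(** An open set is the countable union of the rational squares that it contains, and a square, being
    a ball for the sup norm, is a product of intervals. This connects the product sigma-algebra with
    the topology. *)
Lemma open_measurable2 U : open U -> measurable (U : set (mplane R)).
Proof.
move=> oU.
pose F n := if `[< ball (rational_box n).1 (rational_box n).2 `<=` U >]
  then ball (rational_box n).1 (rational_box n).2 else set0.
have -> : U = \bigcup_n F n.
  apply/seteqP; split => [x Ux|x [n _]].
    have [n [b0 bx bU]] := rational_box_in oU Ux.
    exists n => //; rewrite /F asboolT// => y yb; apply: bU.
    by apply: le_ball yb; lra.
  by rewrite /F; case: asboolP => // + ?; apply.
apply: bigcupT_measurable => n; rewrite /F; case: asboolP => _; last exact: measurable0.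
set b := rational_box n.
rewrite (_ : ball b.1 b.2 = ball b.1.1 b.2 `*` ball b.1.2 b.2)//.
by apply: measurableX; exact: ball_meas.
Qed.

Lemma closed_measurable2 U : closed U -> measurable (U : set (mplane R)).
Proof.
move=> cU; rewrite -(setCK U); apply: measurableC; apply: open_measurable2.
exact: closed_openC.
Qed.

Lemma continuous_measurable2 D f : open D -> (forall x, D x -> {for x, continuous f}) ->
  measurable_fun (D : set (mplane R)) (f : mplane R -> R).
Proof.
move=> oD cf; apply: (measurability _ (RGenOpens.measurableE R)).
move=> _ [_ [a [b ->] <-]].
apply: open_measurable2; rewrite openE => x [Dx fx].
have : nbhs x (D `&` f @^-1` `]a, b[).
  apply: filterI; first exact: open_nbhs_nbhs.
  by apply: (cf x Dx); apply: open_nbhs_nbhs; split => //; exact: interval_open.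
by [].
Qed.

Lemma continuous_measurable2T f : continuous f ->
  measurable_fun [set: mplane R] (f : mplane R -> R).
Proof. by move=> cf; apply: continuous_measurable2 => [|x _]; [exact: openT|exact: cf]. Qed.

Lemma lebesgue2X (A B : set (measurableTypeR R)) : measurable A -> measurable B ->
  L2 (A `*` B) = (@lebesgue_measure R A * @lebesgue_measure R B)%E.
Proof. exact: product_measure1E. Qed.

Lemma lebesgue2_ball_fin (x : plane R) (r : R) : (L2 (ball x r) < +oo)%E.
Proof.
have -> : L2 (ball x r) = (@lebesgue_measure R (ball x.1 r) *
    @lebesgue_measure R (ball x.2 r))%E.
  by apply: lebesgue2X; exact: ball_meas.
have [r0|r0] := leP 0 r.
  by rewrite !lebesgue_measure_ball// -EFinM ltry.
rewrite (_ : ball x.1 r = set0) ?measure0 ?mul0e//.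
apply/seteqP; split => // y; rewrite /ball/=; move: (normr_ge0 (x.1 - y)); lra.
Qed.

Lemma lebesgue2_sigma_finite : sigma_finite [set: mplane R] L2.
Proof.
exists (fun n => ball (0 : plane R) n%:R); last first.
  move=> n; split; last exact: lebesgue2_ball_fin.
  by apply: open_measurable2; exact: ball_open.
apply/seteqP; split => // x _; exists (Num.truncn `|x|).+1 => //.
by rewrite -ball_normE /= sub0r normrN; exact: Num.Theory.truncnS_gt.
Qed.

(** A bare set function equal to [lebesgue2], to which the sigma-finite structure required by the
    Radon-Nikodym theorem is attached. *)
Definition lebesgue2_fun : set (mplane R) -> \bar R := Measure.sort L2.
HB.instance Definition _ := Measure.on lebesgue2_fun.
HB.instance Definition _ :=
  Measure_isSigmaFinite.Build _ _ _ lebesgue2_fun lebesgue2_sigma_finite.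

Lemma bounded_lebesgue2_fin D : measurable (D : set (mplane R)) ->
  bounded_set D -> (L2 D < +oo)%E.
Proof.
move=> mD [M [_ MD]].
have /MD DM : M < `|M| + 1 by rewrite (le_lt_trans (ler_norm _))// ltrDl.
apply: le_lt_trans (lebesgue2_ball_fin 0 (`|M| + 2)).
apply: le_measure; rewrite ?inE//.
  rewrite (_ : ball _ _ = ball (0:R) (`|M| + 2) `*` ball (0:R) (`|M| + 2))//.
  by apply: measurableX; exact: ball_meas.
move=> x /DM /= xM; rewrite -ball_normE /= sub0r normrN.
by apply: (le_lt_trans xM); lra.
Qed.

Lemma bounded_L1fun D f (M : R) : measurable (D : set (mplane R)) -> (L2 D < +oo)%E ->
  measurable_fun (D : set (mplane R)) (f : mplane R -> R) ->
  (forall x, D x -> `|f x| <= M) -> L1fun D f.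
Proof.
move=> mD D0 mf fM; apply: (@le_integrable _ _ _ L2 D mD _ (EFin \o cst M)).
- exact/measurable_EFinP.
- by move=> x Dx; rewrite lee_fin/= (le_trans (fM _ Dx))// ler_norm.
- apply/integrableP; split; first by apply/measurable_EFinP; exact: measurable_cst.
  rewrite [ltLHS](_ : _ = (`|M|%:E * L2 D)%E); last by rewrite -integral_cst.
  by rewrite lte_mul_pinfty// lee_fin.
Qed.

Lemma L1funZ D f (r : R) : measurable (D : set (mplane R)) -> L1fun D f ->
  L1fun D (fun x => r * f x).
Proof. by move=> mD; exact: (integrableZl mD). Qed.

Lemma L1funD D f g : measurable (D : set (mplane R)) -> L1fun D f -> L1fun D g ->
  L1fun D (fun x => f x + g x).
Proof. by move=> mD; exact: (integrableD mD). Qed.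

Lemma L1funB D f g : measurable (D : set (mplane R)) -> L1fun D f -> L1fun D g ->
  L1fun D (fun x => f x - g x).
Proof. by move=> mD; exact: (integrableB mD). Qed.

Lemma L1funS D E f : measurable (D : set (mplane R)) -> measurable (E : set (mplane R)) ->
  E `<=` D -> L1fun D f -> L1fun E f.
Proof. by move=> mD mE ED; exact: (integrableS mD mE ED). Qed.

Lemma L1fun_measurable D f : L1fun D f ->
  measurable_fun (D : set (mplane R)) (f : mplane R -> R).
Proof. by move=> /measurable_int/measurable_EFinP. Qed.

Lemma L1fun_bounded_mul D f g (M : R) : measurable (D : set (mplane R)) ->
  measurable_fun (D : set (mplane R)) (f : mplane R -> R) ->
  (forall x, D x -> `|f x| <= M) -> L1fun D g -> L1fun D (fun x => f x * g x).
Proof.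
move=> mD mf fM ig; have mg := L1fun_measurable ig.
apply: (@le_integrable _ _ _ L2 D mD _ (EFin \o (fun x => M * g x))).
- by apply/measurable_EFinP; exact: measurable_funM.
- move=> x Ax; rewrite lee_fin/= !normrM ler_wpM2r//.
  by rewrite (le_trans (fM _ Ax))// ler_norm.
- exact: L1funZ.
Qed.

Let measurable_shift (r : R) :
  measurable_fun setT (fun y : measurableTypeR R => y + r : measurableTypeR R).
Proof.
by apply: (@measurable_funD _ (measurableTypeR R) R setT id (cst r)) => //; exact: measurable_cst.
Qed.

Lemma measurable_shift2 (v : plane R) :
  measurable_fun setT (fun x : mplane R => (x + v : mplane R)).
Proof.
apply/measurable_fun_pairP; split.
  apply: (@measurableT_comp _ _ _ _ _ _ (fun y : measurableTypeR R => y + v.1) _ fst).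
    exact: measurable_shift.
  exact: measurable_fst.
apply: (@measurableT_comp _ _ _ _ _ _ (fun y : measurableTypeR R => y + v.2) _ snd).
  exact: measurable_shift.
exact: measurable_snd.
Qed.

(** Two uniqueness theorems: that of Lebesgue measure on half-open intervals for each factor, then
    that of the product measure on rectangles. *)
Lemma lebesgue2_shift (v : plane R) (A : set (mplane R)) : measurable A ->
  L2 ((fun x => x + v) @^-1` A) = L2 A.
Proof.
pose ph (r : R) : {mfun measurableTypeR R >-> measurableTypeR R} :=
  HB.pack (fun y : measurableTypeR R => y + r : measurableTypeR R)
    (isMeasurableFun.Build _ _ _ _ _ (measurable_shift r)).
have sh1 (r : R) (B : set (measurableTypeR R)) : measurable B ->
    lebesgue_measure ((fun y => y + r) @^-1` B) = lebesgue_measure B.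
  move=> mB; apply/esym.
  apply: (@lebesgue_measure_unique R (pushforward (@lebesgue_measure R) (ph r))) => //.
  move=> _ [[a b] _ <-].
  change (lebesgue_measure `]a, b]%classic =
    lebesgue_measure ((fun y : measurableTypeR R => y + r) @^-1` `]a, b]%classic)).
  rewrite (_ : _ @^-1` _ = `]a - r, b - r]%classic).
    by rewrite !lebesgue_measure_itv/= !lte_fin ltrD2r -!EFinD opprD opprK addrACA addNr addr0.
  by apply/seteqP; split => y; rewrite /= !in_itv/= lerBrDr ltrBlDr.
move=> mA; apply/esym.
pose pv : {mfun mplane R >-> mplane R} :=
  HB.pack (fun x : mplane R => x + v : mplane R) (isMeasurableFun.Build _ _ _ _ _ (measurable_shift2 v)).
apply: (@product_measure_unique _ _ _ _ R lebesgue_measure lebesgue_measure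
    (pushforward L2 pv)) => // B C mB mC.
change (L2 ((fun x : mplane R => (x + v)%R) @^-1` (B `*` C)) =
  lebesgue_measure B * lebesgue_measure C)%E.
rewrite (_ : _ @^-1` _ = ((fun y => y + v.1) @^-1` B) `*`
   ((fun y => y + v.2) @^-1` C))//.
apply: etrans (lebesgue2X _ _) _; last by rewrite !sh1.
  by have := @measurable_shift v.1 measurableT B mB; rewrite setTI.
by have := @measurable_shift v.2 measurableT C mC; rewrite setTI.
Qed.

Lemma Rintegral_shift f (v : plane R) : measurable_fun [set: mplane R] (f : mplane R -> R) ->
  L1fun setT (fun x => f (x + v)) -> \int[L2]_x f (x + v) = \int[L2]_x f x.
Proof.
move=> mf intf.
pose pv : {mfun mplane R >-> mplane R} :=
  HB.pack (fun x : mplane R => x + v : mplane R)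
    (isMeasurableFun.Build _ _ _ _ _ (measurable_shift2 v)).
have L2E (A : set (mplane R)) : measurable A -> A `<=` setT -> pushforward L2 pv A = L2 A.
  by move=> mA _; exact: lebesgue2_shift.
have mfE : measurable_fun [set: mplane R] (EFin \o f) by exact/measurable_EFinP.
have h := integral_pushforward (measurable_shift2 v) mfE (D := setT) intf measurableT.
by rewrite [RHS]/Rintegral -(eq_measure_integral L2 L2E) h.
Qed.

Lemma Rintegral_dct d (T : measurableType d) (m : {measure set T -> \bar R}) (D : set T)
    (F : nat -> T -> R) (f g : T -> R) :
  measurable D -> (forall n, measurable_fun D (F n)) ->
  (forall x, D x -> F ^~ x @ \oo --> f x) ->
  m.-integrable D (EFin \o g) -> (forall n x, D x -> `|F n x| <= g x) ->
  m.-integrable D (EFin \o f) /\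
  (fun n => \int[m]_(x in D) F n x) @ \oo --> \int[m]_(x in D) f x.
Proof.
move=> mD mF Ff ig Fg.
have mf : measurable_fun D f by exact: measurable_fun_cvg Ff.
have [] := @dominated_convergence _ T R m D mD (fun n => EFin \o F n) (EFin \o f) (EFin \o g).
- by move=> n; exact/measurable_EFinP.
- exact/measurable_EFinP.
- by apply: aeW => x Dx; apply: cvg_EFin; [exact: nearW|exact: Ff].
- by [].
- by apply: aeW => x n Dx /=; rewrite lee_fin; exact: Fg.
move=> intf _ cvi; split => //.
apply: fine_cvg; rewrite fineK//.
exact: integrable_fin_num.
Qed.

(** The Radon-Nikodym derivative of [nu] and the density [g] have the same integral over every
    measurable set, hence coincide almost everywhere, and the change of variables formula holds with
    [g]. *)
Lemma integral_density d (T : measurableType d) (nu : {finite_measure set T -> \bar R})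
    (m : {sigma_finite_measure set T -> \bar R}) (g f : T -> \bar R) (E : set T) :
  m.-integrable setT g -> (forall A, measurable A -> nu A = \int[m]_(x in A) g x)%E ->
  measurable E -> nu.-integrable E f ->
  (\int[nu]_(x in E) f x = \int[m]_(x in E) (f x * g x))%E.
Proof.
move=> ig nuE mE intf.
have numu : nu `<< m.
  apply/null_content_dominatesP => A mA mA0; rewrite nuE//.
  by apply: null_set_integral => //; apply: measurable_funTS; exact: measurable_int ig.
rewrite -(Radon_Nikodym_change_of_variables numu)//.
have iRN := @Radon_Nikodym_integrable _ _ _ (charge_of_finite_measure nu) m numu.
have mRN := measurable_int _ iRN.
have mg := measurable_int _ ig; have mf := measurable_int _ intf.
apply: ae_eq_integral => //.
- by apply: emeasurable_funM => //; exact: measurable_funTS.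
- by apply: emeasurable_funM => //; exact: measurable_funTS.
apply: ae_eqe_mul2l.
apply: integral_ae_eq => //.
- exact: (integrableS measurableT _ _ iRN).
- exact: measurable_funTS.
by move=> A AE mA; rewrite -(@Radon_Nikodym_integral _ _ _ (charge_of_finite_measure nu))// -nuE.
Qed.

Definition density_charge (h : plane R -> R) (ih : L1fun setT h) : charge (mplane R) R :=
  induced_charge ih.

(** For the Hahn decomposition (P, N) chosen inside [charge_integral], the Jordan parts have the
    densities h on P and - h on N. Since P and N partition the plane, their contributions recombine
    into f h whatever the choice. *)
Lemma charge_integral_density (nu : charge (mplane R) R) (h : plane R -> R)
    (A : set (mplane R)) f (M : R) :
  L1fun setT h -> (forall B : set (mplane R), measurable B -> nu B = \int[L2]_(x in B) (h x)%:E)%E ->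
  measurable A -> measurable_fun A (f : mplane R -> R) ->
  (forall x, A x -> `|f x| <= M) ->
  charge_integral nu A f = \int[L2]_(x in A) (f x * h x).
Proof.
move=> ih nuE mA mf fM.
pose m : {sigma_finite_measure set (mplane R) -> \bar R} := lebesgue2_fun.
rewrite /charge_integral; set PN := cid _.
case: PN => -[P N] /= nuPN.
have mP : measurable P by have [[mP _] _ _ _] := nuPN.
have mN : measurable N by have [_ [mN _] _ _] := nuPN.
have restr (Q : set (mplane R)) : measurable Q -> L1fun setT (h \_ Q).
  move=> mQ; rewrite /L1fun.
  rewrite (_ : EFin \o _ = (EFin \o h) \_ Q); last by rewrite restrict_EFin.
  by apply/(integrable_mkcond _ mQ).1; apply: (integrableS measurableT _ _ ih).
have posE (B : set (mplane R)) : measurable B ->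
    jordan_pos nuPN B = (\int[m]_(x in B) (EFin \o (h \_ P)) x)%E.
  move=> mB; rewrite jordan_posE cjordan_posE /crestr0 mem_set// /crestr nuE; last first.
    exact: measurableI.
  by rewrite integral_mkcondr; apply: eq_integral => x _; rewrite restrict_EFin.
have negE (B : set (mplane R)) : measurable B ->
    jordan_neg nuPN B = (\int[m]_(x in B) (EFin \o (fun x => - (h \_ N) x)%R) x)%E.
  move=> mB; rewrite jordan_negE cjordan_negE /crestr0 mem_set// /crestr nuE; last first.
    exact: measurableI.
  have RE : (fun x => (h x)%:E) \_ N = EFin \o (h \_ N) by exact: restrict_EFin.
  have rN := integrableS measurableT mB (@subsetT _ _) (restr _ mN).
  by rewrite integral_mkcondr RE -integralN//; exact: integrable_add_def.
have iN : m.-integrable setT (EFin \o (fun x => - (h \_ N) x)).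
  have := L1funZ (-1) measurableT (restr _ mN); congr (integrable _ _ _).
  by apply/funext => x; rewrite /= mulN1r.
have bdi (k : {finite_measure set (mplane R) -> \bar R}) : k.-integrable A (EFin \o f).
  apply: (@le_integrable _ _ _ k A mA _ (EFin \o cst M)).
  - exact/measurable_EFinP.
  - by move=> x Ax; rewrite lee_fin/= (le_trans (fM _ Ax))// ler_norm.
  - exact: finite_measure_integrable_cst.
have fhi (g : plane R -> R) : L1fun setT g -> L1fun A (fun x => f x * g x).
  by move=> ig; apply: (L1fun_bounded_mul mA mf fM); exact: L1funS ig.
have iP : m.-integrable setT (EFin \o (h \_ P)) by exact: restr.
rewrite /= {1}/Rintegral (integral_density (nu := jordan_pos nuPN) iP posE mA (bdi _)).
rewrite [X in _ - X]/Rintegral (integral_density (nu := jordan_neg nuPN) iN negE mA (bdi _)).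
transitivity (\int[L2]_(x in A) (f x * (h \_ P) x) - \int[L2]_(x in A) (f x * - (h \_ N) x)).
  by [].
rewrite -RintegralB//; last 2 first.
- exact: fhi (restr _ mP).
- exact: (fhi (fun x => - (h \_ N) x)).
apply: eq_Rintegral => x _; rewrite -mulrBr opprK; congr (_ * _).
have [_ _ PNT PN0] := nuPN; rewrite /patch.
have : (P `|` N) x by rewrite PNT.
have : ~ (P `&` N) x by rewrite PN0.
case: ifPn; case: ifPn; rewrite ?(inE, notin_setE)/=; move=> ? ?; rewrite ?addr0 ?add0r//.
- by move=> /not_andP[].
- by move=> _ [].
Qed.

Lemma charge_integral1 (nu : charge (mplane R) R) (A : set (mplane R)) :
  measurable A -> charge_integral nu A (fun=> 1) = fine (nu A).
Proof.
move=> mA; rewrite /charge_integral; set PN := cid _.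
case: PN => -[P N] /= nuPN.
rewrite !Rintegral_cst// !mul1r (jordan_decomp nuPN mA) /cadd/= cscaleN1.
by rewrite fineB// fin_num_measure.
Qed.

Lemma charge_integral_cvg (nu : charge (mplane R) R) (A : set (mplane R))
    (F : nat -> plane R -> R) f (M : R) :
  measurable A -> (forall n, measurable_fun A (F n : mplane R -> R)) ->
  (forall n x, A x -> `|F n x| <= M) -> (forall x, A x -> F ^~ x @ \oo --> f x) ->
  (fun n => charge_integral nu A (F n)) @ \oo --> charge_integral nu A f.
Proof.
move=> mA mF FM Ff; rewrite /charge_integral; set PN := cid _.
case: PN => -[P N] /= nuPN.
have dct (k : {finite_measure set (mplane R) -> \bar R}) :
    (fun n => \int[k]_(x in A) F n x) @ \oo --> \int[k]_(x in A) f x.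
  have ik : k.-integrable A (EFin \o cst M) by exact: finite_measure_integrable_cst.
  by have [] := Rintegral_dct mA mF Ff ik FM.
by apply: cvgB; exact: dct.
Qed.

End plane_measure.

(** * Partial derivatives and integration by parts *)

Section partial_calculus.
Variable R : realType.
Implicit Types (f g : plane R -> R) (x v : plane R).

Lemma is_derive_line f x v d :
  is_derive x v f d <-> is_derive (0 : R) (1 : R) (fun t => f (t *: v + x)) d.
Proof.
have E : 'D_v f x = 'D_(1:R) (fun t : R => f (t *: v + x)) 0.
  rewrite /derive; set g1 := fun h => h^-1 *: _; set g2 := fun h => h^-1 *: _.
  suff -> : g1 = g2 by [].
  by rewrite funeqE /g1 /g2 => h /=; rewrite addr0 scale0r add0r [_%:A]mulr1.
split => -[dx dE]; apply: DeriveDef.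
- by have [+ _] := @derivable1P R _ _ f x v; apply.
- by rewrite -E.
- by have [_] := @derivable1P R _ _ f x v; apply.
- by rewrite E.
Qed.

Lemma is_derive_comp1 (h : R -> R) f x v (dh df : R) :
  is_derive (f x) (1 : R) h dh -> is_derive x v f df ->
  is_derive x v (h \o f) (dh * df).
Proof.
move=> hd fd; apply/is_derive_line.
move/is_derive_line : fd => fd.
apply: is_derive1_comp => //.
by rewrite scale0r add0r.
Qed.

Lemma is_derive_lip f x v (M t : R) : (forall y, derivable f y v) ->
  (forall y, `|'D_v f y| <= M) -> `|f (x + t *: v) - f x| <= M * `|t|.
Proof.
move=> df dfM.
pose F (s : R) := f (s *: v + x).
have dF (s : R) : is_derive s (1 : R) F ('D_v f (s *: v + x)).
  have E : (fun h : R => h^-1 *: ((F \o shift s) (h *: (1:R)) - F s)) =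
      (fun h : R => h^-1 *: ((f \o shift (s *: v + x)) (h *: v) - f (s *: v + x))).
    by apply/funext => h; rewrite /F/= [h *: 1]mulr1 scalerDl addrA.
  apply: DeriveDef; last by rewrite /derive -E.
  by rewrite /derivable E; exact: df.
have cF : continuous F.
  move=> s; apply: differentiable_continuous; apply/derivable1_diffP.
  by case: (dF s).
have lipF (a b : R) : a <= b -> `|F b - F a| <= M * (b - a).
  move=> ab.
  have [c _ ->] := @MVT_segment R F (fun s => 'D_v f (s *: v + x)) a b ab
    (fun s _ => dF s) (continuous_subspaceT cF).
  by rewrite normrM (ger0_norm (_ : 0 <= b - a)) ?subr_ge0// ler_wpM2r ?subr_ge0.
have E s : f (x + s *: v) = F s by rewrite /F addrC.
rewrite E -[in X in _ - X](addr0 x) -[X in x + X](scale0r v) E.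
have [t0|t0] := leP 0 t.
  by rewrite (le_trans (lipF _ _ t0))// subr0 ger0_norm.
by rewrite distrC (le_trans (lipF _ _ (ltW t0)))// sub0r ltr0_norm.
Qed.

Local Notation L2 := (lebesgue2 R).

(** Integration by parts at the level of difference quotients: translation invariance moves the
    increment from [G] to [F], so that [F] needs no derivative, only a bound on its increments times
    [G]. The limit is taken by dominated convergence, the quotients of [G] being bounded by [M]. It
    serves with C = 0 in [integral_partial0] and with a small [G] in [comb_weak_bound]. *)
Lemma diff_quotient_integral (F G : plane R -> R) v (r B B' M C : R) :
  measurable_fun setT (F : mplane R -> R) -> (forall x, `|F x| <= B) ->
  (forall x, r <= `|x| -> F x = 0) ->
  continuous G -> (forall x, `|G x| <= B') -> (forall x, derivable G x v) ->
  (forall x t, `|G (x + t *: v) - G x| <= M * `|t|) ->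
  (forall x t, 0 < t -> t <= 1 -> `|(F (x - t *: v) - F x) * G x| <= C * t) ->
  `|\int[L2]_x (F x * 'D_v G x)| <= C * fine (L2 (ball (0 : plane R) (r + `|v|))).
Proof.
move=> mF FB F0 cG GB dG GM FC.
pose d (n : nat) : R := n.+1%:R^-1.
have d0 n : 0 < d n by rewrite invr_gt0.
have d1 n : d n <= 1 by rewrite invf_le1// ler1n.
have mG : measurable_fun setT (G : mplane R -> R) by exact: continuous_measurable2T.
pose q n x := (d n)^-1 * (G (x + d n *: v) - G x).
have cGs (t : R) : continuous (fun x => G (x + t *: v)).
  move=> x; apply: (@continuous_comp _ _ _ (fun y : plane R => y + t *: v) G); last exact: cG.
  by apply: cvgD; [exact: cvg_id|exact: cvg_cst].
have mq n : measurable_fun setT (q n : mplane R -> R).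
  apply: measurable_funM; first exact: measurable_cst.
  by apply: measurable_funB => //; exact: continuous_measurable2T.
have qcvg x : q ^~ x @ \oo --> 'D_v G x.
  have /cvg_ex [l Dl] := dG x.
  rewrite /derive (cvg_lim _ Dl)//.
  have dn0 : d @ \oo --> (0:R)^'.
    move=> A; rewrite /dnbhs /within/= => A0.
    have : \forall n \near \oo, (d n != 0 -> A (d n)) by exact: cvg_harmonic A0.
    by apply: filterS => n; apply; rewrite gt_eqF.
  rewrite (_ : q ^~ x = (fun h => h^-1 *: ((G \o shift x) (h *: v) - G x)) \o d).
    exact: cvg_comp dn0 Dl.
  by apply/funext => n /=; rewrite /q [d n *: v + x]addrC.
(* A shift by at most [v] moves the support of [F] from the ball of radius r at most to radius r +
   |v|, so all integrals can be taken over that larger ball. *)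
have dx t x : 0 < t -> t <= 1 -> r + `|v| <= `|x| -> F (x - t *: v) = 0.
  move=> t0 t1 rx; apply: F0.
  have : `|x| <= `|x - t *: v| + `|t *: v| by rewrite -{1}(subrK (t *: v) x) ler_normD.
  rewrite normrZ gtr0_norm//; have := normr_ge0 v; nra.
pose D := ball (0 : plane R) (r + `|v|).
have mD : measurable (D : set (mplane R)) by apply: open_measurable2; exact: ball_open.
have nD x : ~ D x -> r + `|v| <= `|x|.
  by rewrite /D -ball_normE /= sub0r normrN => /negP; rewrite -leNgt.
have nDF x : ~ D x -> F x = 0 by move=> /nD rx; apply: F0; have := normr_ge0 v; lra.
have toD (H : plane R -> R) : (forall x, ~ D x -> H x = 0) ->
    \int[L2]_x H x = \int[L2]_(x in D) H x.
  move=> H0; rewrite [RHS]Rintegral_mkcond; congr Rintegral; apply/funext => x.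
  by rewrite patchE; case: ifPn => //; rewrite notin_setE => /H0.
have iD (H : plane R -> R) (N : R) : measurable_fun setT (H : mplane R -> R) ->
    (forall x, `|H x| <= N) -> L1fun D H.
  move=> mH HN; apply: (@bounded_L1fun _ D H N) => //.
    exact: lebesgue2_ball_fin.
  exact: measurable_funTS.
have iT (H : plane R -> R) (N : R) : measurable_fun setT (H : mplane R -> R) ->
    (forall x, `|H x| <= N) -> (forall x, ~ D x -> H x = 0) -> L1fun setT H.
  move=> mH HN H0; have := iD _ _ mH HN => /(integrable_mkcond _ mD).1.
  congr (integrable _ _ _); apply/funext => x.
  by rewrite patchE; case: ifPn => //; rewrite notin_setE /= => /H0 ->.
have B0 : 0 <= B by apply: le_trans (FB 0).
have B'0 : 0 <= B' by apply: le_trans (GB 0).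
have mFs (t : R) : measurable_fun setT (fun x : mplane R => F (x - t *: v)).
  by apply: (measurableT_comp mF); exact: (measurable_shift2 (- (t *: v))).
have step n : \int[L2]_(x in D) (F x * q n x) =
    \int[L2]_(x in D) ((d n)^-1 * ((F (x - d n *: v) - F x) * G x)).
  have iFG (H K : plane R -> R) : measurable_fun setT (H : mplane R -> R) ->
      measurable_fun setT (K : mplane R -> R) -> (forall x, `|H x| <= B) ->
      (forall x, `|K x| <= B') -> (forall x, ~ D x -> H x = 0) ->
      L1fun setT (fun x => H x * K x).
    move=> mH mK HB KB H0; apply: (iT _ (B * B')).
    - exact: measurable_funM.
    - by move=> x; rewrite normrM ler_pM.
    - by move=> x /H0 ->; rewrite mul0r.
  have mGs : measurable_fun setT (fun x : mplane R => G (x + d n *: v)).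
    exact: continuous_measurable2T.
  have dxn x : ~ D x -> F (x - d n *: v) = 0 by move=> /nD; exact: dx.
  have e : \int[L2]_x (F x * G (x + d n *: v)) = \int[L2]_x (F (x - d n *: v) * G x).
    have /= <- := @Rintegral_shift R (fun x => F (x - d n *: v) * G x) (d n *: v).
    - by apply: eq_Rintegral => x _; rewrite addrK.
    - exact: measurable_funM.
    - have := iFG F (fun x => G (x + d n *: v)) mF mGs FB (fun=> GB _) nDF.
      by congr (L1fun _ _); apply/funext => x; rewrite addrK.
  have iFF : L1fun D (fun x => F x * G (x + d n *: v)).
    by apply: (L1funS measurableT) => //; exact: iFG.
  have iFG0 : L1fun D (fun x => F x * G x).
    by apply: (L1funS measurableT) => //; exact: iFG.
  have iFsG : L1fun D (fun x => F (x - d n *: v) * G x).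
    by apply: (L1funS measurableT) => //; exact: iFG.
  under eq_Rintegral do rewrite /q mulrCA mulrBr.
  under [in RHS]eq_Rintegral do rewrite mulrBl.
  rewrite !RintegralZl//; [|exact: L1funB..].
  congr (_ * _); rewrite !RintegralB//; congr (_ - _).
  by rewrite -!toD// => x; [move=> /dxn|move=> /nDF] => ->; rewrite mul0r.
have cvi : (fun n => \int[L2]_(x in D) (F x * q n x)) @ \oo -->
    \int[L2]_(x in D) (F x * 'D_v G x).
  have [||||_ ] := @Rintegral_dct R _ _ L2 D (fun n x => F x * q n x)
    (fun x => F x * 'D_v G x) (cst (B * M)) mD.
  - by move=> n; apply: measurable_funTS; exact: measurable_funM.
  - by move=> x _; apply: cvgMr; exact: qcvg.
  - by apply: (iD _ `|B * M|); [exact: measurable_cst|].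
  - move=> n x _; rewrite normrM ler_pM//.
    rewrite normrM gtr0_norm ?invr_gt0// ler_pdivrMl// mulrC.
    by rewrite (le_trans (GM _ _))// gtr0_norm.
  - by [].
rewrite toD; last by move=> x /nDF ->; rewrite mul0r.
have ncvi : (fun n => `|\int[L2]_(x in D) (F x * q n x)|) @ \oo -->
    `|\int[L2]_(x in D) (F x * 'D_v G x)| by exact: cvg_norm.
rewrite -(cvg_lim _ ncvi)//; apply: limr_le; first by apply/cvg_ex; eexists; exact: ncvi.
near=> n.
have mH : measurable_fun (D : set (mplane R)) (fun x : mplane R => (d n)^-1 * ((F (x - d n *: v) - F x) * G x)).
  apply: measurable_funTS; apply: measurable_funM; first exact: measurable_cst.
  by apply: measurable_funM => //; exact: measurable_funB.
have HC x : `|(d n)^-1 * ((F (x - d n *: v) - F x) * G x)| <= C.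
  by rewrite normrM gtr0_norm ?invr_gt0// ler_pdivrMl// [leRHS]mulrC FC.
rewrite step; apply: (le_trans (le_normr_Rintegral mD _)).
  by apply: bounded_L1fun (lebesgue2_ball_fin _ _) mH (fun x _ => HC x) => //.
rewrite -Rintegral_cst//; apply: le_Rintegral => //.
- apply: (@bounded_L1fun _ D _ C) => //; first exact: lebesgue2_ball_fin.
    exact: measurableT_comp.
  by move=> x _; rewrite normr_id HC.
- by apply: (iD _ `|C|); [exact: measurable_cst|].
Unshelve. all: by end_near. Qed.

Lemma C1_continuous f : C1fun f -> continuous f.
Proof. by case. Qed.

Lemma C1_derivable f i x : C1fun f -> derivable f x (canon2 R i).
Proof. by case=> _ /(_ i)[]. Qed.

Lemma C1_partial_continuous f i : C1fun f -> continuous (partial i f).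
Proof. by case=> _ /(_ i)[]. Qed.

Lemma C1_is_derive f i x : C1fun f -> is_derive x (canon2 R i) f (partial i f x).
Proof. by move=> cf; apply/derivableP; exact: C1_derivable. Qed.

Lemma C1fun_is_derive f (df : 'I_2 -> plane R -> R) : continuous f ->
  (forall i x, is_derive x (canon2 R i) f (df i x)) -> (forall i, continuous (df i)) ->
  C1fun f /\ forall i, partial i f = df i.
Proof.
move=> cf fd cdf.
have E i : partial i f = df i by apply/funext => x; case: (fd i x).
by split => //; split => // i; split; [move=> x; case: (fd i x)|rewrite E].
Qed.

Lemma C1_cst (c : R) : C1fun (fun=> c : R) /\ forall i, partial i (fun=> c) = fun=> 0.
Proof.
apply: (@C1fun_is_derive _ (fun _ _ => 0)).
- exact: cst_continuous.
- by move=> i; exact: cst_continuous.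
Qed.

Lemma C1_add f g : C1fun f -> C1fun g -> C1fun (fun x => f x + g x) /\
  forall i, partial i (fun x => f x + g x) = fun x => partial i f x + partial i g x.
Proof.
move=> cf cg; apply: C1fun_is_derive.
- by move=> x; apply: cvgD; exact: C1_continuous.
- by move=> i x; apply: is_deriveD; exact: C1_is_derive.
- by move=> i x; apply: cvgD; exact: C1_partial_continuous.
Qed.

Lemma C1_mul f g : C1fun f -> C1fun g -> C1fun (fun x => f x * g x) /\
  forall i, partial i (fun x => f x * g x) = fun x => f x * partial i g x + g x * partial i f x.
Proof.
move=> cf cg; apply: C1fun_is_derive.
- by move=> x; apply: cvgM; exact: C1_continuous.
- by move=> i x; apply: is_deriveM; exact: C1_is_derive.
- move=> i x; apply: cvgD; apply: cvgM.
  + exact: (C1_continuous cf).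
  + exact: (C1_partial_continuous cg).
  + exact: (C1_continuous cg).
  + exact: (C1_partial_continuous cf).
Qed.

Lemma C1_scale (c : R) f : C1fun f -> C1fun (fun x => c * f x) /\
  forall i, partial i (fun x => c * f x) = fun x => c * partial i f x.
Proof.
move=> cf; have [cc pc] := C1_cst c; have [cm pm] := C1_mul cc cf; split => // i.
by rewrite pm pc; apply/funext => x; rewrite mulr0 addr0.
Qed.

Lemma C1_comp (h h' : R -> R) f : C1fun f ->
  (forall t, is_derive t (1 : R) h (h' t)) -> continuous h' ->
  C1fun (fun x => h (f x)) /\
  forall i, partial i (fun x => h (f x)) = fun x => h' (f x) * partial i f x.
Proof.
move=> cf hd ch'.
have ch : continuous h.
  by move=> t; apply: differentiable_continuous; apply/derivable1_diffP; case: (hd t).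
apply: C1fun_is_derive.
- by move=> x; apply: continuous_comp; [exact: C1_continuous|exact: ch].
- by move=> i x; apply: is_derive_comp1 => //; exact: C1_is_derive.
- move=> i x; apply: cvgM; last exact: C1_partial_continuous.
  by apply: continuous_comp; [exact: C1_continuous|exact: ch'].
Qed.

Lemma dot2_canon2 (v : plane R) i : dot2 v (canon2 R i) = coord2 v i.
Proof.
by rewrite /dot2 /coord2 /canon2/=; case: eqP => _; rewrite ?mulr1 ?mulr0 ?addr0 ?add0r.
Qed.

Lemma dot2_continuous (v : plane R) : continuous (dot2 v).
Proof.
move=> x; apply: cvgD; apply: cvgM; try exact: cvg_cst.
  exact: cvg_fst.
exact: cvg_snd.
Qed.

Lemma C1_dot2 (v : plane R) : C1fun (dot2 v) /\ forall i, partial i (dot2 v) = fun=> coord2 v i.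
Proof.
apply: C1fun_is_derive; [exact: dot2_continuous| |by move=> i; exact: cst_continuous].
move=> i x; have E : (fun h : R => h^-1 *: ((dot2 v \o shift x) (h *: canon2 R i) - dot2 v x)) @ 0^'
    --> coord2 v i.
  apply: cvg_near_cst; near=> h.
  have h0 : h != 0 by near: h; exact: nbhs_dnbhs_neq.
  rewrite -dot2_canon2 [(dot2 v \o _) _](_ : _ = h * dot2 v (canon2 R i) + dot2 v x).
    by rewrite addrK [_ *: _]mulKf.
  rewrite /dot2 /=; set a := _%:R; set b := _%:R.
  rewrite (_ : h *: a = h * a)// (_ : h *: b = h * b)//; ring.
by apply: DeriveDef; [apply/cvg_ex; eexists; exact: E|exact: cvg_lim E].
Unshelve. all: by end_near. Qed.

Lemma norm_canon2 i : `|canon2 R i| = 1 :> R.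
Proof.
rewrite prod_normE /canon2/=; case: eqP => _ /=; rewrite normr1 normr0.
  by apply/max_idPl; exact: ler01.
by apply/max_idPr; exact: ler01.
Qed.

Lemma compact_closed2 (K : set (plane R)) : compact K -> closed K.
Proof. by apply: compact_closed; exact: norm_hausdorff. Qed.

Lemma compact_bound2 (K : set (plane R)) : compact K ->
  exists2 r : R, 0 < r & forall x, K x -> `|x| < r.
Proof.
move=> /compact_bounded[M [_ KM]]; exists (`|M| + 2); first by rewrite ltr_wpDl.
move=> x Kx; have : `|x| <= `|M| + 1 by apply: KM => //; rewrite (le_lt_trans (ler_norm _))// ltrDl.
by move=> /le_lt_trans; apply; rewrite ltrD2l ltrDr.
Qed.

Lemma compact_support_bounded f (K : set (plane R)) : compact K -> continuous f ->
  (forall x, ~ K x -> f x = 0) -> exists2 M : R, 0 <= M & forall x, `|f x| <= M.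
Proof.
move=> cK cf f0.
have [M [_ fM]] : bounded_set (f @` K).
  by apply: compact_bounded; apply: continuous_compact => //; exact: continuous_subspaceT.
exists (`|M| + 1) => [|x]; first by rewrite addr_ge0.
have [Kx|/f0 ->] := pselect (K x); last by rewrite normr0 addr_ge0.
by apply: fM; [rewrite (le_lt_trans (ler_norm _))// ltrDl|exists x].
Qed.

Lemma partial_support f (K : set (plane R)) i : closed K ->
  (forall x, ~ K x -> f x = 0) -> forall x, ~ K x -> partial i f x = 0.
Proof.
move=> cK f0 x Kx; rewrite /partial.
have n0 : \forall y \near x, f y = cst 0 y.
  have : nbhs x (~` K) by apply: open_nbhs_nbhs; split => //; exact: closed_openC.
  by apply: filterS => y; exact: f0.
by rewrite (near_eq_derive _ n0) derive_cst.
Qed.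

Lemma integral_partial0 f (K : set (plane R)) i : compact K -> C1fun f ->
  (forall x, ~ K x -> f x = 0) -> \int[L2]_x partial i f x = 0.
Proof.
move=> cK cf f0.
have [r r0 Kr] := compact_bound2 cK.
have [B B0 fB] := compact_support_bounded cK (C1_continuous cf) f0.
have df0 := partial_support i (compact_closed2 cK) f0.
have [M M0 dfM] := compact_support_bounded cK (C1_partial_continuous (i := i) cf) df0.
(* The indicator of a ball which exceeds the support of [f] by one unit: under shifts of length at
   most 1 it does not change where [f] is nonzero, so the constant [C] is 0. *)
pose F : plane R -> R := \1_(ball (0 : plane R) (r + 1)).
have Fin (x : plane R) : `|x| < r + 1 -> F x = 1.
  by move=> xr; rewrite /F indicE mem_set// -ball_normE /= sub0r normrN.
have fr x : r <= `|x| -> f x = 0.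
  by move=> rx; apply: f0 => /Kr; rewrite ltNge rx.
have := @diff_quotient_integral F f (canon2 R i) (r + 1) 1 B M 0.
rewrite mul0r => H; apply/eqP; rewrite -normr_le0.
have <- : \int[L2]_x (F x * 'D_(canon2 R i) f x) = \int[L2]_x partial i f x.
  congr Rintegral; apply/funext => x.
  have [xr|rx] := ltP `|x| (r + 1); first by rewrite Fin// mul1r.
  rewrite [partial i f x]df0 ?[X in _ * X]df0 ?mulr0//.
    by move=> /Kr; lra.
  by move=> /Kr; lra.
apply: H.
- by apply: measurable_indic; apply: open_measurable2; exact: ball_open.
- by move=> x; rewrite /F indicE; case: (_ \in _); rewrite ?normr1 ?normr0.
- by move=> x rx; rewrite /F indicE memNset// -ball_normE /= sub0r normrN; lra.
- exact: C1_continuous.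
- exact: fB.
- by move=> x; exact: C1_derivable.
- by move=> x t; apply: is_derive_lip => y; [exact: C1_derivable|exact: dfM].
- move=> x t t0 t1; rewrite mul0r normr_le0.
  have [xr|rx] := ltP `|x| r; last by rewrite fr// mulr0.
  rewrite Fin ?Fin ?subrr ?mul0r//; first lra.
  apply: le_lt_trans (ler_normB _ _) _.
  rewrite normrZ norm_canon2 mulr1 gtr0_norm//; lra.
Qed.

Lemma Rintegral_support (D : set (mplane R)) f : (forall x, ~ D x -> f x = 0) ->
  \int[L2]_(x in D) f x = \int[L2]_x f x.
Proof.
move=> f0; rewrite Rintegral_mkcond; congr Rintegral; apply/funext => x.
by rewrite patchE; case: ifPn => // /negP; rewrite inE => /f0.
Qed.

Lemma compact_support_L1 f (K : set (plane R)) : compact K -> continuous f ->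
  (forall x, ~ K x -> f x = 0) -> L1fun setT f.
Proof.
move=> cK cf f0; have [N N0 fN] := compact_support_bounded cK cf f0.
have mK : measurable (K : set (mplane R)) by apply: closed_measurable2; exact: compact_closed2.
have : L1fun K f.
  apply: (@bounded_L1fun _ K f N) => //.
    by apply: bounded_lebesgue2_fin => //; exact: compact_bounded.
  by apply: measurable_funTS; exact: continuous_measurable2T.
move=> /(integrable_mkcond _ mK).1; congr (integrable _ _ _); apply/funext => x.
by rewrite patchE; case: ifPn => //; rewrite notin_setE /= => /f0 ->.
Qed.

Lemma integral_partial_mul0 (Omega K : set (plane R)) f g i : measurable (Omega : set (mplane R)) ->
  compact K -> K `<=` Omega -> C1fun f -> C1fun g -> (forall x, ~ K x -> f x = 0) ->
  \int[L2]_(x in Omega) (f x * partial i g x) = - \int[L2]_(x in Omega) (g x * partial i f x).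
Proof.
move=> mO cK KO cf cg f0.
have df0 := partial_support i (compact_closed2 cK) f0.
have [cfg pfg] := C1_mul cf cg.
have toO H (H0 : forall x, ~ K x -> H x = 0) :
    \int[L2]_(x in Omega) H x = \int[L2]_x H x.
  by apply: Rintegral_support => x Ox; apply: H0 => /KO.
have ffg0 x : ~ K x -> f x * g x = 0 by move=> /f0 ->; rewrite mul0r.
apply/eqP; rewrite eq_sym -subr_eq0 -opprD oppr_eq0 !toO; last 2 first.
- by move=> x /f0 ->; rewrite mul0r.
- by move=> x /df0 ->; rewrite mulr0.
rewrite -RintegralD//; last 2 first.
- apply: (compact_support_L1 cK) => [x|x /df0 ->]; last by rewrite mulr0.
  by apply: cvgM; [exact: (C1_continuous cg)|exact: (C1_partial_continuous cf)].
- apply: (compact_support_L1 cK) => [x|x /f0 ->]; last by rewrite mul0r.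
  by apply: cvgM; [exact: (C1_continuous cf)|exact: (C1_partial_continuous cg)].
rewrite -[X in _ == X](integral_partial0 i cK cfg ffg0) pfg.
by apply/eqP; congr Rintegral; apply/funext => x; rewrite addrC.
Qed.

End partial_calculus.

(** * Smooth cutoffs *)

Section flat_functions.
Variable R : realType.
Implicit Types p : {poly R}.

(* The functions p(1/s) exp(-1/s) for s > 0, extended by 0, are stable under derivation. *)
Definition flat p (s : R) : R := if 0 < s then p.[s^-1] * expR (- s^-1) else 0.

(** The term of order [(size p).+1] of the exponential series dominates the polynomial with one
    power to spare. Read at y = 1/s, the bound C / y says that [flat p] vanishes linearly at 0. *)
Lemma poly_expR_bound p : exists2 C : R, 0 <= C &
  forall y, 1 <= y -> `|p.[y] * expR (- y)| <= C / y.
Proof.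
pose S := \sum_(i < size p) `|p`_i|; pose n := size p.
exists (S * n.+1`!%:R) => [|y y1]; first by rewrite mulr_ge0// sumr_ge0.
have y0 : 0 < y by lra.
have py : `|p.[y]| <= S * y ^+ n.
  rewrite horner_coef mulr_suml (le_trans (ler_norm_sum _ _ _))//.
  apply: ler_sum => i _; rewrite normrM ler_wpM2l// ger0_norm ?exprn_ge0 ?(ltW y0)//.
  by rewrite ler_weXn2l// ltnW.
have ey : y ^+ n.+1 / n.+1`!%:R <= expR y.
  by have := expR_ge1Dxn n (ltW y0); lra.
have f0 : 0 < n.+1`!%:R :> R by rewrite ltr0n fact_gt0.
rewrite normrM (ger0_norm (expR_ge0 _)) expRN ler_pdivrMr ?expR_gt0//.
apply: (le_trans py).
rewrite -!mulrA; apply: ler_wpM2l; first by rewrite sumr_ge0.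
by rewrite mulrCA ler_pdivlMl// -exprS mulrC -ler_pdivrMr.
Qed.

Lemma flat_lip0 p : exists2 C : R, 0 <= C & forall s, `|s| <= 1 -> `|flat p s| <= C * `|s|.
Proof.
have [C C0 pC] := poly_expR_bound p; exists C => // s s1.
rewrite /flat; case: ifPn => [s0|_]; last by rewrite normr0 mulr_ge0.
rewrite (gtr0_norm s0) in s1 *.
by have := pC s^-1; rewrite invrK; apply; rewrite invf_ge1.
Qed.

Lemma flat_derive p (s : R) : is_derive s (1 : R) (flat p) (flat ('X ^+ 2 * (p - p^`())) s).
Proof.
have inv (t : R) : t != 0 -> is_derive t (1 : R) (fun y : R => y^-1) (- t ^- 2).
  move=> t0; have := is_deriveV (f := id) t0 (is_derive_id t (1 : R)).
  by rewrite [_ *: _]mulr1.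
have [s0|s0|<-] := ltgtP 0 s.
- have n0 : {near s, (fun t => p.[t^-1] * expR (- t^-1)) =1 flat p}.
    by near=> t; rewrite /flat ifT//; near: t; exact: lt_nbhsr.
  apply: (near_eq_is_derive n0).
  have dV := inv s (lt0r_neq0 s0).
  have d1 : is_derive s (1 : R) (fun t : R => p.[t^-1]) (p^`().[s^-1] * - s ^- 2).
    exact: (@is_derive1_comp R (horner p)).
  have d2 : is_derive s (1 : R) (fun t : R => expR (- t^-1)) (expR (- s^-1) * - - s ^- 2).
    exact: (@is_derive1_comp R expR).
  apply: is_derive_eq; rewrite /flat s0 !hornerE /=.
  by rewrite -!exprVn /GRing.scale /=; ring.
- have n0 : {near s, cst (0:R) =1 flat p}.
    by near=> t; rewrite /flat ltNge ltW//; near: t; exact: lt_nbhsl.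
  apply: (near_eq_is_derive n0).
  by rewrite /flat ltNge ltW//=; exact: is_derive_cst.
(* The slope function at 0: [flat p s] is s times [flat ('X * p) s], since 'X is evaluated at
   1/s. *)
- apply/is_derive1_caratheodory; exists (flat ('X * p)); split.
  + move=> z; rewrite /flat ltxx !subr0; case: ifPn => [z0|_]; last by rewrite mul0r.
    by rewrite hornerM hornerX [RHS]mulrC !mulrA divff ?gt_eqF// mul1r.
  + have [C C0 fC] := flat_lip0 ('X * p).
    have f00 : flat ('X * p) 0 = 0 by rewrite /flat ltxx.
    suff : flat ('X * p) @ (0:R) --> (0:R) by rewrite -[X in _ --> X]f00.
    apply/cvgr0Pnorm_le => e e0; near=> z.
    have z1 : `|z| <= 1 by near: z; apply: cvgr0_norm_le; [exact: cvg_id|].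
    apply: (le_trans (fC z z1)).
    have : `|z| <= e / (C + 1).
      by near: z; apply: cvgr0_norm_le; [exact: cvg_id|rewrite divr_gt0// ltr_wpDl].
    rewrite ler_pdivlMr ?ltr_wpDl// mulrC => h.
    by apply: le_trans h; rewrite ler_wpM2r// lerDl.
  + by rewrite /flat ltxx.
Unshelve. all: by end_near. Qed.

End flat_functions.

Section smooth_functions.
Variable R : realType.
Implicit Types (f g : plane R -> R) (Omega : set (plane R)).

(** Recursion on the order makes stability under products and compositions a single induction.
    [smooth] speaks of iterated partial derivatives along all lists of directions; [smooth_Cn]
    recovers it from all finite orders. *)
Fixpoint Cn (n : nat) f : Prop :=
  C1fun f /\ if n is n'.+1 then forall i, Cn n' (partial i f) else True.

Lemma Cn_C1 n f : Cn n f -> C1fun f.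
Proof. by case: n => [|n] []. Qed.

Lemma Cn_pred n f : Cn n.+1 f -> Cn n f.
Proof.
elim: n f => [|n ih] f [cf pf]; first by [].
by split => // i; apply: ih; exact: pf.
Qed.

Lemma smooth_Cn f : (forall n, Cn n f) -> smooth f.
Proof.
move=> cf s.
suff H : forall (t : seq 'I_2) g, Cn (size t) g -> C1fun (foldr (@partial R) g t) by exact: H.
elim/last_ind => [g [] //|t i ih g].
by rewrite size_rcons foldr_rcons => -[_ /(_ i)]; exact: ih.
Qed.

Lemma Cn_cst (c : R) n : Cn n (fun=> c).
Proof.
elim: n c => [|n ih] c; have [c1 p1] := C1_cst c; first by [].
by split => // i; rewrite p1; exact: ih.
Qed.

Lemma Cn_add n f g : Cn n f -> Cn n g -> Cn n (fun x => f x + g x).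
Proof.
elim: n f g => [|n ih] f g cf cg; have [c1 p1] := C1_add (Cn_C1 cf) (Cn_C1 cg); first by split.
by split => // i; rewrite p1; apply: ih; [apply: cf.2|apply: cg.2].
Qed.

Lemma Cn_mul n f g : Cn n f -> Cn n g -> Cn n (fun x => f x * g x).
Proof.
elim: n f g => [|n ih] f g cf cg; have [c1 p1] := C1_mul (Cn_C1 cf) (Cn_C1 cg); first by split.
split => // i; rewrite p1; apply: Cn_add; apply: ih.
- exact: Cn_pred.
- exact: cg.2.
- exact: Cn_pred.
- exact: cf.2.
Qed.

(** The outer function ranges over a family closed under derivation, [d] sending an index to that of
    the derivative, so the induction hypothesis applies to the derivative. The families used are
    [flat], indexed by polynomials, and the exponential alone. *)
Lemma Cn_comp (I : Type) (h : I -> R -> R) (d : I -> I) n f i :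
  (forall j t, is_derive t (1 : R) (h j) (h (d j) t)) -> Cn n f -> Cn n (fun x => h i (f x)).
Proof.
move=> hd; have ch j : continuous (h j).
  by move=> t; apply: differentiable_continuous; apply/derivable1_diffP; case: (hd j t).
elim: n f i => [|n ih] f i cf;
  have [c1 p1] := C1_comp (Cn_C1 cf) (hd i) (ch (d i)); first by [].
split => // j; rewrite p1; apply: Cn_mul; last exact: cf.2.
by apply: ih; exact: Cn_pred.
Qed.

Lemma Cn_dot2 n (v : plane R) : Cn n (dot2 v).
Proof.
have [c1 p1] := C1_dot2 v; case: n => [|n]; split => // i.
by rewrite p1; exact: Cn_cst.
Qed.

(** Positive exactly in the disc of radius sqrt 2 r, which contains the sup-norm ball of radius r
    and is contained in that of radius 3/2 r. *)
Definition bump (c : plane R) (r : R) (x : plane R) : R :=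
  flat 1 (2 * r ^+ 2 - ((x.1 - c.1) ^+ 2 + (x.2 - c.2) ^+ 2)).

Lemma Cn_bump n c r : Cn n (bump c r).
Proof.
have Cx (v : plane R) (a : R) : Cn n (fun x => (dot2 v x - a) ^+ 2).
  by apply: (Cn_mul (f := fun x => dot2 v x - a)); apply: Cn_add (Cn_dot2 _ _) (Cn_cst _ _).
have Cq : Cn n (fun x => 2 * r ^+ 2 + (-1) *
    ((dot2 (1, 0) x - c.1) ^+ 2 + (dot2 (0, 1) x - c.2) ^+ 2)).
  apply: Cn_add; first exact: Cn_cst.
  by apply: Cn_mul; [exact: Cn_cst|exact: Cn_add].
rewrite (_ : bump c r = fun x => flat 1 (2 * r ^+ 2 + (-1) *
    ((dot2 (1, 0) x - c.1) ^+ 2 + (dot2 (0, 1) x - c.2) ^+ 2))).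
  exact: (Cn_comp (1 : {poly R}) (@flat_derive R) Cq).
by apply/funext => x; rewrite /bump /dot2/= !mul1r !mul0r addr0 add0r mulN1r.
Qed.

Lemma bump_ge0 c r x : 0 <= bump c r x.
Proof. by rewrite /bump /flat; case: ifP => // _; rewrite hornerC mul1r expR_ge0. Qed.

Lemma bump_gt0 c r x : ball c r x -> 0 < bump c r x.
Proof.
move=> [x1 x2]; rewrite /bump /flat ifT; first by rewrite hornerC mul1r expR_gt0.
by move: x1 x2; rewrite /ball/= !ltr_norml => /andP[? ?] /andP[? ?]; nra.
Qed.

Definition bump_support (c : plane R) (r : R) : set (plane R) :=
  `[c.1 - 3 / 2 * r, c.1 + 3 / 2 * r]%classic `*` `[c.2 - 3 / 2 * r, c.2 + 3 / 2 * r]%classic.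

Lemma bump_support_compact c r : compact (bump_support c r).
Proof. by apply: compact_setX; exact: segment_compact. Qed.

Lemma bump_support_ball c r : 0 < r -> bump_support c r `<=` ball c (2 * r).
Proof.
move=> r0 x [/= x1 x2]; split; move: x1 x2; rewrite /ball/= !in_itv/= ltr_norml; lra.
Qed.

Lemma bump_out c r x : 0 < r -> ~ bump_support c r x -> bump c r x = 0.
Proof.
move=> r0 xK; rewrite /bump /flat ifF//; apply/negP => h; apply: xK.
have H (u v : R) : u ^+ 2 + v ^+ 2 < 2 * r ^+ 2 -> - (3 / 2 * r) <= u <= 3 / 2 * r.
  by move=> uv; have v0 := sqr_ge0 v; apply/andP; split; rewrite leNgt; apply/negP; nra.
rewrite subr_gt0 in h; have h' := h; rewrite addrC in h'.
by split; rewrite /= in_itv/=; [have := H _ _ h|have := H _ _ h']; lra.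
Qed.

Lemma smooth_cutoff Omega : open Omega ->
  exists psi : nat -> plane R -> R, [/\ forall n, test_fun Omega (psi n),
    forall n x, 0 <= psi n x <= 1 & forall x, Omega x -> psi ^~ x @ \oo --> (1 : R)].
Proof.
move=> oO.
pose good n := (0 < (@rational_box R n).2) /\
  ball (@rational_box R n).1 (2 * (@rational_box R n).2) `<=` Omega.
pose b n : plane R -> R :=
  if `[< good n >] then bump (@rational_box R n).1 (@rational_box R n).2 else fun=> 0.
pose m n x : R := \sum_(i < n) b i x.
(* At a point of [Omega] the sums [m n] are eventually bounded below by a positive constant, and the
   factor n drives the exponential to 0. Where [m n] vanishes so does [psi n], hence the compact
   support. *)
pose psi n x : R := 1 + (-1) * expR (n%:R * (- m n x)).
have b0 n x : 0 <= b n x by rewrite /b; case: ifP => // _; exact: bump_ge0.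
have m0 n x : 0 <= m n x by apply: sumr_ge0.
have Cb k n : Cn k (b n).
  rewrite /b; case: ifP => _; [exact: Cn_bump|exact: Cn_cst].
have Cm k n : Cn k (m n).
  elim: n => [|n ih].
    rewrite (_ : m 0 = fun=> 0); first exact: Cn_cst.
    by apply/funext => x; rewrite /m big_ord0.
  rewrite (_ : m n.+1 = fun x => m n x + b n x); first exact: Cn_add.
  by apply/funext => x; rewrite /m big_ord_recr.
have Cpsi k n : Cn k (psi n).
  apply: Cn_add; first exact: Cn_cst.
  apply: Cn_mul; first exact: Cn_cst.
  apply: (@Cn_comp unit (fun=> expR) id k (fun x => n%:R * (- m n x)) tt).
  apply: Cn_mul; first exact: Cn_cst.
  rewrite (_ : (fun x => - m n x) = fun x => -1 * m n x).
    by apply: Cn_mul; [exact: Cn_cst|exact: Cm].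
  by apply/funext => x; rewrite mulN1r.
have Ksupp n : exists2 K : set (plane R), compact K /\ K `<=` Omega &
    forall x, ~ K x -> m n x = 0.
  elim: n => [|n [K [cK KO] Km]].
    by exists set0 => [|x _]; [split; [exact: compact0|]|rewrite /m big_ord0].
  have [gn|gn] := pselect (good n).
    exists (K `|` bump_support (@rational_box R n).1 (@rational_box R n).2).
      split; first by apply: compactU => //; exact: bump_support_compact.
      rewrite subUset; split => //.
      by apply: subset_trans gn.2; apply: bump_support_ball; case: gn.
    move=> x /not_orP[Kx sx]; rewrite /m big_ord_recr/= -/(m n x) Km// add0r /b.
    by case: ifP => // _; apply: bump_out => //; case: gn.
  exists K => // x Kx; rewrite /m big_ord_recr/= -/(m n x) Km// add0r /b.
  by rewrite asboolF.
exists psi; split.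
- move=> n; split; first by apply: smooth_Cn => k; exact: Cpsi.
  have [K [cK KO] Km] := Ksupp n; exists K => // x Kx.
  by rewrite /psi Km// oppr0 mulr0 expR0 mulr1 subrr.
- move=> n x; rewrite /psi mulN1r subr_ge0 gerBl expR_ge0 andbT -expR0 ler_expR.
  by rewrite mulrN oppr_le0 mulr_ge0.
- move=> x Ox.
  have [k /= [r0 xb bO]] := rational_box_in oO Ox.
  have bk0 : 0 < b k x by rewrite /b asboolT//; exact: bump_gt0.
  have mk n : (k < n)%N -> b k x <= m n x.
    move=> kn; rewrite /m (bigD1 (Ordinal kn))//= lerDl.
    by apply: sumr_ge0 => i _; exact: b0.
  apply: (@squeeze_cvgr _ _ _ _ (fun n => 1 - expR (- b k x) ^+ n) (cst 1)).
  + near=> n; rewrite /psi mulN1r gerBl expR_ge0 andbT lerD2l lerN2.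
    rewrite -expRM_natl ler_expR !mulrN lerN2 ler_wpM2l//.
    by apply: mk; near: n; exact: nbhs_infty_gt.
  + rewrite -[X in _ --> X]subr0; apply: cvgB; first exact: cvg_cst.
    apply: cvg_expr; rewrite ger0_norm ?expR_ge0// -expR0 ltr_expR; lra.
  + exact: cvg_cst.
Unshelve. all: by end_near. Qed.

End smooth_functions.

(** * Oscillating profiles *)

Section staircase.
Variable R : realType.
Implicit Types s t M : R.

Definition pos s : R := Num.max s 0.

Lemma pos_ge s : 0 <= s -> pos s = s.
Proof. by move=> s0; apply/max_idPl. Qed.

Lemma pos_le s : s <= 0 -> pos s = 0.
Proof. by move=> s0; apply/max_idPr. Qed.

Lemma pos_continuous : continuous pos.
Proof. by move=> s; apply: continuous_max; [exact: cvg_id|exact: cvg_cst]. Qed.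

Lemma pos_sqr_derive s : is_derive s (1 : R) (fun t => pos t ^+ 2) (2 * pos s).
Proof.
have [s0|s0|<-] := ltgtP 0 s.
- have n0 : {near s, (fun t : R => t ^+ 2) =1 (fun t => pos t ^+ 2)}.
    by near=> t; rewrite pos_ge// ltW//; near: t; exact: lt_nbhsr.
  apply: (near_eq_is_derive n0); rewrite pos_ge ?ltW//.
  by apply: is_derive_eq; rewrite /GRing.scale/=; ring.
- have n0 : {near s, cst (0 : R) =1 (fun t => pos t ^+ 2)}.
    by near=> t; rewrite pos_le ?expr0n// ltW//; near: t; exact: lt_nbhsl.
  apply: (near_eq_is_derive n0); rewrite pos_le ?ltW// mulr0; exact: is_derive_cst.
- apply/is_derive1_caratheodory; exists pos; split.
  + move=> z; rewrite (pos_le (lexx 0)) expr0n/= !subr0.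
    by have [z0|/ltW z0] := leP 0 z; rewrite ?(pos_ge z0) ?(pos_le z0) ?expr2 ?mul0r.
  + exact: pos_continuous.
  + by rewrite pos_le// mulr0.
Unshelve. all: by end_near. Qed.

(** A quadratic spline rising from 0 to 1 on the unit interval; its derivative [hat] is the triangle
    of height 2 on that interval. Truncated powers allow differentiation term by term. *)
Definition step s : R := 2 * pos s ^+ 2 - 4 * pos (s - 2^-1) ^+ 2 + 2 * pos (s - 1) ^+ 2.
Definition hat s : R := 4 * pos s - 8 * pos (s - 2^-1) + 4 * pos (s - 1).

Lemma step_derive s : is_derive s (1 : R) step (hat s).
Proof.
have d (a b : R) : is_derive s (1 : R) (fun t => a * pos (t - b) ^+ 2) (a * (2 * pos (s - b))).
  have db : is_derive s (1 : R) (fun t => t - b) 1 by apply: is_derive_eq; rewrite /GRing.scale/=; ring.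
  have d1 : is_derive s (1 : R) (fun t => pos (t - b) ^+ 2) (2 * pos (s - b) * 1).
    have dp := pos_sqr_derive (s - b).
    exact: (@is_derive1_comp R (fun t => pos t ^+ 2) (fun t => t - b)).
  by apply: is_derive_eq; rewrite /GRing.scale/=; ring.
have d0 : is_derive s (1 : R) (fun t => 2 * pos t ^+ 2) (2 * (2 * pos s)).
  by have := d 2 0; rewrite subr0; under eq_fun do rewrite subr0.
have -> : hat s = 2 * (2 * pos s) - 4 * (2 * pos (s - 2^-1)) + 2 * (2 * pos (s - 1)).
  by rewrite /hat; lra.
by apply: is_deriveD; apply: is_deriveB.
Qed.

Lemma hat_continuous : continuous hat.
Proof.
have c (a b : R) : continuous (fun t => a * pos (t - b)).
  move=> t; apply: cvgM; first exact: cvg_cst.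
  apply: (@continuous_comp _ _ _ (fun t : R => t - b) pos); last exact: pos_continuous.
  by apply: cvgB; [exact: cvg_id|exact: cvg_cst].
move=> t; apply: cvgD; last exact: c.
apply: cvgB; last exact: c.
by apply: cvgM; [exact: cvg_cst|exact: pos_continuous].
Qed.

Lemma step_le0 s : s <= 0 -> step s = 0.
Proof. by move=> s0; rewrite /step !pos_le; lra. Qed.

Lemma step_ge1 s : 1 <= s -> step s = 1.
Proof. by move=> s1; rewrite /step !pos_ge; lra. Qed.

Lemma hat_ge0 s : 0 <= hat s.
Proof.
rewrite /hat; have [s0|s0] := leP s 0; first by rewrite !pos_le; lra.
have [s1|s1] := leP s 2^-1; first by rewrite (pos_ge (ltW s0)) !pos_le; lra.
by have [s2|s2] := leP s 1; [rewrite (pos_le (s := s - 1)) ?pos_ge|rewrite !pos_ge]; lra.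
Qed.

Lemma hat_out s : s <= 0 \/ 1 <= s -> hat s = 0.
Proof. by case=> h; rewrite /hat; [rewrite !pos_le|rewrite !pos_ge]; lra. Qed.

Lemma step_01 s : 0 <= step s <= 1.
Proof.
rewrite /step; have [s0|s0] := leP s 0; first by rewrite !pos_le; lra.
have [s1|s1] := leP s 2^-1; first by rewrite (pos_ge (ltW s0)) !pos_le; [nra|lra..].
have [s2|s2] := leP s 1; last by rewrite !pos_ge; lra.
by rewrite (pos_le (s := s - 1)) ?pos_ge; [nra|lra..].
Qed.

Definition frac_part s : R := s - (Num.floor s)%:~R.

Lemma frac_itv s : 0 <= frac_part s < 1.
Proof.
have := floor_itv s; rewrite /frac_part intrD => /andP[h1 h2].
by apply/andP; split; lra.
Qed.

(** In each unit interval the staircase rises by one over the initial fraction 1/M and is constant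
    afterwards; [spike] is its derivative, concentrated on these fractions. *)
Definition stair M s : R := (Num.floor s)%:~R + step (M * frac_part s).
Definition spike M s : R := M * hat (M * frac_part s).

(** The floor jumps at integers, but for 1 < M the rise is already complete just to the left of an
    integer. Hence the formula with the floor frozen at its value at [s] remains valid on both
    sides, and differentiability is that of [step]. *)
Lemma stair_near M s : 1 < M -> \forall t \near s,
  stair M t = (Num.floor s)%:~R + step (M * (t - (Num.floor s)%:~R)) /\
  spike M t = M * hat (M * (t - (Num.floor s)%:~R)).
Proof.
move=> M1; set n := Num.floor s.
have := frac_itv s; rewrite /frac_part -/n => /andP[s0 s1].
have M0 : M^-1 < 1 by rewrite invf_lt1//; lra.
near=> t.
have t1 : t < n%:~R + 1 by near: t; apply: lt_nbhsl; lra.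
have t0 : n%:~R - (1 - M^-1) < t by near: t; apply: lt_nbhsr; lra.
have [nt|tn] := leP n%:~R t.
  have tE : Num.floor t = n by apply: floor_def; rewrite nt intrD.
  by rewrite /stair /spike /frac_part tE.
have tE : Num.floor t = n - 1.
  have M0' : 0 < M^-1 by rewrite invr_gt0; lra.
  by apply: floor_def; rewrite subrK tn andbT intrD mulrN1z; lra.
rewrite /stair /spike /frac_part tE intrD mulrN1z.
have h1 : 1 <= M * (t - (n%:~R - 1)).
  have MV : M * M^-1 = 1 by rewrite divff// gt_eqF//; lra.
  by rewrite -[X in X <= _]MV; apply: ler_wpM2l; lra.
have h2 : M * (t - n%:~R) <= 0 by apply: mulr_ge0_le0; lra.
by rewrite (step_ge1 h1) (step_le0 h2) !hat_out; [lra|left|right].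
Unshelve. all: by end_near. Qed.

Lemma stair_derive M s : 1 < M -> is_derive s (1 : R) (stair M) (spike M s).
Proof.
move=> M1; have sn := stair_near s M1; have [_ ->] := nbhs_singleton sn.
set n : R := (Num.floor s)%:~R in sn *.
have n0 : {near s, (fun t => n + step (M * (t - n))) =1 stair M}.
  by apply: filterS sn => t [-> _].
apply: (near_eq_is_derive n0).
have d1 : is_derive s (1 : R) (fun t => M * (t - n)) M.
  by apply: is_derive_eq; rewrite /GRing.scale/=; ring.
have d2 : is_derive s (1 : R) (fun t => step (M * (t - n))) (hat (M * (s - n)) * M).
  have ds := step_derive (M * (s - n)).
  exact: (@is_derive1_comp R step (fun t => M * (t - n))).
by apply: is_derive_eq; rewrite /GRing.scale/=; ring.
Qed.

Lemma spike_continuous M : 1 < M -> continuous (spike M).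
Proof.
move=> M1 s; have sn := stair_near s M1.
set n : R := (Num.floor s)%:~R in sn *.
have n0 : {near s, (fun t => M * hat (M * (t - n))) =1 spike M}.
  by apply: filterS sn => t [_ ->].
rewrite /continuous_at (_ : spike M s = M * hat (M * (s - n))); last exact: (nbhs_singleton sn).2.
apply: cvg_trans (near_eq_cvg n0) _.
apply: cvgM; first exact: cvg_cst.
apply: (@continuous_comp _ _ _ (fun t => M * (t - n)) hat); last exact: hat_continuous.
apply: cvgM; first exact: cvg_cst.
by apply: cvgB; [exact: cvg_id|exact: cvg_cst].
Qed.

Lemma spike_ge0 M s : 0 <= M -> 0 <= spike M s.
Proof. by move=> M0; rewrite mulr_ge0// hat_ge0. Qed.

Lemma stair_id M s : `|stair M s - s| <= 1.
Proof.
have := frac_itv s; have := step_01 (M * frac_part s); rewrite /stair /frac_part.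
set a := step _; set n := (_)%:~R => /andP[? ?] /andP[? ?].
by rewrite ler_norml; apply/andP; split; lra.
Qed.

Lemma spike_neq0 M s : 0 < M -> spike M s != 0 -> 0 < frac_part s < M^-1.
Proof.
move=> M0 h; apply/andP; split; rewrite ltNge; apply: contra h => h; apply/eqP.
  by rewrite /spike hat_out ?mulr0//; left; apply: mulr_ge0_le0 => //; lra.
rewrite /spike hat_out ?mulr0//; right.
by rewrite -ler_pdivrMl// mulr1.
Qed.

(** Spikes live where the fractional part is below 1/M <= 1/2, and the shift by half a period sends
    such a point to a fractional part above 1/2. *)
Lemma spike_shift_disjoint M s : 2 <= M -> spike M s * spike M (s - 2^-1) = 0.
Proof.
move=> M2; apply/eqP; rewrite mulf_eq0; apply/norP => -[h1 h2].
have M0 : 0 < M by lra.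
have Mh : M^-1 <= 2^-1 by rewrite lef_pV2// posrE.
have /andP[a1 a2] := spike_neq0 M0 h1; have /andP[b1 b2] := spike_neq0 M0 h2.
have fs : Num.floor (s - 2^-1) = Num.floor s - 1.
  apply: floor_def; rewrite subrK intrD mulrN1z; move: a1 a2; rewrite /frac_part; lra.
move: a1 a2 b1 b2; rewrite /frac_part fs intrD mulrN1z; lra.
Qed.

End staircase.

(** * Weak convergence on a bounded domain, tested against Lipschitz functions *)

Section bounded_domain.
Variable R : realType.
Implicit Types (Omega : set (plane R)) (f h : plane R -> R).
Local Notation L2 := (lebesgue2 R).

Lemma closure_compact Omega : bounded_set Omega -> compact (closure Omega).
Proof.
move=> [M [_ OM]].
have OK : closure Omega `<=` `[- (`|M| + 1), `|M| + 1]%classic `*` `[- (`|M| + 1), `|M| + 1]%classic.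
  have Kc : closed (`[- (`|M| + 1), `|M| + 1]%classic `*` `[- (`|M| + 1), `|M| + 1]%classic : set (plane R)).
    by apply: compact_closed2; apply: compact_setX; exact: segment_compact.
  rewrite closureE; apply: smallest_sub => // x Ox.
  have : `|x| <= `|M| + 1 by apply: OM => //; rewrite (le_lt_trans (ler_norm _))// ltrDl.
  rewrite prod_normE ge_max => /andP[]; rewrite !ler_norml => ? ?.
  by split; rewrite /= in_itv.
apply: (subclosed_compact _ _ OK); first exact: closed_closure.
by apply: compact_setX; exact: segment_compact.
Qed.

Lemma within_closure_bounded Omega h : bounded_set Omega ->
  {within closure Omega, continuous h} ->
  exists2 B : R, 0 <= B & forall x, closure Omega x -> `|h x| <= B.
Proof.
move=> bO ch.
have [M [_ hM]] : bounded_set (h @` closure Omega).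
  by apply: compact_bounded; apply: continuous_compact => //; exact: closure_compact.
exists (`|M| + 1) => [|x Ox]; first by rewrite addr_ge0.
by apply: hM; [rewrite (le_lt_trans (ler_norm _))// ltrDl|exists x].
Qed.

Lemma within_closure_open Omega h : open Omega -> {within closure Omega, continuous h} ->
  forall x, Omega x -> {for x, continuous h}.
Proof.
move=> oO ch x Ox.
have : {within Omega, continuous h}.
  by apply: continuous_subspaceW ch; exact: subset_closure.
by rewrite continuous_open_subspace// => /(_ x); apply; rewrite inE.
Qed.

Lemma within_closure_measurable Omega h : open Omega -> {within closure Omega, continuous h} ->
  measurable_fun (Omega : set (mplane R)) (h : mplane R -> R).
Proof.
by move=> oO ch; apply: continuous_measurable2 => //; exact: within_closure_open.
Qed.

Lemma within_closure_L1 Omega h : open Omega -> bounded_set Omega ->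
  {within closure Omega, continuous h} -> L1fun Omega h.
Proof.
move=> oO bO ch; have [B B0 hB] := within_closure_bounded bO ch.
have mO := open_measurable2 oO.
apply: (@bounded_L1fun _ Omega h B) => //.
- exact: bounded_lebesgue2_fin.
- exact: within_closure_measurable.
- by move=> x Ox; apply: hB; exact: subset_closure.
Qed.

Lemma within_compact_unif (K : set (plane R)) h (e : R) : compact K ->
  {within K, continuous h} -> 0 < e ->
  exists2 d : R, 0 < d & forall x y, K x -> K y -> `|x - y| < d -> `|h x - h y| < e.
Proof.
move=> cK ch e0.
have := cK; rewrite compact_near_coveringP -near_covering_withinP.
move=> /(_ R (0 : R)^'+ (fun d x => forall y, K y -> `|x - y| < d -> `|h x - h y| < e)).
have e20 : 0 < e / 2 by rewrite divr_gt0.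
have hyp x : K x -> \forall x' \near x & d \near (0 : R)^'+,
    K x' -> forall y, K y -> `|x' - y| < d -> `|h x' - h y| < e.
  move=> Kx; have /subspace_continuousP/(_ x Kx) := ch.
  move=> /cvgrPdist_lt/(_ _ e20); rewrite near_withinE => /nbhs_ballP[r /= r0 hr].
  have r20 : 0 < r / 2 by rewrite divr_gt0.
  exists (ball x (r / 2), [set d | d < r / 2]).
    by split; [exact: nbhsx_ballx|exact: nbhs_right_lt].
  move=> [x' d] /= [xx' dr] Kx' y Ky x'y.
  have h1 := hr x' (le_ball _ xx') Kx'; have h2 := hr y _ Ky.
  rewrite (le_lt_trans (ler_distD (h x) _ _))// [ltRHS]splitr distrC ltrD//.
    by apply: h1; lra.
  apply: h2; rewrite -ball_normE /=; move: xx'; rewrite -ball_normE /= => xx'.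
  by rewrite (le_lt_trans (ler_distD x' _ _))//; lra.
move=> /(_ _ hyp) nd.
have [d [d0 Kd]] : exists d : R, 0 < d /\ K `<=` (fun x => forall y, K y -> `|x - y| < d -> `|h x - h y| < e).
  near (0 : R)^'+ => d; exists d; split; first by near: d; exact: nbhs_right_gt.
  by near: d.
by exists d => // x y /Kd; exact.
Unshelve. all: by end_near. Qed.

(* Inf-convolution with a multiple of the norm, truncated from above. *)
Lemma lipschitz_approx (K : set (plane R)) h (e : R) : compact K ->
  {within K, continuous h} -> 0 < e ->
  exists H : plane R -> R, exists B L : R, [/\ forall x, `|H x| <= B,
    forall x y, `|H x - H y| <= L * `|x - y|, 0 <= L & forall x, K x -> `|H x - h x| <= e].
Proof.
move=> cK ch e0.
have [K0|/set0P[x0 Kx0]] := eqVneq K set0.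
  exists (fun=> 0), 0, 0; split => //; first by move=> x; rewrite normr0.
    by move=> x y; rewrite subrr normr0 mul0r.
  by move=> x; rewrite K0.
have [B0 [_ hB0]] : bounded_set (h @` K).
  by apply: compact_bounded; exact: continuous_compact.
pose B := `|B0| + 1.
have B_gt0 : 0 < B by rewrite ltr_wpDl.
have hB x : K x -> `|h x| <= B.
  by move=> Kx; apply: hB0; [rewrite (le_lt_trans (ler_norm _))// ltrDl|exists x].
have [d d0 hd] : exists2 d : R, 0 < d & forall x y, K x -> K y -> `|x - y| < d -> `|h x - h y| < e.
  exact: within_compact_unif.
(* At distance d or more the penalty is at least 2 B, so such points cannot bring the infimum below
   [h x]; nearer points lower it by at most e. *)
pose L := 2 * B / d.
have L0 : 0 <= L by rewrite divr_ge0// ?mulr_ge0// ltW.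
pose V x := [set h y + L * `|x - y| | y in K].
have Vlb x : lbound (V x) (- B).
  move=> _ [y Ky <-]; have := hB y Ky; rewrite ler_norml => /andP[h1 _].
  by rewrite ler_wpDr// mulr_ge0.
have Vinf x : has_inf (V x).
  by split; [exists (h x0 + L * `|x - x0|); exists x0|exists (- B)].
have Vle x y : K y -> inf (V x) <= h y + L * `|x - y|.
  by move=> Ky; apply: ge_inf; [case: (Vinf x)|exists y].
have lip1 x y : inf (V x) <= inf (V y) + L * `|x - y|.
  rewrite -lerBlDr; apply: lb_le_inf; first by case: (Vinf y).
  move=> _ [z Kz <-]; rewrite lerBlDr; apply: (le_trans (Vle x z Kz)).
  by rewrite -addrA lerD2l -mulrDr ler_wpM2l// (le_trans (ler_distD y _ _))// addrC.
pose H x := Num.min (inf (V x)) B.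
exists H, B, L; split => //.
- move=> x; rewrite ler_norml /H le_min ge_min lexx orbT andbT.
  have lb := lb_le_inf (Vinf x).1 (Vlb x); apply/andP; split => //; lra.
- have H1 x y : H x <= H y + L * `|x - y|.
    rewrite /H; have := lip1 x y; have : 0 <= L * `|x - y| by rewrite mulr_ge0.
    by rewrite /Num.min; case: ifP; case: ifP => /=; rewrite ?ltNge => *; lra.
  move=> x y; have := H1 x y; have := H1 y x; rewrite (distrC y x).
  by rewrite ler_norml => *; apply/andP; split; lra.
- move=> x Kx; have hx := hB x Kx.
  have up : inf (V x) <= h x by have := Vle x x Kx; rewrite subrr normr0 mulr0 addr0.
  have dn : h x - e <= inf (V x).
    apply: lb_le_inf; first by case: (Vinf x).
    move=> _ [y Ky <-]; have [xyd|dxy] := ltP `|x - y| d.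
      have := hd x y Kx Ky xyd; have : 0 <= L * `|x - y| by rewrite mulr_ge0.
      rewrite ltr_norml => ? /andP[? ?]; lra.
    have : 2 * B <= L * `|x - y| by rewrite /L mulrAC ler_pdivlMr// ler_wpM2l// mulr_ge0// ltW.
    have := hB y Ky; move: hx; rewrite !ler_norml => /andP[? ?] /andP[? ?]; lra.
  move: hx; rewrite ler_norml => /andP[_ hxB].
  rewrite /H min_l; last lra.
  by rewrite ler_norml; apply/andP; split; lra.
Qed.

Definition vol Omega : R := fine (L2 Omega).

Lemma bounded_dct (D : set (mplane R)) (F : nat -> plane R -> R) f (B : R) :
  measurable D -> (L2 D < +oo)%E ->
  (forall n, measurable_fun D (F n : mplane R -> R)) ->
  (forall n x, D x -> `|F n x| <= B) -> (forall x, D x -> F ^~ x @ \oo --> f x) ->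
  (fun n => \int[L2]_(x in D) F n x) @ \oo --> \int[L2]_(x in D) f x.
Proof.
move=> mD D0 mF FB Ff.
have iB : L2.-integrable D (EFin \o (cst B : mplane R -> R)).
  by apply: (@bounded_L1fun _ D (cst B) `|B|) => //; exact: measurable_cst.
by have [] := Rintegral_dct mD mF Ff iB FB.
Qed.

Lemma lipschitz_continuous h (L : R) :
  (forall x y, `|h x - h y| <= L * `|x - y|) -> 0 <= L -> continuous h.
Proof.
move=> hL L0 x; apply/cvgrPdist_lt => e e0.
have eL : 0 < e / (L + 1) by rewrite divr_gt0// ltr_wpDl.
have := nbhsx_ballx x _ eL; apply: filterS => y.
rewrite -ball_normE /= ltr_pdivlMr ?ltr_wpDl// => hxy.
by rewrite (le_lt_trans (hL _ _))// (le_lt_trans _ hxy)// mulrC ler_wpM2l// lerDl.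
Qed.

(** Density argument: bounded Lipschitz tests suffice, because they approximate continuous functions
    uniformly on the compact closure and because the masses of the nonnegative [w n] stay bounded,
    as the test function 1 shows. The hypothesis compares [w n] with half of the cutoff rather than
    with 1/2, which makes it accessible to integration by parts. *)
Lemma weak_half Omega (w : nat -> plane R -> R) (psi : nat -> plane R -> R) :
  open Omega -> bounded_set Omega ->
  (forall n, continuous (w n)) -> (forall n x, 0 <= w n x) ->
  (forall n, L1fun Omega (w n)) ->
  (forall n, continuous (psi n)) -> (forall n x, 0 <= psi n x <= 1) ->
  (forall x, Omega x -> psi ^~ x @ \oo --> (1 : R)) ->
  (forall (H : plane R -> R) (B L : R), (forall x, `|H x| <= B) ->
    (forall x y, `|H x - H y| <= L * `|x - y|) -> 0 <= L ->
    (fun n => \int[L2]_(x in Omega) (H x * (w n x - 2^-1 * psi n x))) @ \oo --> (0 : R)) ->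
  forall h, {within closure Omega, continuous h} ->
  (fun n => \int[L2]_(x in Omega) (h x * w n x)) @ \oo --> 2^-1 * \int[L2]_(x in Omega) h x.
Proof.
have arith (a b c g d v k e : R) : `|a - b| <= d * v -> `|c - g| <= d * k ->
    `|2^-1 * a - c| <= d -> d * (2^-1 * v + 1 + k) <= e -> `|2^-1 * b - g| <= e.
  rewrite !ler_norml => /andP[? ?] /andP[? ?] /andP[? ?] ?.
  by apply/andP; split; lra.
have arith2 (v : R) : 0 <= v -> 2^-1 * v + 1 + (v + 2) <= 2 * (v + 2) by lra.
move=> oO bO cw w0 iw cpsi psi01 psi1 Hw.
have mO := open_measurable2 oO.
have O0 := bounded_lebesgue2_fin mO bO.
have mw n : measurable_fun (Omega : set (mplane R)) (w n : mplane R -> R).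
  by apply: measurable_funTS; exact: continuous_measurable2T.
have mpsi n : measurable_fun (Omega : set (mplane R)) (psi n : mplane R -> R).
  by apply: measurable_funTS; exact: continuous_measurable2T.
have psile n x : `|psi n x| <= 1 by have := psi01 n x => /andP[p0 p1]; rewrite ger0_norm.
have ipsi n : L1fun Omega (psi n) by apply: (@bounded_L1fun _ Omega _ 1).
have lipc := lipschitz_continuous.
have LimH (H : plane R -> R) (B L : R) : (forall x, `|H x| <= B) ->
    (forall x y, `|H x - H y| <= L * `|x - y|) -> 0 <= L ->
    (fun n => \int[L2]_(x in Omega) (H x * w n x)) @ \oo --> 2^-1 * \int[L2]_(x in Omega) H x.
  move=> HB HL L0.
  have mH : measurable_fun (Omega : set (mplane R)) (H : mplane R -> R).
    by apply: measurable_funTS; apply: continuous_measurable2T; exact: lipc HL L0.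
  have iHp n : L1fun Omega (fun x => H x * psi n x).
    by apply: (L1fun_bounded_mul mO mH (fun x _ => HB x)).
  have iHw n : L1fun Omega (fun x => H x * w n x).
    by apply: (L1fun_bounded_mul mO mH (fun x _ => HB x)).
  have e n : \int[L2]_(x in Omega) (H x * w n x) =
      \int[L2]_(x in Omega) (H x * (w n x - 2^-1 * psi n x)) +
      2^-1 * \int[L2]_(x in Omega) (H x * psi n x).
    have -> : \int[L2]_(x in Omega) (H x * (w n x - 2^-1 * psi n x)) =
        \int[L2]_(x in Omega) (H x * w n x - 2^-1 * (H x * psi n x)).
      by apply: eq_Rintegral => x _; rewrite mulrBr mulrCA.
    by rewrite (RintegralB mO (iHw n) (L1funZ _ mO (iHp n))) (RintegralZl _ mO (iHp n)) subrK.
  rewrite (funext e) -[X in _ --> X]add0r; apply: cvgD; first exact: (Hw H B L).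
  apply: cvgMr.
  apply: (@bounded_dct Omega (fun n x => H x * psi n x) H B) => //.
  - by move=> n; exact: measurable_funM.
  - by move=> n x Ox; rewrite normrM -[B]mulr1 ler_pM//; exact: HB.
  - by move=> x Ox; rewrite -[X in _ --> X]mulr1; apply: cvgMr; exact: psi1.
move=> h ch.
have mh := within_closure_measurable oO ch.
have ih := within_closure_L1 oO bO ch.
have [Bh Bh0 hB] := within_closure_bounded bO ch.
have hBO x : Omega x -> `|h x| <= Bh by move=> Ox; apply: hB; exact: subset_closure.
have ihw n : L1fun Omega (fun x => h x * w n x) by apply: (L1fun_bounded_mul mO mh hBO).
apply/cvgrPdist_le => e e0.
(* For large n the masses, which tend to half of the volume, are at most [C]. In units of e / (2 C)
   the three errors are vol / 2, 1 and C, and their sum is at most 2 C. *)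
pose C := vol Omega + 2.
have vol0 : 0 <= vol Omega by rewrite /vol fine_ge0.
have C0 : 0 < C by rewrite /C; lra.
have eC : 0 < e / (2 * C) by rewrite divr_gt0// mulr_gt0.
have [H [B [L [HB HL L0 Hh]]]] := lipschitz_approx (closure_compact bO) ch eC.
have mH : measurable_fun (Omega : set (mplane R)) (H : mplane R -> R).
  by apply: measurable_funTS; apply: continuous_measurable2T; exact: lipc HL L0.
have iH : L1fun Omega H by apply: (@bounded_L1fun _ Omega _ B).
have iHw n : L1fun Omega (fun x => H x * w n x).
  by apply: (L1fun_bounded_mul mO mH (fun x _ => HB x)).
have iHh : L1fun Omega (fun x => H x - h x) by exact: L1funB.
have mass : (fun n => \int[L2]_(x in Omega) w n x) @ \oo --> 2^-1 * vol Omega.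
  have H1 : forall x : plane R, `|1| <= 1 :> R by rewrite normr1.
  have H2 : forall x y : plane R, `|1 - 1| <= 0 * `|x - y| :> R.
    by move=> x y; rewrite subrr normr0 mul0r.
  have := LimH (fun=> 1) 1 0 H1 H2 (lexx 0); rewrite Rintegral_cst// mul1r.
  have -> // : (fun n => \int[L2]_(x in Omega) (1 * w n x)) = fun n => \int[L2]_(x in Omega) w n x.
  by apply/funext => n; apply: eq_Rintegral => x _; rewrite mul1r.
have vHh : `|\int[L2]_(x in Omega) (H x - h x)| <= e / (2 * C) * vol Omega.
  rewrite (le_trans (le_normr_Rintegral mO iHh))// -Rintegral_cst//.
  apply: le_Rintegral => //.
  - by apply/integrable_abse: iHh.
  - by apply: (@bounded_L1fun _ Omega _ `|e / (2 * C)|) => //; exact: measurable_cst.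
  - by move=> x Ox; apply: Hh; exact: subset_closure.
near=> n.
have wn : \int[L2]_(x in Omega) w n x <= C.
  have : `|2^-1 * vol Omega - \int[L2]_(x in Omega) w n x| <= 1.
    by near: n; move/cvgrPdist_le : mass; apply.
  by rewrite ler_norml /C => /andP[? ?]; lra.
have iHhw : L1fun Omega (fun x => (H x - h x) * w n x).
  by have := L1funB mO (iHw n) (ihw n); congr (L1fun _ _); apply/funext => x; rewrite mulrBl.
have wHh : `|\int[L2]_(x in Omega) ((H x - h x) * w n x)| <= e / (2 * C) * C.
  rewrite (le_trans (le_normr_Rintegral mO iHhw))//.
  apply: (@le_trans _ _ (\int[L2]_(x in Omega) (e / (2 * C) * w n x))).
    apply: le_Rintegral => //.
    - by apply/integrable_abse: iHhw.
    - exact: L1funZ.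
    - move=> x Ox; rewrite normrM (ger0_norm (w0 n x)) ler_wpM2r//.
      by apply: Hh; exact: subset_closure.
  by rewrite (RintegralZl _ mO (iw n)); apply: ler_wpM2l => //; exact: ltW.
have Hn : `|2^-1 * \int[L2]_(x in Omega) H x - \int[L2]_(x in Omega) (H x * w n x)| <= e / (2 * C).
  by near: n; move/cvgrPdist_le : (LimH H B L HB HL L0); apply.
have e1 : \int[L2]_(x in Omega) (H x - h x) = \int[L2]_(x in Omega) H x - \int[L2]_(x in Omega) h x.
  by rewrite (RintegralB mO iH ih).
have e2 : \int[L2]_(x in Omega) ((H x - h x) * w n x) =
    \int[L2]_(x in Omega) (H x * w n x) - \int[L2]_(x in Omega) (h x * w n x).
  by rewrite -(RintegralB mO (iHw n) (ihw n)); apply: eq_Rintegral => x _; rewrite mulrBl.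
have key : e / (2 * C) * (2^-1 * vol Omega + 1 + C) <= e.
  by rewrite mulrAC ler_pdivrMr ?mulr_gt0//; apply: ler_wpM2l; [exact: ltW|exact: arith2].
by rewrite e1 in vHh; rewrite e2 in wHh; exact: arith vHh wHh Hn key.
Unshelve. all: by end_near. Qed.

End bounded_domain.

(** * Slip bands: ramps, combs and their localization *)

Section slip_profile.
Variable R : realType.
Implicit Types (Omega : set (plane R)) (v : plane R) (f h : plane R -> R).
Local Notation L2 := (lebesgue2 R).

(** The deviation of the staircase from the identity, at frequency k and phase s, scaled so that its
    derivative is [comb] minus 1/2. It is bounded by 1 / (2 k), so [comb] oscillates around 1/2 and
    converges weakly to it as k grows. *)
Definition ramp (k M s t : R) : R := (2 * k)^-1 * (stair M (k * t - s) - (k * t - s)).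
Definition comb (k M s t : R) : R := 2^-1 * spike M (k * t - s).

Lemma ramp_derive (k M s t : R) : 0 < k -> 1 < M ->
  is_derive t (1 : R) (ramp k M s) (comb k M s t - 2^-1).
Proof.
move=> k0 M1.
have d1 : is_derive t (1 : R) (fun t => k * t - s) k.
  by apply: is_derive_eq; rewrite /GRing.scale/=; ring.
have d2 := stair_derive (k * t - s) M1.
have d3 : is_derive t (1 : R) (fun t => stair M (k * t - s)) (spike M (k * t - s) * k).
  exact: (@is_derive1_comp R (stair M) (fun t => k * t - s)).
have -> : comb k M s t - 2^-1 = (2 * k)^-1 * (spike M (k * t - s) * k - k).
  by rewrite /comb; field; rewrite gt_eqF.
have d4 : is_derive t (1 : R) (fun t => stair M (k * t - s) - (k * t - s)) (spike M (k * t - s) * k - k).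
  exact: is_deriveB.
by apply: is_derive_eq; rewrite /GRing.scale/=; ring.
Qed.

Lemma comb_continuous (k M s : R) : 1 < M -> continuous (comb k M s).
Proof.
move=> M1 t; apply: cvgM; first exact: cvg_cst.
apply: (@continuous_comp _ _ _ (fun t => k * t - s) (spike M)); last exact: spike_continuous.
by apply: cvgB; [apply: cvgM; [exact: cvg_cst|exact: cvg_id]|exact: cvg_cst].
Qed.

Lemma comb_ge0 (k M s t : R) : 0 <= M -> 0 <= comb k M s t.
Proof. by move=> M0; rewrite mulr_ge0// spike_ge0. Qed.

Lemma hat_le2 (s : R) : hat s <= 2.
Proof.
rewrite /hat; have [s0|s0] := leP s 0; first by rewrite !pos_le; lra.
have [s1|s1] := leP s 2^-1; first by rewrite (pos_ge (ltW s0)) !pos_le; lra.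
by have [s2|s2] := leP s 1; [rewrite (pos_le (s := s - 1)) ?pos_ge|rewrite !pos_ge]; lra.
Qed.

Lemma comb_le (k M s t : R) : 0 <= M -> comb k M s t <= M.
Proof.
by move=> M0; rewrite /comb /spike; have := hat_le2 (M * frac_part (k * t - s)); nra.
Qed.

Lemma ramp_small (k M s t : R) : 0 < k -> `|ramp k M s t| <= (2 * k)^-1.
Proof.
move=> k0; have k1 : 0 <= (2 * k)^-1 by rewrite invr_ge0 mulr_ge0// ltW.
by rewrite normrM ger0_norm// ler_piMr// stair_id.
Qed.

Lemma comb_disjoint (k M t : R) : 2 <= M -> comb k M 0 t * comb k M 2^-1 t = 0.
Proof.
move=> M2; have h := spike_shift_disjoint (k * t) M2.
by rewrite /comb subr0 mulrACA; rewrite h mulr0.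
Qed.

Lemma C1_ramp (k M s : R) v : 0 < k -> 1 < M ->
  C1fun (fun x => ramp k M s (dot2 v x)) /\
  forall j, partial j (fun x => ramp k M s (dot2 v x)) =
    fun x => (comb k M s (dot2 v x) - 2^-1) * coord2 v j.
Proof.
move=> k0 M1; have [c1 p1] := C1_dot2 v.
have cc : continuous (fun t => comb k M s t - 2^-1).
  by move=> t; apply: cvgB; [exact: comb_continuous|exact: cvg_cst].
have [c2 p2] := C1_comp c1 (fun t => @ramp_derive k M s t k0 M1) cc.
by split => // j; rewrite p2 p1.
Qed.

Lemma continuous_neq0_open f : continuous f -> open [set x | f x != 0].
Proof.
move=> cf; rewrite (_ : [set x | _] = f @^-1` [set~ 0]).
  apply: open_comp; first by move=> x _; exact: cf.
  by apply: closed_openC; apply: accessible_closed_set1; exact: hausdorff_accessible (@norm_hausdorff _ R).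
by apply/seteqP; split => x /=; [move=> /eqP|move=> /eqP].
Qed.

(** At a fixed point the fractional part is either 0, where the spike vanishes, or eventually above
    the width of the bands, so the indicators of the bands tend to 0 pointwise and dominated
    convergence applies. The shift in m.+2 ensures the condition 2 <= M of [comb_disjoint]. *)
Lemma comb_support Omega v (k s e : R) : open Omega -> bounded_set Omega -> 0 < e ->
  \forall m \near \oo, vol (Omega `&` [set x | comb k m.+2%:R s (dot2 v x) != 0]) < e.
Proof.
move=> oO bO e0.
have mO := open_measurable2 oO; have O0 := bounded_lebesgue2_fin mO bO.
pose S (m : nat) : set (mplane R) := [set x | comb k m.+2%:R s (dot2 v x) != 0].
have mS m : measurable (S m).
  apply: open_measurable2; apply: continuous_neq0_open => x.
  apply: (@continuous_comp _ _ _ (dot2 v) (comb k m.+2%:R s)).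
    exact: dot2_continuous.
  by apply: comb_continuous; rewrite ltr1n.
have volE m : vol (Omega `&` S m) = \int[L2]_(x in Omega) \1_(S m) x.
  rewrite /vol /Rintegral; congr fine.
  by rewrite integral_indic// setIC.
have : (fun m => \int[L2]_(x in Omega) \1_(S m) x) @ \oo --> \int[L2]_(x in Omega) (0 : R).
  apply: (@bounded_dct R Omega (fun m => \1_(S m)) (fun=> 0) 1) => //.
  - by move=> m x _; rewrite indicE; case: (_ \in _); rewrite ?normr1 ?normr0.
  - move=> x _; apply: cvg_near_cst.
    have /andP[f0 f1] := frac_itv (k * dot2 v x - s); set f := frac_part _ in f0 f1.
    have cf m : comb k m.+2%:R s (dot2 v x) != 0 -> 0 < f < m.+2%:R^-1.
      by rewrite mulf_eq0 negb_or => /andP[_ h]; apply: spike_neq0.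
    have [f00|fn0] := eqVneq f 0.
      apply: nearW => m; rewrite indicE memNset//= => /cf.
      by rewrite f00 ltxx.
    near=> m; rewrite indicE memNset//= => /cf/andP[_].
    apply/negP; rewrite -leNgt -[leRHS]invrK lef_pV2 ?posrE ?ltr0n ?invr_gt0 ?lt0r ?fn0//.
    near: m; exists (Num.truncn f^-1) => // m /= fm.
    by rewrite (le_trans (ltW (truncnS_gt _)))// ler_nat ltnW// ltnS.
rewrite Rintegral_cst// mul0r => /cvgr0Pnorm_lt/(_ _ e0).
apply: filterS => m; rewrite -volE => h; exact: le_lt_trans (ler_norm _) h.
Unshelve. all: by end_near. Qed.

(** What the recovery sequences use of the bands. [g_psi_small] controls the error that the cutoff
    causes in the strain. The weak limits of psi rp and psi rm, with the vanishing volume of the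
    bands, make each family concentrate into half of [omega]; [rp_rm] says that the families do not
    overlap. *)
Record profile Omega v (psi g rp rm : nat -> plane R -> R) : Prop := Profile {
  psi_C1 : forall n, C1fun (psi n) ;
  psi_supp : forall n, exists2 K : set (plane R), compact K /\ K `<=` Omega &
    forall x, ~ K x -> psi n x = 0 ;
  psi_01 : forall n x, 0 <= psi n x <= 1 ;
  psi_cvg : forall x, Omega x -> psi ^~ x @ \oo --> (1 : R) ;
  g_C1 : forall n, C1fun (g n) ;
  g_partial : forall n j, partial j (g n) = fun x => (rp n x + rm n x - 1) * coord2 v j ;
  rp_continuous : forall n, continuous (rp n) ;
  rm_continuous : forall n, continuous (rm n) ;
  rp_ge0 : forall n x, 0 <= rp n x ;
  rm_ge0 : forall n x, 0 <= rm n x ;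
  rp_rm : forall n x, rp n x * rm n x = 0 ;
  g_small : forall n x, `|g n x| <= n.+1%:R^-1 ;
  g_psi_small : forall n j x, `|g n x * partial j (psi n) x| <= n.+1%:R^-1 ;
  rp_weak : forall h, {within closure Omega, continuous h} ->
    (fun n => \int[L2]_(x in Omega) (h x * (psi n x * rp n x))) @ \oo -->
    2^-1 * \int[L2]_(x in Omega) h x ;
  rm_weak : forall h, {within closure Omega, continuous h} ->
    (fun n => \int[L2]_(x in Omega) (h x * (psi n x * rm n x))) @ \oo -->
    2^-1 * \int[L2]_(x in Omega) h x ;
  rp_vol : (fun n => vol (Omega `&` [set x | rp n x != 0])) @ \oo --> (0 : R) ;
  rm_vol : (fun n => vol (Omega `&` [set x | rm n x != 0])) @ \oo --> (0 : R) }.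

(* The oscillating part of the comb is the derivative of a small ramp, so that an
   integration by parts moves the derivative to the other factors. *)
Lemma comb_weak_bound Omega K v psi (i : 'I_2) (k M s r Lp B L : R) (H : plane R -> R) :
  open Omega -> (forall x, Omega x -> `|x| < r) -> 0 < k -> 1 < M -> coord2 v i != 0 ->
  C1fun psi -> compact K -> K `<=` Omega -> (forall x, ~ K x -> psi x = 0) -> (forall x, 0 <= psi x <= 1) ->
  (forall x, `|partial i psi x| <= Lp) ->
  (forall x, `|H x| <= B) -> (forall x y, `|H x - H y| <= L * `|x - y|) -> 0 <= L ->
  `|\int[L2]_(x in Omega) (H x * (psi x * comb k M s (dot2 v x) - 2^-1 * psi x))| <=
  (L + B * Lp) / (2 * k) * fine (L2 (ball (0 : plane R) (r + 1))) / `|coord2 v i|.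
Proof.
move=> oO Or k0 M1 vi cpsi cK KO psi0 psi01 psiL HB HL L0.
have psi0' x : ~ Omega x -> psi x = 0 by move=> Ox; apply: psi0 => /KO.
have cH := lipschitz_continuous HL L0.
have psile x : `|psi x| <= 1 by have /andP[p0 p1] := psi01 x; rewrite ger0_norm.
have ccomb : continuous (fun x => comb k M s (dot2 v x)).
  move=> x; apply: (@continuous_comp _ _ _ (dot2 v) (comb k M s)).
    exact: dot2_continuous.
  exact: comb_continuous.

have B0 : 0 <= B by exact: le_trans (HB 0).
have [cR pR] := C1_ramp s v k0 M1.
set G := fun x => ramp k M s (dot2 v x) in cR pR.
pose F x := H x * psi x.
(* The derivative of the ramp along the i-th axis is comb - 1/2 times the i-th coordinate of [v];
   dividing by this nonzero coordinate recovers the integrand. *)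
have -> : \int[L2]_(x in Omega) (H x * (psi x * comb k M s (dot2 v x) - 2^-1 * psi x)) =
    (\int[L2]_x (F x * 'D_(canon2 R i) G x)) / coord2 v i.
  rewrite Rintegral_support; last by move=> x /psi0' ->; rewrite mul0r mulr0 subrr mulr0.
  apply/(canRL (mulfK vi)).
  have e1 x : H x * (psi x * comb k M s (dot2 v x) - 2^-1 * psi x) * coord2 v i =
      F x * 'D_(canon2 R i) G x.
    by rewrite [X in _ = _ * X](congr1 (fun f => f x) (pR i)) /F; ring.
  rewrite -RintegralZr//; last first.
    apply: (compact_support_L1 cK); last by move=> x /psi0 ->; rewrite mul0r mulr0 subrr mulr0.
    move=> x; apply: cvgM; first exact: cH.
    by apply: cvgB; apply: cvgM; rewrite /=; [exact: (C1_continuous cpsi)|exact: ccomb|exact: cvg_cst|exact: (C1_continuous cpsi)].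
  by congr Rintegral; apply/funext => x; exact: e1.
rewrite normrM normfV ler_wpM2r ?invr_ge0//.
have cF : continuous F by move=> x; apply: cvgM; [exact: cH|exact: (C1_continuous cpsi)].
rewrite -[X in ball _ (_ + X)](norm_canon2 R i).
apply: (@diff_quotient_integral R F G (canon2 R i) r B (2 * k)^-1 ((M + 2^-1) * `|coord2 v i|)) => //.
- exact: continuous_measurable2T.
- by move=> x; rewrite normrM -[B]mulr1 ler_pM.
- by move=> x rx; rewrite /F psi0' ?mulr0// => /Or; rewrite ltNge rx.
- exact: C1_continuous.
- by move=> x; exact: ramp_small.
- by move=> x; exact: C1_derivable.
- move=> x t; apply: is_derive_lip => y; first exact: C1_derivable.
  rewrite (congr1 (fun f => f y) (pR i) : 'D_(canon2 R i) G y = _) normrM ler_wpM2r//.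
  have := comb_ge0 k s (dot2 v y) (ltW (lt_trans ltr01 M1)).
  have := comb_le k s (dot2 v y) (ltW (lt_trans ltr01 M1)).
  by rewrite ler_norml => *; apply/andP; split; lra.
- move=> x t t0 t1; rewrite normrM [leRHS]mulrAC ler_pM//; last exact: ramp_small.
  have -> : F (x - t *: canon2 R i) - F x = H (x - t *: canon2 R i) * (psi (x - t *: canon2 R i) - psi x)
    + (H (x - t *: canon2 R i) - H x) * psi x by rewrite /F; ring.
  rewrite (le_trans (ler_normD _ _))// !normrM addrC mulrDl lerD//.
    rewrite -[leRHS]mulr1 ler_pM// (le_trans (HL _ _))// addrC addKr normrN normrZ norm_canon2.
    by rewrite mulr1 gtr0_norm.
  rewrite -mulrA ler_pM// -scaleNr.
  have := @is_derive_lip R psi x (canon2 R i) Lp (- t).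
  rewrite normrN (gtr0_norm t0); apply => y; [exact: C1_derivable|exact: psiL].
Qed.

(** With [Lp n] a bound on the gradient of the cutoff, the frequency (n+1) (1 + Lp n) makes both g
    times that gradient and the bound of [comb_weak_bound] of order 1/n. The height [M n] of the
    spikes is chosen last, so that at this frequency the bands have volume below 1/(n+1). The two
    families are combs of phases 0 and 1/2. *)
Lemma profile_exists Omega v (i0 : 'I_2) : open Omega -> bounded_set Omega ->
  coord2 v i0 != 0 -> exists psi g rp rm, profile Omega v psi g rp rm.
Proof.
have arith (a b l : R) (n : nat) : 0 <= a -> 0 <= b -> 0 <= l ->
    (a + b * l) / (2 * (n.+1%:R * (1 + l))) <= (a + b) / n.+1%:R.
  move=> a0 b0 l0; have n0 : 0 < n.+1%:R :> R by [].
  have l1 : 0 < 1 + l by lra.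
  rewrite ler_pdivrMr ?mulr_gt0// [leRHS](_ : _ = 2 * (a + b) * (1 + l)); first nra.
  by field; rewrite gt_eqF.
move=> oO bO vi0.
have mO := open_measurable2 oO; have O0 := bounded_lebesgue2_fin mO bO.
have [psi [tpsi psi01 psi1]] := smooth_cutoff oO.
have C1psi n : C1fun (psi n) by have [/(_ [::])] := tpsi n.
have [r Or] : exists r : R, forall x, Omega x -> `|x| < r.
  have [M [_ OM]] := bO; exists (`|M| + 2) => x Ox.
  have : `|x| <= `|M| + 1 by apply: OM => //; rewrite (le_lt_trans (ler_norm _))// ltrDl.
  by move=> /le_lt_trans; apply; rewrite ltrD2l ltrDr.
have /choice[Lp LpP] n : exists Lp : R, 0 <= Lp /\ forall j x, `|partial j (psi n) x| <= Lp.
  have [_ [K [cK _] psi0]] := tpsi n.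
  have Bj j : exists2 M : R, 0 <= M & forall x, `|partial j (psi n) x| <= M.
    apply: (compact_support_bounded cK); first exact: C1_partial_continuous.
    exact: partial_support (compact_closed2 cK) psi0.
  have /choice[B BP] : forall j, exists M : R, 0 <= M /\ forall x, `|partial j (psi n) x| <= M.
    by move=> j; have [M M0 MP] := Bj j; exists M.
  exists (\sum_j B j); split => [|j x]; first by apply: sumr_ge0 => j _; case: (BP j).
  rewrite (le_trans ((BP j).2 x))// (bigD1 j)//= lerDl.
  by apply: sumr_ge0 => k _; case: (BP k).
pose k n := n.+1%:R * (1 + Lp n).
have k0 n : 0 < k n by rewrite mulr_gt0// ltr_pwDl//; case: (LpP n).
have n0 (n : nat) : 0 < n.+1%:R^-1 :> R by rewrite invr_gt0.
have /choice[m mP] n : exists m, forall s, s = 0 \/ s = 2^-1 ->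
    vol (Omega `&` [set x | comb (k n) m.+2%:R s (dot2 v x) != 0]) < n.+1%:R^-1.
  have h1 := comb_support v (k n) 0 oO bO (n0 n).
  have h2 := comb_support v (k n) 2^-1 oO bO (n0 n).
  have [N _ NP] := filterI h1 h2.
  have [h3 h4] := NP N (leqnn N).
  by exists N => s [->|->]; [exact: h3|exact: h4].
pose M n : R := (m n).+2%:R.
have M1 n : 1 < M n by rewrite ltr1n.
have M0 n : 0 <= M n by rewrite ler0n.
pose rh s n x := comb (k n) (M n) s (dot2 v x).
have rhc s n : continuous (rh s n).
  move=> x; apply: (@continuous_comp _ _ _ (dot2 v) (comb (k n) (M n) s)).
    exact: dot2_continuous.
  exact: comb_continuous.
have rh0 s n x : 0 <= rh s n x by exact: comb_ge0.
have Cg s n := C1_ramp s v (k0 n) (M1 n).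
pose g n x := ramp (k n) (M n) 0 (dot2 v x) + ramp (k n) (M n) 2^-1 (dot2 v x).
have Cgg n := C1_add (Cg 0 n).1 (Cg 2^-1 n).1.
have gk n x : `|g n x| <= (k n)^-1.
  have e : (k n)^-1 = (2 * k n)^-1 + (2 * k n)^-1 by field; rewrite gt_eqF.
  by rewrite (le_trans (ler_normD _ _))// e lerD// ramp_small.
have cvg_inv (u : nat -> R) (C : R) : (forall n, 0 <= u n <= C * n.+1%:R^-1) -> u @ \oo --> (0 : R).
  move=> uP; apply: (@squeeze_cvgr _ _ _ _ (fun=> 0) (fun n => C * n.+1%:R^-1)).
  - by apply: nearW.
  - exact: cvg_cst.
  - rewrite -(mulr0 C); apply: cvgM; first exact: cvg_cst.
    exact: cvg_harmonic.
have weak s h : {within closure Omega, continuous h} ->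
    (fun n => \int[L2]_(x in Omega) (h x * (psi n x * rh s n x))) @ \oo -->
    2^-1 * \int[L2]_(x in Omega) h x.
  apply: (@weak_half R Omega (fun n x => psi n x * rh s n x) psi) => //.
  - by move=> n x; apply: cvgM; [exact: (C1_continuous (C1psi n))|exact: rhc].
  - by move=> n x; apply: mulr_ge0 => //; have /andP[] := psi01 n x.
  - move=> n; have [_ [K [cK KO] psi0]] := tpsi n.
    apply: (@L1funS _ setT) => //; apply: (compact_support_L1 cK).
      by move=> x; apply: cvgM; [exact: (C1_continuous (C1psi n))|exact: rhc].
    by move=> x /psi0 ->; rewrite mul0r.
  - by move=> n; exact: C1_continuous.
  - move=> H B L HB HL L0; apply/norm_cvg0P.
    have B0 : 0 <= B by exact: le_trans (HB 0).
    apply: (cvg_inv _ ((L + B) * fine (L2 (ball (0 : plane R) (r + 1))) / `|coord2 v i0|)) => n.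
    rewrite normr_ge0/=; have [_ [K [cK KO] psi0]] := tpsi n.
    have := @comb_weak_bound Omega K v (psi n) i0 (k n) (M n) s r (Lp n) B L H oO Or (k0 n) (M1 n)
      vi0 (C1psi n) cK KO psi0 (psi01 n) ((LpP n).2 i0) HB HL L0.
    move=> /le_trans; apply.
    have -> : (L + B) * fine (L2 (ball (0 : plane R) (r + 1))) / `|coord2 v i0| * n.+1%:R^-1 =
      (L + B) / n.+1%:R * fine (L2 (ball (0 : plane R) (r + 1))) / `|coord2 v i0| by ring.
    rewrite ler_wpM2r ?invr_ge0// ler_wpM2r ?fine_ge0//.
    by apply: arith => //; case: (LpP n).
exists psi, g, (rh 0), (rh 2^-1); split => //.
- by move=> n; have [_ [K cK psi0]] := tpsi n; exists K.
- by move=> n; exact: (Cgg n).1.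
- move=> n j; rewrite (Cgg n).2 (Cg 0 n).2 (Cg 2^-1 n).2; apply/funext => x.
  by rewrite /rh; field.
- by move=> n x; apply: comb_disjoint; rewrite ler_nat.
- move=> n x; rewrite (le_trans (gk n x))// lef_pV2 ?posrE// ler_peMr// lerDl.
  by case: (LpP n).
- move=> n j x; rewrite normrM.
  have : `|g n x| * `|partial j (psi n) x| <= (k n)^-1 * (1 + Lp n).
    by rewrite ler_pM//; have := (LpP n).2 j x; lra.
  move=> /le_trans; apply; rewrite /k invfM divfK//.
  by rewrite gt_eqF// ltr_pwDl//; case: (LpP n).
- exact: weak.
- exact: weak.
- apply: (cvg_inv _ 1) => n; rewrite mul1r; apply/andP; split; first by rewrite fine_ge0.
  by apply: ltW; apply: mP; left.
- apply: (cvg_inv _ 1) => n; rewrite mul1r; apply/andP; split; first by rewrite fine_ge0.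
  by apply: ltW; apply: mP; right.
Qed.

End slip_profile.

(** * Positively homogeneous functions *)

Section matrix_limits.
Variables (U : topologicalType) (m n : nat).

Lemma cvg_mx_entries T (F : set_system T) (G : T -> 'M[U]_(m, n)) (M : 'M[U]_(m, n)) :
  Filter F -> (forall i j, (fun t => G t i j) @ F --> M i j) -> G @ F --> M.
Proof.
move=> FF GM A [P MP sPA].
have : \forall t \near F, forall i j, P i j (G t i j).
  apply: filter_forall => i; apply: filter_forall => j.
  exact: (GM i j _ (MP i j)).
by apply: filterS => t Pt; apply: sPA.
Qed.

Lemma mx_entry_continuous i j : continuous (fun M : 'M[U]_(m, n) => M i j).
Proof.
move=> M A MA; exists (fun k l => if (k == i) && (l == j) then A else setT).
  move=> k l; case: ifPn => [/andP[/eqP -> /eqP ->]//|_]; exact: filterT.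
by move=> N /(_ i j); rewrite !eqxx.
Qed.

End matrix_limits.

Section homogeneous_functions.
Variable R : realType.
Variable Omega : set (plane R).
Local Notation L2 := (lebesgue2 R).
Local Notation Chom := (@Chom R Omega _).
Local Notation gydom := (@gydom R Omega _).

Lemma MD_comb (A B : 'M[R]_2) (a b : R) : MD A -> MD B -> MD (a *: A + b *: B).
Proof.
move=> [sA tA] [sB tB]; split; first by rewrite linearD !linearZ/= sA sB.
by rewrite linearD !linearZ/= tA tB !mulr0 addr0.
Qed.

Lemma MD_scale (A : 'M[R]_2) (a : R) : MD A -> MD (a *: A).
Proof. by move=> dA; have := MD_comb a 0 dA dA; rewrite scale0r addr0. Qed.

Lemma MD_0 : MD (0 : 'M[R]_2).
Proof. by split; rewrite ?linear0. Qed.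

Definition MDrow m (q : 'rV[Xi R]_m) := forall i, MD (q ord0 i).1.

Definition rowaff m (r : R) (q c : 'rV[Xi R]_m) : 'rV[Xi R]_m :=
  \row_i (r *: (q ord0 i).1 + (c ord0 i).1, r * (q ord0 i).2 + (c ord0 i).2).

Lemma MDrow_aff m r (q c : 'rV[Xi R]_m) : MDrow q -> MDrow c -> MDrow (rowaff r q c).
Proof. by move=> dq dc i; rewrite mxE/= -[(c ord0 i).1]scale1r; exact: MD_comb. Qed.

Lemma rowaff_continuous m (q c : 'rV[Xi R]_m) : continuous (fun r => rowaff r q c).
Proof.
move=> r; apply: cvg_mx_entries => i j; rewrite mxE.
have -> : (fun t => rowaff t q c i j) =
    (fun t => (t *: (q ord0 j).1 + (c ord0 j).1, t * (q ord0 j).2 + (c ord0 j).2)).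
  by apply/funext => t; rewrite mxE.
have c1 : (fun t => t *: (q ord0 j).1 + (c ord0 j).1) @ r --> r *: (q ord0 j).1 + (c ord0 j).1.
  by apply: cvgD; [apply: cvgZr_tmp; exact: cvg_id|exact: cvg_cst].
have c2 : (fun t => t * (q ord0 j).2 + (c ord0 j).2) @ r --> r * (q ord0 j).2 + (c ord0 j).2.
  by apply: cvgD; [apply: cvgM; [exact: cvg_id|exact: cvg_cst]|exact: cvg_cst].
exact: cvg_pair c1 c2.
Qed.

Lemma cvg_gypoint m T (F : set_system T) (FF : Filter F) (X : T -> plane R)
    (Q : T -> 'rV[Xi R]_m) (E : T -> R) x q eta :
  X @ F --> x -> Q @ F --> q -> E @ F --> eta ->
  (fun t => ((X t, Q t, E t) : gypoint R m)) @ F --> ((x, q, eta) : gypoint R m).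
Proof. by move=> cX cQ cE; exact: cvg_pair (cvg_pair cX cQ) cE. Qed.

(** [Chom] gives continuity within [gydom] only, so the approaching points are required to stay
    there. *)
Lemma Chom_cvg m (f : gypoint R m -> R) T (F : set_system T) (FF : Filter F) Y y0 :
  Chom f -> gydom y0 -> (\forall t \near F, gydom (Y t)) -> Y @ F --> y0 ->
  (fun t => f (Y t)) @ F --> f y0.
Proof.
move=> [/subspace_continuousP cf _] y0D YD Yy.
apply: cvg_trans (cf y0 y0D) => A; rewrite /= !nbhs_filterE /=.
rewrite {1}/nbhs/= /within/= => fA.
have fA' : nbhs y0 [set y | gydom y -> A (f y)] := fA.
by apply: (filterS _ (filterI YD (Yy _ fA'))) => t [d]; exact.
Qed.

Lemma Chom_slice m (f : gypoint R m -> R) q eta : Chom f -> MDrow q ->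
  {within closure Omega, continuous (fun x => f (x, q, eta))}.
Proof.
move=> cf dq; apply/subspace_continuousP => x Ox.
apply: (@Chom_cvg m f _ _ _ (fun x => (x, q, eta)) (x, q, eta)) => //.
  by rewrite near_withinE; apply: nearW.
apply: cvg_within_filter.
by apply: cvg_gypoint; [exact: cvg_id|exact: cvg_cst|exact: cvg_cst].
Qed.

(** Continuity at each (x, q0, eta0) becomes uniform in x by compactness of the closure, expressed
    by near coverings. Each neighbourhood is taken for e / 2, since both values are compared with
    the one at its centre. *)
Lemma Chom_tube m (f : gypoint R m -> R) T (F : set_system T) (FF : Filter F) q eta q0 eta0 e :
  bounded_set Omega -> Chom f -> MDrow q0 -> (\forall t \near F, MDrow (q t)) ->
  q @ F --> q0 -> eta @ F --> eta0 -> 0 < e ->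
  \forall t \near F, forall x, closure Omega x ->
    `|f (x, q t, eta t) - f (x, q0, eta0)| < e.
Proof.
move=> bO cf dq0 dq qq ee e0; have := closure_compact bO.
rewrite compact_near_coveringP -near_covering_withinP.
move=> /(_ T F (fun t x => MDrow (q t) -> `|f (x, q t, eta t) - f (x, q0, eta0)| < e) FF) H.
have {}H : \forall t \near F, closure Omega `<=`
    (fun x => MDrow (q t) -> `|f (x, q t, eta t) - f (x, q0, eta0)| < e).
  apply: H => x Ox.
  have y0D : gydom (x, q0, eta0) by split.
  have e20 : 0 < e / 2 by rewrite divr_gt0.
  have [/subspace_continuousP/(_ _ y0D) + _] := cf.
  move=> /cvgrPdist_lt/(_ _ e20); rewrite near_withinE => -[[A B] /= [[[A1 A2] /= [A1x A2q] A12] Bx] AB].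
  have Atq : \forall t \near F, A2 (q t) /\ B (eta t).
    by apply: filterI; [exact: qq|exact: ee].
  exists (A1, fun t => A2 (q t) /\ B (eta t)) => // -[x' t] /= [A1x' [A2t Bt]] Ox' dqt.
  have h1 := AB (x', q t, eta t) (conj (A12 (x', q t) (conj A1x' A2t)) Bt) (conj Ox' dqt).
  have h2 := AB (x', q0, eta0) (conj (A12 (x', q0) (conj A1x' (nbhs_singleton A2q))) (nbhs_singleton Bx)) (conj Ox' dq0).
  by rewrite (le_lt_trans (ler_distD (f (x, q0, eta0)) _ _))// [ltRHS]splitr distrC ltrD.
by near=> t => x Ox; apply: (near H t) => //; near: t.
Unshelve. all: by end_near. Qed.

Lemma Chom_slice_bounded m (f : gypoint R m -> R) q eta : bounded_set Omega -> Chom f ->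
  MDrow q -> exists2 C : R, 0 <= C & forall x, closure Omega x -> `|f (x, q, eta)| <= C.
Proof. by move=> bO cf dq; apply: within_closure_bounded => //; exact: Chom_slice. Qed.

Lemma Chom_line_bounded m (f : gypoint R m -> R) (q c : 'rV[Xi R]_m) (M : R) :
  bounded_set Omega -> Chom f -> MDrow q -> MDrow c ->
  exists2 C : R, 0 <= C & forall x r, closure Omega x -> 0 <= r <= M ->
    `|f (x, rowaff r q c, 1)| <= C.
Proof.
move=> bO cf dq dc.
pose g (z : plane R * R) := f (z.1, rowaff z.2 q c, 1).
pose K : set (plane R * R) := closure Omega `*` `[0, M]%classic.
have cg : {within K, continuous g}.
  apply/subspace_continuousP => -[x r] [Ox _].
  apply: (@Chom_cvg m f _ _ _ (fun z => (z.1, rowaff z.2 q c, 1)) (x, rowaff r q c, 1)) => //.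
  - by split => //; exact: MDrow_aff.
  - by rewrite near_withinE; apply: nearW => -[y s] [Oy _]; split => //; exact: MDrow_aff.
  - apply: cvg_within_filter; apply: cvg_gypoint; [exact: cvg_fst| |exact: cvg_cst].
    apply: (@cvg_comp _ _ _ snd (fun r => rowaff r q c) _ _ _ cvg_snd).
    exact: rowaff_continuous.
have [C [_ hC]] : bounded_set (g @` K).
  apply: compact_bounded; apply: continuous_compact => //.
  by apply: compact_setX; [exact: closure_compact|exact: segment_compact].
exists (`|C| + 1) => [|x r Ox rM]; first by rewrite addr_ge0.
apply: hC; first by rewrite (le_lt_trans (ler_norm _))// ltrDl.
by exists (x, r) => //; split => //=; rewrite in_itv.
Qed.

(* Homogeneity turns the behaviour at large [r] into continuity at [(x, q, 0)]. *)
Lemma Chom_recession m (f : gypoint R m -> R) (q c : 'rV[Xi R]_m) (e : R) :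
  bounded_set Omega -> Chom f -> MDrow q -> MDrow c -> 0 < e ->
  exists2 C : R, 0 <= C & forall x r, closure Omega x -> 0 <= r ->
    `|f (x, rowaff r q c, 1) - f (x, c, 1) - r * f (x, q, 0)| <= e * r + C * (r != 0)%:R.
Proof.
move=> bO cf dq dc e0.
have arith (a b c' C1 C2 C3 M r : R) : `|a| <= C1 -> `|b| <= C2 -> `|c'| <= C3 -> 0 <= C3 ->
    0 <= r <= M -> `|a - b - r * c'| <= e * r + (C1 + C2 + M * C3).
  move=> h1 h2 h3 h4 /andP[r0 rM]; rewrite (le_trans (ler_normB _ _))// normrM (ger0_norm r0).
  have h5 : r * `|c'| <= M * C3 by rewrite ler_pM.
  have h6 : 0 <= e * r by rewrite mulr_ge0// ltW.
  by have := ler_normB a b; lra.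
have arith2 (a b c' C2 r : R) : `|a - c'| <= e * r -> `|b| <= C2 -> `|a - b - c'| <= e * r + C2.
  by rewrite !ler_norml => /andP[? ?] /andP[? ?]; apply/andP; split; lra.
(* With s = 1/r, homogeneity turns f (x, r q + c, 1) into r f (x, q + s c, s), so large r
   corresponds to s near 0; hence the exchanged roles of [c] and [q]. *)
have q0 : rowaff 0 c q = q.
  by apply/rowP => i; rewrite mxE scale0r mul0r !add0r -surjective_pairing.
have qs : (fun s => rowaff s c q) @ (0 : R)^'+ --> q.
  rewrite -[X in _ --> X]q0; apply: cvg_at_right_filter; exact: rowaff_continuous.
have es : (fun s : R => s) @ (0 : R)^'+ --> (0 : R).
  by apply: cvg_at_right_filter; exact: cvg_id.
have ds : \forall s \near (0 : R)^'+, MDrow (rowaff s c q).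
  by apply: nearW => s; exact: MDrow_aff.
have := Chom_tube (at_right_proper_filter (0 : R)) bO cf dq ds qs es e0.
move=> [d /= d0 dP].
have [C1 C10 h1] := Chom_line_bounded d^-1 bO cf dq dc.
have [C2 C20 h2] := Chom_slice_bounded 1 bO cf dc.
have [C3 C30 h3] := Chom_slice_bounded 0 bO cf dq.
(* For r <= 1/d the three terms are bounded separately; for larger r only f (x, c, 1) is left over,
   bounded by [C2]. At r = 0 the difference vanishes, whence the factor (r != 0), which integrates
   to the volume of the bands. *)
exists (C1 + C2 + d^-1 * C3).
  by rewrite !addr_ge0// mulr_ge0// invr_ge0 ltW.
move=> x r Ox r0; have [->|rn0] := eqVneq r 0.
  have -> : rowaff 0 q c = c.
    by apply/rowP => i; rewrite mxE scale0r mul0r !add0r -surjective_pairing.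
  by rewrite subrr !(mul0r, mulr0) subrr normr0 addr0.
have rp : 0 < r by rewrite lt0r rn0.
rewrite mulr1; have [rM|Mr] := leP r d^-1.
  by apply: arith => //; [apply: h1; rewrite ?r0|exact: h2|exact: h3|rewrite r0].
apply: (@le_trans _ _ (e * r + C2)); last first.
  have : 0 <= d^-1 * C3 by rewrite mulr_ge0// invr_ge0 ltW.
  by lra.
apply: arith2; last exact: h2.
have sd : ball_ [eta Num.Def.normr] 0 d r^-1.
  by rewrite /= sub0r normrN gtr0_norm ?invr_gt0// -[ltRHS]invrK ltf_pV2 ?posrE ?invr_gt0.
have s0 : 0 < r^-1 by rewrite invr_gt0.
have := dP _ sd s0 x Ox; set y := f _ => hy.
have [_ fh] := cf.
have -> : f (x, rowaff r q c, 1) = r * y.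
  rewrite /y -fh//; last by split => //; exact: MDrow_aff.
  congr f; rewrite /gyscale /= mulfV//; congr (_, _, _); apply/rowP => i; rewrite !mxE /=.
  by rewrite scalerDr scalerA mulrDr mulrA mulfV// scale1r mul1r addrC [in X in (_, X)]addrC.
by rewrite -mulrBr normrM gtr0_norm// mulrC ler_wpM2r// ltW.
Qed.

Lemma L1fun_le (D : set (mplane R)) (f g : plane R -> R) : measurable D ->
  measurable_fun D (f : mplane R -> R) -> L1fun D g -> (forall x, D x -> `|f x| <= g x) ->
  L1fun D f /\ `|\int[L2]_(x in D) f x| <= \int[L2]_(x in D) g x.
Proof.
move=> mD mf ig fg.
have i_f : L1fun D f.
  apply: (le_integrable mD _ _ ig); first exact/measurable_EFinP.
  by move=> x Dx /=; rewrite lee_fin (le_trans (fg x Dx))// ler_norm.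
split => //; rewrite (le_trans (le_normr_Rintegral mD i_f))//.
by apply: le_Rintegral => //; apply/integrable_abse: i_f.
Qed.

Lemma Rintegral_indic (D S : set (mplane R)) : measurable D -> measurable S ->
  \int[L2]_(x in D) \1_S x = vol (D `&` S).
Proof. by move=> mD mS; rewrite /vol /Rintegral integral_indic// setIC. Qed.

(** Integrating [Chom_recession] at r = rho n x leaves f (x, q, 0) tested against [rho n], with an
    error of at most e times the mass of [rho n] plus C times the volume of its support. The masses
    are bounded by weak convergence, so e is fixed first; this fixes C, and then n makes the volume
    small. *)
Lemma concentration m (f : gypoint R m -> R) (q c : 'rV[Xi R]_m) (rho : nat -> plane R -> R) :
  open Omega -> bounded_set Omega -> Chom f -> MDrow q -> MDrow c ->
  (forall n, continuous (rho n)) -> (forall n x, 0 <= rho n x) ->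
  (forall n, L1fun Omega (rho n)) ->
  (forall h : plane R -> R, {within closure Omega, continuous h} ->
    (fun n => \int[L2]_(x in Omega) (h x * rho n x)) @ \oo --> 2^-1 * \int[L2]_(x in Omega) h x) ->
  (fun n => vol (Omega `&` [set x | rho n x != 0])) @ \oo --> (0 : R) ->
  (forall n, L1fun Omega (fun x => f (x, rowaff (rho n x) q c, 1) - f (x, c, 1))) /\
  (fun n => \int[L2]_(x in Omega) (f (x, rowaff (rho n x) q c, 1) - f (x, c, 1))) @ \oo -->
    2^-1 * \int[L2]_(x in Omega) f (x, q, 0).
Proof.
move=> oO bO cf dq dc crho rho0 irho wrho vrho.
have mO := open_measurable2 oO; have O0 := bounded_lebesgue2_fin mO bO.
pose G n x := f (x, rowaff (rho n x) q c, 1) - f (x, c, 1).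
pose h x := f (x, q, 0).
have ch : {within closure Omega, continuous h} by exact: Chom_slice.
have mh := within_closure_measurable oO ch.
have mrho n : measurable_fun (Omega : set (mplane R)) (rho n : mplane R -> R).
  by apply: measurable_funTS; exact: continuous_measurable2T.
have mG n : measurable_fun (Omega : set (mplane R)) (G n : mplane R -> R).
  apply: measurable_funB; last first.
    by apply: within_closure_measurable => //; exact: Chom_slice.
  apply: continuous_measurable2 => // x Ox.
  apply: (@Chom_cvg m f _ _ _ (fun x => (x, rowaff (rho n x) q c, 1)) (x, rowaff (rho n x) q c, 1)) => //.
  - by split; [exact: subset_closure|exact: MDrow_aff].
  - have : nbhs x Omega by exact: open_nbhs_nbhs.
    by apply: filterS => y Oy; split; [exact: subset_closure|exact: MDrow_aff].
  - apply: cvg_gypoint; [exact: cvg_id| |exact: cvg_cst].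
    apply: (@continuous_comp _ _ _ (rho n) (fun r => rowaff r q c)); first exact: crho.
    exact: rowaff_continuous.
pose S n : set (mplane R) := [set x | rho n x != 0].
have mS n : measurable (S n).
  by apply: open_measurable2; exact: continuous_neq0_open.
have iS n : L1fun Omega (\1_(S n) : plane R -> R).
  apply: (@bounded_L1fun _ Omega _ 1) => //.
    by move=> x _; rewrite indicE; case: (_ \in _); rewrite ?normr1 ?normr0.
have D n e C : (forall x r, closure Omega x -> 0 <= r ->
    `|f (x, rowaff r q c, 1) - f (x, c, 1) - r * f (x, q, 0)| <= e * r + C * (r != 0)%:R) ->
    L1fun Omega (fun x => G n x - h x * rho n x) /\
    `|\int[L2]_(x in Omega) (G n x - h x * rho n x)| <=
      e * (\int[L2]_(x in Omega) rho n x) + C * vol (Omega `&` S n).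
  move=> eC.
  have iC : L1fun Omega (fun x => e * rho n x + C * \1_(S n) x).
    by apply: L1funD => //; exact: L1funZ.
  have [] := L1fun_le (f := fun x => G n x - h x * rho n x) mO _ iC.
  - by apply: measurable_funB => //; exact: measurable_funM.
  - move=> x Ox; rewrite [h x * _]mulrC (le_trans (eC x (rho n x) _ _))//.
      exact: subset_closure.
    rewrite lerD2l indicE /S; case: (boolP (rho n x != 0)) => r0.
      by rewrite mem_set.
    by rewrite memNset//; exact/negP.
  move=> i1 /le_trans i2; split => //; apply: i2.
  rewrite (RintegralD mO (L1funZ _ mO (irho n)) (L1funZ _ mO (iS n))).
  by rewrite (RintegralZl _ mO (irho n)) (RintegralZl _ mO (iS n)) Rintegral_indic.
have [Bh Bh0 hB] := within_closure_bounded bO ch.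
have ihr n : L1fun Omega (fun x => h x * rho n x).
  by apply: (L1fun_bounded_mul mO mh _ (irho n)) => x Ox; apply: hB; exact: subset_closure.
have iGd n : L1fun Omega (fun x => G n x - h x * rho n x).
  by have [C _ eC] := Chom_recession bO cf dq dc ltr01; have [] := D n 1 C eC.
have iG n : L1fun Omega (G n).
  by have := L1funD mO (iGd n) (ihr n); congr L1fun; apply/funext => x; rewrite subrK.
split => //.
have -> : (fun n => \int[L2]_(x in Omega) (f (x, rowaff (rho n x) q c, 1) - f (x, c, 1))) =
    fun n => \int[L2]_(x in Omega) (G n x - h x * rho n x) + \int[L2]_(x in Omega) (h x * rho n x).
  apply/funext => n; rewrite -(RintegralD mO (iGd n) (ihr n)).
  by apply: eq_Rintegral => x _; rewrite subrK.
rewrite -[X in _ --> X]add0r; apply: cvgD; last exact: wrho.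
apply/cvgr0Pnorm_le => e e0.
have vol0 : 0 <= vol Omega by rewrite /vol fine_ge0.
pose e' := e / (2 * (vol Omega + 1)).
have e'0 : 0 < e' by rewrite divr_gt0// mulr_gt0// ltr_wpDl.
have [C C0 eC] := Chom_recession bO cf dq dc e'0.
have mass : (fun n => \int[L2]_(x in Omega) rho n x) @ \oo --> 2^-1 * vol Omega.
  have c1 : continuous (fun _ : plane R => 1 : R) by exact: cst_continuous.
  have := wrho (fun=> 1) (continuous_subspaceT c1).
  rewrite Rintegral_cst// mul1r.
  have -> // : (fun n => \int[L2]_(x in Omega) (1 * rho n x)) = fun n => \int[L2]_(x in Omega) rho n x.
  by apply/funext => n; apply: eq_Rintegral => x _; rewrite mul1r.
have eC2 : 0 < e / (2 * (C + 1)) by rewrite divr_gt0// mulr_gt0// ltr_wpDl.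
near=> n.
have [_ /le_trans] := D n e' C eC; apply.
have h1 : \int[L2]_(x in Omega) rho n x <= vol Omega + 1.
  have : `|2^-1 * vol Omega - \int[L2]_(x in Omega) rho n x| <= 1.
    by near: n; move/cvgrPdist_le : mass; apply.
  by rewrite ler_norml => /andP[? ?]; lra.
have h2 : vol (Omega `&` S n) <= e / (2 * (C + 1)).
  rewrite -(ger0_norm (_ : 0 <= vol _)) ?fine_ge0//.
  by near: n; move/cvgr0Pnorm_le : vrho; apply.
rewrite [leRHS]splitr lerD//.
  rewrite (le_trans (ler_wpM2l (ltW e'0) h1))// /e' invfM mulrA mulfVK// gt_eqF//.
  by rewrite ltr_wpDl.
rewrite (le_trans (ler_wpM2l C0 h2))// mulrA ler_pdivrMr ?mulr_gt0 ?ltr_wpDl//.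
rewrite (_ : e / 2 * (2 * (C + 1)) = e * (C + 1)); last by field.
by rewrite mulrC ler_pM2l// lerDl.
Unshelve. all: by end_near. Qed.

End homogeneous_functions.

Section inner_product.
Variable R : realType.
Implicit Types A B : 'M[R]_2.

Lemma inner2 A B : inner A B = A ord0 ord0 * B ord0 ord0 + A ord0 ord_max * B ord0 ord_max
  + (A ord_max ord0 * B ord_max ord0 + A ord_max ord_max * B ord_max ord_max).
Proof. by rewrite /inner !big_ord_recl !big_ord0 !addr0 (_ : lift ord0 ord0 = ord_max)//; exact: val_inj. Qed.

Lemma inner_ge0 A : 0 <= inner A A.
Proof. by rewrite inner2 -!expr2 !addr_ge0// sqr_ge0. Qed.

Lemma inner_eq0 A : inner A A = 0 -> A = 0.
Proof.
move=> /eqP; rewrite /inner psumr_eq0; last first.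
  by move=> i _; apply: sumr_ge0 => j _; rewrite -expr2 sqr_ge0.
move=> /allP A0; apply/matrixP => i j; rewrite mxE.
have := A0 i (mem_index_enum i); rewrite psumr_eq0 => [/allP/(_ j (mem_index_enum j))/=|k _].
  by rewrite -expr2 sqrf_eq0 => /eqP.
by rewrite -expr2 sqr_ge0.
Qed.

Lemma cvg_inner T (F : set_system T) (FF : Filter F) (M N : T -> 'M[R]_2) A B :
  (forall i j, (fun t => M t i j) @ F --> A i j) -> (forall i j, (fun t => N t i j) @ F --> B i j) ->
  (fun t => inner (M t) (N t)) @ F --> inner A B.
Proof.
move=> MA NB.
have c i j : (fun t => M t i j * N t i j) @ F --> A i j * B i j.
  by apply: cvgM; [exact: MA|exact: NB].
rewrite inner2 (funext (fun t => inner2 (M t) (N t))).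
exact: cvgD (cvgD (c _ _) (c _ _)) (cvgD (c _ _) (c _ _)).
Qed.

Lemma innerZ A B a b : inner (a *: A) (b *: B) = a * b * inner A B.
Proof. by rewrite !inner2 !mxE; ring. Qed.

Lemma fnorm_sqr A : fnorm A ^+ 2 = inner A A.
Proof. by rewrite sqr_sqrtr// inner_ge0. Qed.

Lemma fnormZ A a : fnorm (a *: A) = `|a| * fnorm A.
Proof. by rewrite /fnorm innerZ -expr2 sqrtrM ?sqr_ge0// sqrtr_sqr. Qed.

Lemma fnorm_gt0 A : A != 0 -> 0 < fnorm A.
Proof.
move=> A0; rewrite sqrtr_gt0 lt0r inner_ge0 andbT.
by apply: contra A0 => /eqP/inner_eq0 ->.
Qed.

End inner_product.

(** * Young measures with coefficients constant in space *)

Section constant_young_measures.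
Variable R : realType.
Variable Omega : set (plane R).
Hypotheses (oO : open Omega) (bO : bounded_set Omega).
Local Notation L2 := (lebesgue2 R).
Local Notation Chom := (@Chom R Omega _).

Let mO : measurable (Omega : set (mplane R)). Proof. exact: open_measurable2. Qed.
Let O0 : (L2 Omega < +oo)%E. Proof. exact: bounded_lebesgue2_fin. Qed.

Definition gynorm m (q : 'rV[Xi R]_m) (eta : R) : R := Num.sqrt (Xinorm2 q + eta ^+ 2).

Lemma Xinorm2_ge0 m (q : 'rV[Xi R]_m) : 0 <= Xinorm2 q.
Proof. by apply: sumr_ge0 => i _; rewrite addr_ge0 ?sqr_ge0// inner_ge0. Qed.

Lemma Xinorm2_eq0 m (q : 'rV[Xi R]_m) : Xinorm2 q = 0 -> q = 0.
Proof.
move=> /eqP; rewrite /Xinorm2 psumr_eq0 => [/allP q0|i _]; last first.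
  by rewrite addr_ge0 ?sqr_ge0// inner_ge0.
apply/rowP => i; rewrite mxE; have := q0 i (mem_index_enum i) => /=.
rewrite paddr_eq0 ?sqr_ge0 ?inner_ge0// sqrf_eq0 => /andP[/eqP/inner_eq0 h1 /eqP h2].
by rewrite [q ord0 i]surjective_pairing h1 h2.
Qed.

(** Normalization to the unit sphere by homogeneity; if the norm is zero, homogeneity with factor 0
    gives the value 0. This yields the continuity bound of [Mstar]. *)
Lemma Chom_norm m (f : gypoint R m -> R) (M : R) x q eta : Chom f ->
  (forall y, gysphere Omega y -> `|f y| <= M) -> closure Omega x -> MDrow q ->
  `|f (x, q, eta)| <= M * gynorm q eta.
Proof.
move=> [_ fh] fM Ox dq; set N := gynorm q eta.
have N2 : N ^+ 2 = Xinorm2 q + eta ^+ 2 by rewrite sqr_sqrtr// addr_ge0 ?Xinorm2_ge0// sqr_ge0.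
have [N0|N0] := eqVneq N 0.
  have : Xinorm2 q + eta ^+ 2 == 0 by rewrite -N2 N0 expr0n.
  rewrite paddr_eq0 ?Xinorm2_ge0 ?sqr_ge0// sqrf_eq0 => /andP[/eqP/Xinorm2_eq0 q0 /eqP e0].
  have yd : gydom Omega ((x, q, eta) : gypoint R m) by [].
  have := fh 0 _ (lexx 0) yd; rewrite mul0r.
  rewrite /gyscale /= mul0r (_ : \row_i _ = q) ?e0 => [->|]; first by rewrite N0 normr0 mulr0.
  by apply/rowP => i; rewrite q0 !mxE /= scaler0 mul0r.
have Np : 0 < N by rewrite lt0r N0 sqrtr_ge0.
pose y : gypoint R m := (x, \row_i (N^-1 *: (q ord0 i).1, N^-1 * (q ord0 i).2), N^-1 * eta).
have yS : gysphere Omega y.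
  split; first by split => // i; rewrite mxE; exact: MD_scale.
  rewrite /y /= /Xinorm2 exprMn.
  under eq_bigr do rewrite mxE /= innerZ exprMn -expr2 -mulrDr.
  by rewrite -mulr_sumr -mulrDr -/(Xinorm2 q) -N2 exprVn mulVf// expf_neq0.
have -> : f (x, q, eta) = N * f y.
  rewrite -fh ?(ltW Np)//; last by case: yS.
  congr f; rewrite /gyscale /y /=; congr (_, _, _); last by rewrite mulrA mulfV// mul1r.
  apply/rowP => i; rewrite !mxE /= scalerA mulrA mulfV// scale1r mul1r.
  by rewrite -surjective_pairing.
by rewrite normrM gtr0_norm// mulrC ler_wpM2r// ?(ltW Np)//; exact: fM.
Qed.

Lemma Chom_L1 m (f : gypoint R m -> R) q eta : Chom f -> MDrow q ->
  L1fun Omega (fun x => f (x, q, eta)).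
Proof. by move=> cf dq; apply: within_closure_L1 => //; exact: Chom_slice. Qed.

Lemma Rintegral_bound (h : plane R -> R) (M : R) : L1fun Omega h ->
  (forall x, Omega x -> `|h x| <= M) -> `|\int[L2]_(x in Omega) h x| <= M * vol Omega.
Proof.
move=> ih hM.
have iM : L1fun Omega (fun=> M).
  by apply: (@bounded_L1fun _ Omega _ `|M|) => //; exact: measurable_cst.
have [_] := L1fun_le mO (L1fun_measurable ih) iM hM.
by rewrite Rintegral_cst.
Qed.

Lemma Rintegral_eq0 (h : plane R -> R) : (forall x, Omega x -> h x = 0) ->
  \int[L2]_(x in Omega) h x = 0.
Proof.
move=> h0; rewrite (@eq_Rintegral _ _ _ _ _ (fun=> 0)) ?Rintegral_cst ?mul0r// => x.
by rewrite inE; exact: h0.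
Qed.

Definition slab m (q : 'rV[Xi R]_m) (eta : R) : functional R m :=
  fun f => \int[L2]_(x in Omega) f (x, q, eta).

Lemma slab_linear m q eta a (f g : gypoint R m -> R) : MDrow q -> Chom f -> Chom g ->
  slab q eta (fun y => a * f y + g y) = a * slab q eta f + slab q eta g.
Proof.
move=> dq cf cg; have i1 := Chom_L1 eta cf dq; have i2 := Chom_L1 eta cg dq.
by rewrite /slab (RintegralD mO (L1funZ a mO i1) i2) (RintegralZl _ mO i1).
Qed.

Lemma slab_cvg m (q : nat -> 'rV[Xi R]_m) q0 eta f : Chom f -> MDrow q0 ->
  (forall k, MDrow (q k)) -> q @ \oo --> q0 ->
  (fun k => slab (q k) eta f) @ \oo --> slab q0 eta f.
Proof.
move=> cf dq0 dq qq; apply/cvgrPdist_le => e e0.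
have vol0 : 0 <= vol Omega by rewrite /vol fine_ge0.
have e1 : 0 < e / (vol Omega + 1) by rewrite divr_gt0// ltr_wpDl.
have dqn : \forall k \near \oo, MDrow (q k) by exact: nearW.
have H : \forall k \near \oo, forall x, closure Omega x ->
    `|f (x, q k, eta) - f (x, q0, eta)| < e / (vol Omega + 1).
  by apply: (@Chom_tube R Omega m f nat \oo _ q (fun=> eta)) => //; exact: cvg_cst.
apply: filterS H => k hk.
rewrite /slab -(RintegralB mO (Chom_L1 eta cf dq0) (Chom_L1 eta cf (dq k))).
apply: (@le_trans _ _ (e / (vol Omega + 1) * vol Omega)).
  apply: Rintegral_bound.
    by apply: L1funB => //; exact: Chom_L1.
  by move=> x Ox; rewrite distrC ltW//; apply: hk; exact: subset_closure.
by rewrite mulrAC ler_pdivrMr ?ltr_wpDl// ler_pM2l// lerDl.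
Qed.

(** [slab c 1] is [delta] and [slab q 0] is [omega] of a constant function. The fields of the
    example do not depend on the point, so all its Young measures have this form and depend on time
    through the rows only. *)
Definition twin m (c q q' : 'rV[Xi R]_m) : functional R m :=
  fun f => slab c 1 f + 2^-1 * slab q 0 f + 2^-1 * slab q' 0 f.

Lemma twin_GY m (c q q' : 'rV[Xi R]_m) : MDrow c -> MDrow q -> MDrow q' -> GY Omega (twin c q q').
Proof.
move=> dc dq dq'.
have vol0 : 0 <= vol Omega by rewrite /vol fine_ge0.
split.
- split.
    by move=> a f g cf cg; rewrite /twin !slab_linear//; ring.
  exists (vol Omega * (gynorm c 1 + 2^-1 * gynorm q 0 + 2^-1 * gynorm q' 0)).
    by rewrite mulr_ge0// !addr_ge0 ?mulr_ge0 ?sqrtr_ge0.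
  move=> f cf M M0 fM.
  have b p eta : MDrow p -> `|slab p eta f| <= M * gynorm p eta * vol Omega.
    move=> dp; apply: Rintegral_bound; first exact: Chom_L1.
    by move=> x Ox; apply: Chom_norm => //; exact: subset_closure.
  rewrite (le_trans (ler_normD _ _))//.
  have := ler_normD (slab c 1 f) (2^-1 * slab q 0 f).
  rewrite !normrM (ger0_norm (_ : 0 <= 2^-1 :> R)) ?invr_ge0//.
  by have := b c 1 dc; have := b q 0 dq; have := b q' 0 dq'; lra.
- move=> f cf f0.
  have b p eta : MDrow p -> 0 <= slab p eta f.
    move=> dp; apply: Rintegral_ge0 => x Ox; apply: f0; split => //.
    exact: subset_closure.
  by rewrite !addr_ge0 ?mulr_ge0 ?b.
- move=> f cf f0.
  have b p eta : MDrow p -> 0 <= eta -> slab p eta f = 0.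
    move=> dp e0; apply: Rintegral_eq0 => x Ox; apply: f0 => //; split => //.
    exact: subset_closure.
  by rewrite /twin !b// mulr0 !addr0.
- move=> phi cphi; rewrite /twin /slab /=.
  have -> : \int[L2]_(x in Omega) (phi x * 1) = \int[L2]_(x in Omega) phi x.
    by apply: eq_Rintegral => x _; rewrite mulr1.
  have z : \int[L2]_(x in Omega) (phi x * 0) = 0.
    by apply: Rintegral_eq0 => x _; rewrite mulr0.
  by rewrite z mulr0 !addr0.
Qed.

Lemma twin_cvg m (c : 'rV[Xi R]_m) (q q' : nat -> 'rV[Xi R]_m) q0 q'0 : MDrow c ->
  MDrow q0 -> MDrow q'0 -> (forall k, MDrow (q k)) -> (forall k, MDrow (q' k)) ->
  q @ \oo --> q0 -> q' @ \oo --> q'0 ->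
  gy_cvg Omega (fun k => twin c (q k) (q' k)) (twin c q0 q'0).
Proof.
move=> dc dq0 dq'0 dq dq' qq qq' f cf.
by apply: cvgD; [apply: cvgD; [exact: cvg_cst|]|]; apply: cvgMr; exact: slab_cvg.
Qed.

End constant_young_measures.

(** * Strains of smooth fields *)

Section smooth_fields.
Variable R : realType.
Variable Omega : set (plane R).
Hypotheses (oO : open Omega) (bO : bounded_set Omega).
Local Notation L2 := (lebesgue2 R).
Local Notation measR := (charge (mplane R) R).
Implicit Types (h f : plane R -> R) (U : plane R -> plane R).

Let mO : measurable (Omega : set (mplane R)). Proof. exact: open_measurable2. Qed.
Let O0 : (L2 Omega < +oo)%E. Proof. exact: bounded_lebesgue2_fin. Qed.

Lemma continuous_bounded_domain h : continuous h ->
  exists2 B : R, 0 <= B & forall x, Omega x -> `|h x| <= B.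
Proof.
move=> ch; have [B B0 hB] := within_closure_bounded bO (continuous_subspaceT ch).
by exists B => // x Ox; apply: hB; exact: subset_closure.
Qed.

Lemma continuous_L1 h : continuous h -> L1fun Omega h.
Proof. by move=> ch; apply: within_closure_L1 => //; exact: continuous_subspaceT. Qed.

Lemma continuous_measurable_domain h : continuous h ->
  measurable_fun (Omega : set (mplane R)) (h : mplane R -> R).
Proof. by move=> ch; apply: measurable_funTS; exact: continuous_measurable2T. Qed.

Lemma L1fun_patch h : L1fun Omega h -> L1fun setT (h \_ Omega).
Proof. by move=> /(integrable_mkcond _ mO).1; rewrite restrict_EFin. Qed.

(* [0] when [h] is not integrable on Omega. *)
Definition dens h : measR :=
  if pselect (L1fun setT (h \_ Omega)) is left ih then density_charge ih else czero.

Lemma dens_patchE h (B : set (mplane R)) : L1fun Omega h -> measurable B ->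
  dens h B = (\int[L2]_(x in B) ((h \_ Omega) x)%:E)%E.
Proof.
move=> /L1fun_patch ih mB; rewrite /dens; case: pselect => // ih'.
Qed.

Lemma densE h (B : set (mplane R)) : L1fun Omega h -> measurable B ->
  dens h B = (\int[L2]_(x in B `&` Omega) (h x)%:E)%E.
Proof.
move=> ih mB; rewrite dens_patchE// integral_mkcondr.
by apply: eq_integral => x _; rewrite restrict_EFin.
Qed.

Lemma densE_Rintegral h (B : set (mplane R)) : L1fun Omega h -> measurable B ->
  dens h B = (\int[L2]_(x in B `&` Omega) h x)%:E.
Proof.
move=> ih mB; rewrite densE// fineK//; apply: integrable_fin_num; first exact: measurableI.
exact: L1funS (measurableI _ _ mB mO) _ ih.
Qed.

Lemma dens_concentrated h : L1fun Omega h -> concentrated (dens h) (closure Omega).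
Proof.
move=> ih B mB B0; rewrite densE// (_ : B `&` Omega = set0) ?integral_set0//.
by rewrite -subset0 -B0; apply: setIS; exact: subset_closure.
Qed.

Lemma charge_integral_dens h f : L1fun Omega h -> continuous f ->
  charge_integral (dens h) Omega f = \int[L2]_(x in Omega) (f x * h x).
Proof.
move=> ih cf; have [M _ fM] := continuous_bounded_domain cf.
rewrite (charge_integral_density (h := h \_ Omega) (M := M))//.
- by apply: eq_Rintegral => x xO; rewrite patchE xO.
- exact: L1fun_patch.
- by move=> B mB; exact: dens_patchE.
- exact: continuous_measurable_domain.
Qed.

Definition C1field U := forall i, C1fun (fun x => coord2 (U x) i).

Definition sym_partial U (i j : 'I_2) (x : plane R) : R :=
  2^-1 * (partial j (fun y => coord2 (U y) i) x + partial i (fun y => coord2 (U y) j) x).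

Lemma sym_partial_continuous U i j : C1field U -> continuous (sym_partial U i j).
Proof.
move=> cU x; apply: cvgMr; apply: cvgD.
  exact: (C1_partial_continuous (i := j) (cU i)).
exact: (C1_partial_continuous (i := i) (cU j)).
Qed.

(** Either factor may carry the compact support: the test function, for the distributional strain,
    or the field, for the Green formula, where the test function need not vanish at the boundary. *)
Lemma sym_partial_parts U K phi i j : C1field U -> C1fun phi -> compact K -> K `<=` Omega ->
  (forall x, ~ K x -> phi x = 0) \/ (forall x i, ~ K x -> coord2 (U x) i = 0) ->
  \int[L2]_(x in Omega) (phi x * sym_partial U i j x) =
  - \int[L2]_(x in Omega)
      (2^-1 * (coord2 (U x) i * partial j phi x + coord2 (U x) j * partial i phi x)).
Proof.
move=> cU cphi cK KO supp.
have ibp k l : \int[L2]_(x in Omega) (phi x * partial l (fun y => coord2 (U y) k) x) =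
    - \int[L2]_(x in Omega) (coord2 (U x) k * partial l phi x).
  case: supp => s; first exact: integral_partial_mul0 cK KO cphi (cU k) s.
  by rewrite (@integral_partial_mul0 R Omega K (fun y => coord2 (U y) k))// ?opprK// => x; exact: s.
have i1 k l : L1fun Omega (fun x => phi x * partial l (fun y => coord2 (U y) k) x).
  apply: continuous_L1 => x; apply: cvgM; first exact: (C1_continuous cphi).
  exact: (C1_partial_continuous (cU k)).
have i2 k l : L1fun Omega (fun x => coord2 (U x) k * partial l phi x).
  apply: continuous_L1 => x; apply: cvgM; first exact: (C1_continuous (cU k)).
  exact: (C1_partial_continuous cphi).
have -> : \int[L2]_(x in Omega) (phi x * sym_partial U i j x) =
    2^-1 * (\int[L2]_(x in Omega) (phi x * partial j (fun y => coord2 (U y) i) x) +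
            \int[L2]_(x in Omega) (phi x * partial i (fun y => coord2 (U y) j) x)).
  rewrite -(RintegralD mO (i1 i j) (i1 j i)) -(RintegralZl _ mO (L1funD mO (i1 i j) (i1 j i))).
  by apply: eq_Rintegral => x _; rewrite /sym_partial mulrCA mulrDr.
rewrite (RintegralZl _ mO (L1funD mO (i2 i j) (i2 j i))) (RintegralD mO (i2 i j) (i2 j i)).
by rewrite !ibp -opprD mulrN.
Qed.

Lemma sym_grad_C1 U : C1field U -> sym_grad Omega U (fun i j => dens (sym_partial U i j)).
Proof.
move=> cU phi [/(_ [::])/= cphi [K [cK KO] phi0]] i j.
rewrite charge_integral_dens; last exact: (C1_continuous cphi).
  by apply: (sym_partial_parts (K := K)) => //; left.
by apply: continuous_L1; exact: sym_partial_continuous.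
Qed.

Lemma C1field_L1 U : C1field U -> L1vec Omega U.
Proof. by move=> cU i; apply: continuous_L1; exact: (C1_continuous (cU i)). Qed.

Lemma C1field_BD U : C1field U -> BD Omega U.
Proof.
move=> cU; split; first exact: C1field_L1.
by exists (fun i j => dens (sym_partial U i j)); exact: sym_grad_C1.
Qed.

(** A field vanishing outside a compact subset of [Omega] produces no boundary term in the Green
    formula, so the zero function qualifies as its trace. *)
Lemma zero_trace U K : C1field U -> compact K -> K `<=` Omega ->
  (forall x i, ~ K x -> coord2 (U x) i = 0) -> BD_trace Omega U (fun=> 0).
Proof.
move=> cU cK KO U0; split.
- exact: C1field_L1.
- move=> i; rewrite (_ : (fun x => _) = cst 0%E); first exact: integrable0.
  by apply/funext => x; rewrite /coord2; case: ifP.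
- exists (fun i j => dens (sym_partial U i j)); first exact: sym_grad_C1.
  move=> phi cphi i j; rewrite charge_integral_dens; last exact: (C1_continuous cphi).
    rewrite (sym_partial_parts (K := K))//; last by right.
    rewrite addNr; apply/esym; rewrite /Rintegral (_ : (fun x => _) = cst 0%E) ?integral0//.
    apply/funext => x; rewrite mxE /coord2 /=; case: ifP; case: ifP => _ _; rewrite ?mul0r ?mulr0 ?addr0 ?mulr0//.
  by apply: continuous_L1; exact: sym_partial_continuous.
Qed.

Lemma continuous_L2fun h : continuous h -> L2fun Omega h.
Proof.
move=> ch; split; first exact: continuous_measurable_domain.
by apply: continuous_L1 => x; apply: cvgM; exact: ch.
Qed.

Lemma inner_cvg0 (d : nat -> plane R -> 'M[R]_2) (B : R) :
  (forall n i j, continuous (fun x => d n x i j)) ->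
  (forall n x i j, Omega x -> `|d n x i j| <= B) ->
  (forall x i j, Omega x -> (fun n => d n x i j) @ \oo --> (0 : R)) ->
  (fun n => \int[L2]_(x in Omega) inner (d n x) (d n x)) @ \oo --> (0 : R).
Proof.
move=> cd dB d0.
have z : \int[L2]_(x in Omega) (0 : R) = 0 by apply: Rintegral_eq0.
rewrite -[X in _ --> X]z.
apply: (@bounded_dct _ Omega (fun n x => inner (d n x) (d n x)) (fun=> 0) (4 * B ^+ 2)) => //.
- move=> n; apply: continuous_measurable_domain => x.
  by apply: cvg_inner => i j; exact: cd.
- move=> n x Ox; rewrite ger0_norm ?inner_ge0// inner2.
  have sq i j : d n x i j * d n x i j <= B ^+ 2.
    by rewrite -expr2 -real_normK ?num_real// lerXn2r ?nnegrE// ?(le_trans _ (dB n x i j Ox))// dB.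
  have := sq ord0 ord0; have := sq ord0 ord_max; have := sq ord_max ord0; have := sq ord_max ord_max.
  lra.
- move=> x Ox; rewrite -[X in _ --> X](_ : inner (0 : 'M[R]_2) 0 = 0); last first.
    by rewrite inner2 !mxE; ring.
  by apply: cvg_inner => i j; rewrite mxE; exact: d0.
Qed.

End smooth_fields.

(** * Recovery sequences *)

Section slip_systems.
Variable R : realType.

Lemma ord2P (P : 'I_2 -> Prop) : P ord0 -> P ord_max -> forall i, P i.
Proof.
move=> P0 P1 [[|[|//]] lti]; first by rewrite (_ : Ordinal lti = ord0)//; exact: val_inj.
by rewrite (_ : Ordinal lti = ord_max)//; exact: val_inj.
Qed.

Lemma coord2_0 (v : plane R) : coord2 v ord0 = v.1. Proof. by []. Qed.

Lemma coord2_1 (v : plane R) : coord2 v ord_max = v.2. Proof. by []. Qed.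

Definition coord2E := (coord2_0, coord2_1).

Lemma MD_entries (A : 'M[R]_2) : MD A ->
  A ord_max ord_max = - A ord0 ord0 /\ A ord_max ord0 = A ord0 ord_max.
Proof.
move=> [sA]; rewrite /mxtrace !big_ord_recl big_ord0 addr0.
rewrite (_ : lift ord0 ord0 = ord_max); last exact: val_inj.
move=> tA; split; first by apply/eqP; rewrite -addr_eq0 addrC tA.
by rewrite -[in LHS]sA mxE.
Qed.

(** The quadratic form of A is a x^2 + 2 b x y - a y^2, of determinant - (a^2 + b^2) < 0; being
    indefinite it is a product of two real linear forms, whose coefficients are [v1] and [v2]. *)
Lemma odot_decomp (A : 'M[R]_2) : MD A -> A != 0 ->
  exists v1 v2 i, A = odot v1 v2 /\ coord2 v2 i != 0.
Proof.
move=> /MD_entries[e1 e2] A0.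
have odotE (v1 v2 : plane R) : v1.1 * v2.1 = A ord0 ord0 -> v1.2 * v2.2 = - A ord0 ord0 ->
    v1.1 * v2.2 + v1.2 * v2.1 = 2 * A ord0 ord_max -> A = odot v1 v2.
  move=> h1 h2 h3; apply/matrixP; apply: ord2P; apply: ord2P; rewrite mxE ?e1 ?e2 !coord2E; lra.
have [a0|a0] := eqVneq (A ord0 ord0) 0.
  exists (2 * A ord0 ord_max, 0), (0, 1), ord_max; split; last by rewrite coord2E oner_neq0.
  by apply: odotE; rewrite /= ?a0; ring.
set a := A ord0 ord0 in a0 e1 odotE *; set b := A ord0 ord_max in e2 odotE *.
pose r := Num.sqrt (a ^+ 2 + b ^+ 2).
have r2 : r ^+ 2 = a ^+ 2 + b ^+ 2 by rewrite sqr_sqrtr// addr_ge0// sqr_ge0.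
(* Factorization for a != 0 with r^2 = a^2 + b^2: the second coefficients multiply to (b^2 - r^2) /
   a = - a, and the mixed products add up to 2 b. *)
exists (a, b - r), (1, (b + r) / a), ord0; split; last by rewrite coord2E oner_neq0.
apply: odotE; rewrite /=.
- by rewrite mulr1.
- by apply: (mulIf a0); rewrite mulrA divfK//; nra.
- by rewrite mulrCA mulfV// !mulr1; ring.
Qed.

End slip_systems.

Section continuity.
Variable R : realType.
Implicit Types f g : plane R -> R.

Lemma continuous_cst2 (c : R) : continuous (fun _ : plane R => c).
Proof. exact: cst_continuous. Qed.

Lemma continuous_add2 f g : continuous f -> continuous g -> continuous (fun x => f x + g x).
Proof. by move=> cf cg x; apply: cvgD; [exact: cf|exact: cg]. Qed.

Lemma continuous_opp2 f : continuous f -> continuous (fun x => - f x).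
Proof. by move=> cf x; apply: cvgN; exact: cf. Qed.

Lemma continuous_mul2 f g : continuous f -> continuous g -> continuous (fun x => f x * g x).
Proof. by move=> cf cg x; apply: cvgM; [exact: cf|exact: cg]. Qed.

End continuity.

(** Decomposes sums, opposites and products of functions on the plane; the leaves are closed by the
    continuity facts of the context. *)
Ltac continuity2 := lazymatch goal with
  | |- continuous (fun _ => ?c) => exact: continuous_cst2
  | |- continuous (fun x => @?f x + @?g x) =>
      apply: (@continuous_add2 _ f g); [continuity2|continuity2]
  | |- continuous (fun x => - @?f x) => apply: (@continuous_opp2 _ f); continuity2
  | |- continuous (fun x => @?f x * @?g x) =>
      apply: (@continuous_mul2 _ f g); [continuity2|continuity2]
  | |- _ => by []
  end.

Section recovery.
Variable R : realType.
Variables (Omega : set (plane R)) (xi0 : 'M[R]_2) (v1 v2 : plane R).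
Variables (psi g rp rm : nat -> plane R -> R).
Hypotheses (oO : open Omega) (bO : bounded_set Omega).
Hypothesis Av : sympart xi0 = odot v1 v2.
Hypothesis dA : MD (sympart xi0).
Hypothesis pf : profile Omega v2 psi g rp rm.
Local Notation L2 := (lebesgue2 R).
Local Notation A := (sympart xi0).

Let mO : measurable (Omega : set (mplane R)). Proof. exact: open_measurable2. Qed.
Let O0 : (L2 Omega < +oo)%E. Proof. exact: bounded_lebesgue2_fin. Qed.

Let cpsi n : continuous (psi n). Proof. exact: (C1_continuous (psi_C1 pf n)). Qed.
Let cpsi' n j : continuous (partial j (psi n)).
Proof. exact: (C1_partial_continuous (psi_C1 pf n)). Qed.
Let cg n : continuous (g n). Proof. exact: (C1_continuous (g_C1 pf n)). Qed.
Let crp := rp_continuous pf.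
Let crm := rm_continuous pf.

Let psi1 n x : `|psi n x| <= 1.
Proof. by have /andP[p0 p1] := psi_01 pf n x; rewrite ger0_norm. Qed.

Lemma sympart_entry (i j : 'I_2) : 2^-1 * (xi0 i j + xi0 j i) = A i j.
Proof. by rewrite !mxE. Qed.

Lemma odot_entry (i j : 'I_2) : 2^-1 * (coord2 v1 i * coord2 v2 j + coord2 v1 j * coord2 v2 i) = A i j.
Proof. by rewrite Av mxE. Qed.

Definition recovery_u (t b : R) n (x : plane R) : plane R :=
  t *: matvec xi0 x + (b * (g n x * psi n x)) *: v1.

(** The part of the strain that converges strongly. The spikes b psi (rp + rm) A are left to
    [recovery_p]; what remains of (a + b) A - b psi A is a A + b (1 - psi) A, and the last term is
    the error due to the gradient of the cutoff. *)
Definition recovery_e (a b : R) n (x : plane R) : 'M[R]_2 :=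
  a *: A + (b * (1 - psi n x)) *: A + (b * g n x) *: odot v1 (grad (psi n) x).

Definition recovery_p (b : R) n (x : plane R) : 'M[R]_2 :=
  (b * (psi n x * (rp n x + rm n x))) *: A.

Definition recovery_z (th z : R) n (x : plane R) : R :=
  th + z * (psi n x * (rp n x - rm n x)).

Lemma matvec_C1 : C1field (matvec xi0) /\
  forall i j, partial j (fun x => coord2 (matvec xi0 x) i) = fun=> xi0 i j.
Proof.
have E i : (fun x => coord2 (matvec xi0 x) i) = dot2 (xi0 i ord0, xi0 i ord_max).
  apply/funext => x; move: i; apply: ord2P; rewrite coord2E /matvec /dot2 /=.
    by rewrite !big_ord_recl big_ord0 addr0 (_ : lift ord0 ord0 = ord_max)//; exact: val_inj.
  by rewrite !big_ord_recl big_ord0 addr0 (_ : lift ord0 ord0 = ord_max)//; exact: val_inj.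
split=> [i|i j]; rewrite E; first exact: (C1_dot2 _).1.
by rewrite (C1_dot2 _).2; apply/funext => x; move: j; apply: ord2P; rewrite coord2E.
Qed.

Let W n := C1_mul (g_C1 pf n) (psi_C1 pf n).

Lemma recovery_u_C1 t b n : C1field (recovery_u t b n) /\
  forall i j, partial j (fun x => coord2 (recovery_u t b n x) i) = fun x =>
    t * xi0 i j + b * coord2 v1 i * (g n x * partial j (psi n) x +
       psi n x * ((rp n x + rm n x - 1) * coord2 v2 j)).
Proof.
have E i : (fun x => coord2 (recovery_u t b n x) i) =
    fun x => t * coord2 (matvec xi0 x) i + b * coord2 v1 i * (g n x * psi n x).
  by apply/funext => x; rewrite /recovery_u /coord2; case: ifP => _ /=; rewrite /GRing.scale/=; ring.
have [mC mp] := matvec_C1.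
have H1 i := C1_scale t (mC i).
have H2 i := C1_scale (b * coord2 v1 i) (W n).1.
have C3 i := C1_add (H1 i).1 (H2 i).1.
split=> [i|i j]; rewrite E; first exact: (C3 i).1.
by rewrite (C3 i).2 (H1 i).2 mp (H2 i).2 (W n).2 (g_partial pf).
Qed.

Lemma recovery_strain t b n (i j : 'I_2) x : sym_partial (recovery_u t b n) i j x =
  t * A i j + b * (psi n x * (rp n x + rm n x - 1)) * A i j +
  b * (2^-1 * (coord2 v1 i * (g n x * partial j (psi n) x) + coord2 v1 j * (g n x * partial i (psi n) x))).
Proof.
have [_ p1] := recovery_u_C1 t b n.
(* The entry of A is read as a symmetrized entry of [xi0] in the term with t, and as an entry of
   [odot v1 v2] in the term with b; then both sides agree as polynomials. *)
have shift (s r c : R) : s = c -> r = c -> forall k l, k * s + l * r = k * c + l * c by move=> -> ->.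
by rewrite -(shift _ _ _ (sympart_entry i j) (odot_entry i j)) /sym_partial !p1; ring.
Qed.

Lemma grad_coord (f : plane R -> R) x j : coord2 (grad f x) j = partial j f x.
Proof. by move: j; apply: ord2P. Qed.

Lemma recovery_e_entry a b n x i j : recovery_e a b n x i j =
  a * A i j + b * (1 - psi n x) * A i j +
  b * (2^-1 * (coord2 v1 i * (g n x * partial j (psi n) x) + coord2 v1 j * (g n x * partial i (psi n) x))).
Proof. by rewrite /recovery_e !mxE !grad_coord; ring. Qed.

Lemma recovery_sum a b t n x i j : a + b = t ->
  sym_partial (recovery_u t b n) i j x = recovery_e a b n x i j + recovery_p b n x i j.
Proof. by move=> <-; rewrite recovery_strain recovery_e_entry /recovery_p !mxE; ring. Qed.

Lemma recovery_e_continuous a b n i j : continuous (fun x => recovery_e a b n x i j).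
Proof.
rewrite (funext (fun x => recovery_e_entry a b n x i j)); continuity2.
Qed.

Lemma recovery_p_continuous b n i j : continuous (fun x => recovery_p b n x i j).
Proof.
rewrite (_ : (fun x => _) = fun x => (b * (psi n x * (rp n x + rm n x))) * A i j); last first.
  by apply/funext => x; rewrite /recovery_p !mxE.
continuity2.
Qed.

Lemma recovery_z_continuous th z n : continuous (recovery_z th z n).
Proof. rewrite /recovery_z; continuity2. Qed.

Definition recovery_pm b n : measmat R := fun i j => dens Omega (fun x => recovery_p b n x i j).

Lemma recovery_pm_MbD b n : MbD Omega (recovery_pm b n).
Proof.
have ip i j : L1fun Omega (fun x => recovery_p b n x i j).
  by apply: continuous_L1 => //; exact: recovery_p_continuous.
have dp x : MD (recovery_p b n x) by exact: MD_scale.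
split=> [i j|i j B mB|B mB].
- exact: dens_concentrated.
- rewrite /recovery_pm !densE//; apply: eq_integral => x _.
  by rewrite -[in LHS](dp x).1 mxE.
- rewrite /recovery_pm !big_ord_recl big_ord0 adde0 (_ : lift ord0 ord0 = ord_max); last exact: val_inj.
  rewrite !densE_Rintegral// -EFinD.
  have mBO : measurable (B `&` Omega) by exact: measurableI.
  rewrite -RintegralD//; last 2 first.
  - exact: L1funS (ip _ _).
  - exact: L1funS (ip _ _).
  rewrite (_ : (fun x => _) = cst 0) ?Rintegral_cst ?mul0r//.
    by apply/funext => x; have [-> _] := MD_entries (dp x); rewrite subrr.
Qed.

Lemma bdry_open_disjoint (B : set (plane R)) : B `<=` bdry Omega -> B `&` Omega = set0.
Proof.
move=> BO; rewrite -subset0 => x [/BO[_ nx] Ox]; apply: nx.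
by have /interior_id -> := oO.
Qed.

(** The oscillation is compactly supported in [Omega], so the displacement differs from the datum by
    a field of trace zero, and the plastic strain, having a density on [Omega], carries no mass on
    the boundary. *)
Lemma recovery_admissible a b t n : a + b = t ->
  admissible Omega (bdry Omega) (fun x => t *: matvec xi0 x) (recovery_u t b n)
    (recovery_e a b n) (recovery_pm b n).
Proof.
move=> abt.
have ip i j : L1fun Omega (fun x => recovery_p b n x i j).
  by apply: continuous_L1 => //; exact: recovery_p_continuous.
have ie i j : L1fun Omega (fun x => recovery_e a b n x i j).
  by apply: continuous_L1 => //; exact: recovery_e_continuous.
have [uC up] := recovery_u_C1 t b n.
split.
- exact: C1field_BD.
- split; first by move=> i j; apply: continuous_L2fun => //; exact: recovery_e_continuous.
  apply: aeW => x _; apply/matrixP => i j; rewrite mxE !recovery_e_entry.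
  have [<- _] := dA; rewrite !mxE; ring.
- exact: recovery_pm_MbD.
- exists (fun i j => dens Omega (sym_partial (recovery_u t b n) i j)).
    exact: sym_grad_C1.
  move=> B mB BO i j; rewrite /recovery_pm.
  rewrite densE_Rintegral//; last first.
    by apply: continuous_L1 => //; exact: sym_partial_continuous.
  rewrite densE_Rintegral// (setIidl BO).
  have iB h : L1fun Omega h -> L1fun B h by exact: L1funS.
  rewrite -[X in (_ = X + _)%E]fineK; last by apply: integrable_fin_num => //; exact: iB.
  rewrite -EFinD; congr EFin; rewrite -[RHS](RintegralD mB (iB _ (ie i j)) (iB _ (ip i j))).
  by apply: eq_Rintegral => x _; rewrite (recovery_sum _ _ _ _ abt).
- have [K [cK KO] K0] := psi_supp pf n.
  pose U (x : plane R) := t *: matvec xi0 x - recovery_u t b n x.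
  have EU i : (fun x => coord2 (U x) i) = fun x => (- (b * coord2 v1 i)) * (g n x * psi n x).
    by apply/funext => x; rewrite /U /recovery_u /coord2; case: ifP => _ /=; rewrite /GRing.scale/=; ring.
  exists (fun=> 0).
    apply: (@zero_trace R Omega oO bO U K) => //.
      by move=> i; rewrite EU; exact: (C1_scale _ (W n).1).1.
    by move=> x i Kx; rewrite (congr1 (fun f => f x) (EU i)) K0// !mulr0.
  move=> B mB BO i j; rewrite /recovery_pm densE// bdry_open_disjoint// integral_set0.
  rewrite (_ : (fun x => _) = cst 0%E) ?integral0//.
  by apply/funext => x; rewrite mxE /coord2 /=; case: ifP; case: ifP => _ _; rewrite ?mul0r ?mulr0 ?addr0 ?mulr0.
Qed.

Let inv0 : (fun n => n.+1%:R^-1 : R) @ \oo --> (0 : R).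
Proof. exact: cvg_harmonic. Qed.

Let gpsi_cvg j x : (fun n => g n x * partial j (psi n) x) @ \oo --> (0 : R).
Proof.
apply/norm_cvg0P; apply: (@squeeze_cvgr _ _ _ _ (fun=> 0) (fun n => n.+1%:R^-1)).
- by apply: nearW => n; rewrite normr_ge0 (g_psi_small pf).
- exact: cvg_cst.
- exact: inv0.
Qed.

Let odot_bound (p q c d : R) : `|p| <= 1 -> `|q| <= 1 ->
  `|2^-1 * (c * p + d * q)| <= `|c| + `|d|.
Proof.
move=> p1 q1; have h1 : `|c * p| <= `|c| by rewrite normrM ler_piMr.
have h2 : `|d * q| <= `|d| by rewrite normrM ler_piMr.
rewrite normrM ger0_norm ?invr_ge0//; have := ler_normD (c * p) (d * q).
by have := normr_ge0 c; have := normr_ge0 d; lra.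
Qed.

Let g1 n j x : `|g n x * partial j (psi n) x| <= 1.
Proof. by rewrite (le_trans (g_psi_small pf n j x))// invf_le1// ler1n. Qed.

Lemma recovery_e_strong a b : L2_strong Omega (recovery_e a b) (fun=> a *: A).
Proof.
(* The factor 2 covers the diagonal entries, where the same coordinate of [v1] occurs twice. *)
pose B := `|b| * (fnorm A + (`|coord2 v1 ord0| + `|coord2 v1 ord_max|) * 2).
have E n x i j : (recovery_e a b n x - a *: A) i j = b * ((1 - psi n x) * A i j +
    2^-1 * (coord2 v1 i * (g n x * partial j (psi n) x) + coord2 v1 j * (g n x * partial i (psi n) x))).
  by rewrite [LHS]mxE recovery_e_entry !mxE; ring.
apply: (@inner_cvg0 R Omega oO bO (fun n x => recovery_e a b n x - a *: A) B).
- move=> n i j; rewrite (funext (fun x => E n x i j)); continuity2.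
- move=> n x i j Ox; rewrite E normrM ler_wpM2l// (le_trans (ler_normD _ _))// lerD//.
    rewrite normrM.
    have h1 : `|1 - psi n x| <= 1.
      by have /andP[? ?] := psi_01 pf n x; rewrite ger0_norm; lra.
    have h2 : `|A i j| <= fnorm A.
      rewrite -sqrtr_sqr ler_wsqrtr// /inner (bigD1 i)//= (bigD1 j)//= expr2 -addrA lerDl.
      apply: addr_ge0; apply: sumr_ge0 => k _; first by rewrite -expr2 sqr_ge0.
      by apply: sumr_ge0 => l _; rewrite -expr2 sqr_ge0.
    by have := normr_ge0 (A i j); have := normr_ge0 (1 - psi n x); nra.
  have h := @odot_bound (g n x * partial j (psi n) x) (g n x * partial i (psi n) x)
    (coord2 v1 i) (coord2 v1 j) (g1 n j x) (g1 n i x).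
  rewrite (le_trans h)//; have k0 := normr_ge0 (coord2 v1 ord0).
  have k1 := normr_ge0 (coord2 v1 ord_max); move: i j {h}.
  by apply: ord2P; apply: ord2P; lra.
- move=> x i j Ox; rewrite (funext (fun n => E n x i j)).
  rewrite -[X in _ --> X](_ : b * ((1 - 1) * A i j + 2^-1 * (coord2 v1 i * 0 + coord2 v1 j * 0)) = 0); last by ring.
  have := psi_cvg pf Ox => c1.
  apply: cvgMr; apply: cvgD.
    by apply: cvgMl; apply: cvgB; [exact: cvg_cst|].
  by apply: cvgMr; apply: cvgD; apply: cvgMr; exact: gpsi_cvg.
Qed.

(** Convergence in L^1 comes from the smallness of [g n]. In the strain, psi (rp + rm - 1) tends
    weakly to 1/2 + 1/2 - 1 = 0, so the spikes leave no trace in the limit strain, and the term with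
    the gradient of the cutoff tends to 0 boundedly. *)
Lemma recovery_u_weakstar t b :
  BD_weakstar Omega (recovery_u t b) (fun x => t *: matvec xi0 x).
Proof.
have uC n := (recovery_u_C1 t b n).1.
(* The limit is itself a recovery field, with slip 0, so its strain is an instance of
   [recovery_strain]; the index 0 is arbitrary. *)
have u0E : (fun x => t *: matvec xi0 x) = recovery_u t 0 0.
  by apply/funext => x; rewrite /recovery_u mul0r scale0r addr0.
have wC : C1field (fun x => t *: matvec xi0 x) by rewrite u0E; exact: (recovery_u_C1 _ _ _).1.
split.
- by move=> n; exact: C1field_L1.
- exact: C1field_L1.
- have enE n x : enorm (recovery_u t b n x - t *: matvec xi0 x) = `|b * (g n x * psi n x)| * enorm v1.
    rewrite /recovery_u addrC addKr /enorm.
    rewrite (_ : dot2 _ _ = (b * (g n x * psi n x)) ^+ 2 * dot2 v1 v1).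
      by rewrite sqrtrM ?sqr_ge0// sqrtr_sqr.
    by rewrite /dot2 /= /GRing.scale/=; ring.
  apply/norm_cvg0P; apply: (@squeeze_cvgr _ _ _ _ (fun=> 0)
    (fun n => (`|b| * enorm v1 * vol Omega) * n.+1%:R^-1)).
  + apply: nearW => n; rewrite normr_ge0/= mulrAC.
    apply: Rintegral_bound => //.
      rewrite (_ : (fun x => _) = fun x => `|b * (g n x * psi n x)| * enorm v1); last first.
        by apply/funext => x; exact: enE.
      apply: continuous_L1 => // x; apply: cvgM; last exact: cvg_cst.
      by apply: cvg_norm; apply: cvgMr; apply: cvgM; [exact: cg|exact: cpsi].
    move=> x Ox; rewrite enE normrM normr_id (ger0_norm (sqrtr_ge0 _)) mulrAC ler_wpM2r ?sqrtr_ge0//.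
    rewrite normrM ler_wpM2l// normrM -[leRHS]mulr1 ler_pM//; exact: (g_small pf).
  + exact: cvg_cst.
  + by rewrite -[X in _ --> X](mulr0 (`|b| * enorm v1 * vol Omega)); apply: cvgMr; exact: inv0.
- exists (fun n i j => dens Omega (sym_partial (recovery_u t b n) i j)),
    (fun i j => dens Omega (sym_partial (fun x => t *: matvec xi0 x) i j)).
  split; [by move=> n; exact: sym_grad_C1|exact: sym_grad_C1|].
  move=> phi [cphi _] i j.
  have iS U : C1field U -> L1fun Omega (sym_partial U i j).
    by move=> cU; apply: continuous_L1 => //; exact: sym_partial_continuous.
  rewrite charge_integral_dens//; last exact: iS.
  have i1 : L1fun Omega phi by exact: continuous_L1.
  have i2 n : L1fun Omega (fun x => phi x * (psi n x * rp n x)).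
    by apply: continuous_L1 => //; continuity2.
  have i3 n : L1fun Omega (fun x => phi x * (psi n x * rm n x)).
    by apply: continuous_L1 => //; continuity2.
  have i4 n : L1fun Omega (fun x => phi x * psi n x).
    by apply: continuous_L1 => //; continuity2.
  have i5 n : L1fun Omega (fun x => phi x * (2^-1 * (coord2 v1 i * (g n x * partial j (psi n) x)
      + coord2 v1 j * (g n x * partial i (psi n) x)))).
    by apply: continuous_L1 => //; continuity2.
  have i23 n := L1funD mO (i2 n) (i3 n).
  have i234 n := L1funB mO (i23 n) (i4 n).
  have E n : charge_integral (dens Omega (sym_partial (recovery_u t b n) i j)) Omega phi =
      t * A i j * (\int[L2]_(x in Omega) phi x) +
      b * A i j * (\int[L2]_(x in Omega) (phi x * (psi n x * rp n x)) +
         \int[L2]_(x in Omega) (phi x * (psi n x * rm n x)) -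
         \int[L2]_(x in Omega) (phi x * psi n x)) +
      b * \int[L2]_(x in Omega) (phi x *
        (2^-1 * (coord2 v1 i * (g n x * partial j (psi n) x) + coord2 v1 j * (g n x * partial i (psi n) x)))).
    rewrite charge_integral_dens//; last exact: iS.
    rewrite -(RintegralZl _ mO i1) -(RintegralD mO (i2 n) (i3 n)) -(RintegralB mO (i23 n) (i4 n)).
    rewrite -(RintegralZl _ mO (i234 n)) -(RintegralZl _ mO (i5 n)).
    rewrite -(RintegralD mO (L1funZ _ mO i1) (L1funZ _ mO (i234 n))).
    rewrite -RintegralD//; last 2 first.
    - by apply: L1funD => //; apply: L1funZ => //; exact: i234.
    - by apply: L1funZ => //; exact: i5.
    by apply: eq_Rintegral => x _; rewrite recovery_strain; ring.
  have wE : \int[L2]_(x in Omega) (phi x * sym_partial (fun x => t *: matvec xi0 x) i j x) =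
      t * A i j * \int[L2]_(x in Omega) phi x.
    rewrite -(RintegralZl _ mO i1); apply: eq_Rintegral => x _.
    by rewrite u0E recovery_strain; ring.
  rewrite wE (funext E) -[X in _ --> X](_ : t * A i j * (\int[L2]_(x in Omega) phi x) +
      b * A i j * (2^-1 * (\int[L2]_(x in Omega) phi x) + 2^-1 * (\int[L2]_(x in Omega) phi x)
        - \int[L2]_(x in Omega) phi x) + b * \int[L2]_(x in Omega) (phi x * 0) =
      t * A i j * \int[L2]_(x in Omega) phi x); last first.
    have -> : \int[L2]_(x in Omega) (phi x * 0) = 0 by apply: Rintegral_eq0 => // x _; rewrite mulr0.
    by field.
  have cwphi : {within closure Omega, continuous phi} by exact: continuous_subspaceT.
  have [M M0 phiM] := continuous_bounded_domain bO cphi.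
  apply: cvgD; last apply: cvgMr.
    apply: cvgD; first exact: cvg_cst.
    apply: cvgMr; apply: cvgB; first by apply: cvgD; [exact: rp_weak pf _ _|exact: rm_weak pf _ _].
    apply: (@bounded_dct R Omega (fun n x => phi x * psi n x) phi M) => //.
    - by move=> n; apply: continuous_measurable_domain => //; continuity2.
    - by move=> n x Ox; rewrite normrM -[M]mulr1 ler_pM//; exact: phiM.
    - by move=> x Ox; rewrite -[X in _ --> X]mulr1; apply: cvgMr; exact: (psi_cvg pf).
  apply: (@bounded_dct R Omega (fun n x => phi x * (2^-1 * (coord2 v1 i * (g n x * partial j (psi n) x)
        + coord2 v1 j * (g n x * partial i (psi n) x)))) (fun x => phi x * 0)
      (M * (`|coord2 v1 i| + `|coord2 v1 j|))) => //.
  - by move=> n; apply: continuous_measurable_domain => //; continuity2.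
  - by move=> n x Ox; rewrite normrM ler_pM//; [exact: phiM|exact: odot_bound].
  - move=> x Ox; apply: cvgMr.
    rewrite -[X in _ --> X](_ : 2^-1 * (coord2 v1 i * 0 + coord2 v1 j * 0) = 0); last by ring.
    by apply: cvgMr; apply: cvgD; apply: cvgMr; exact: gpsi_cvg.
Qed.

Definition recovery_row m (th : R) (b z : 'I_m -> R) n (x : plane R) : 'rV[Xi R]_m :=
  \row_i (recovery_p (b i) n x, recovery_z th (z i) n x).

Lemma recovery_is_delta m th (b z : 'I_m -> R) n :
  is_delta Omega (fun i => recovery_pm (b i) n) (fun i => dens Omega (recovery_z th (z i) n))
    (delta Omega (recovery_row th b z n)).
Proof.
have ip i j k : L1fun Omega (fun x => recovery_p (b i) n x j k).
  by apply: continuous_L1 => //; exact: recovery_p_continuous.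
have iz i : L1fun Omega (recovery_z th (z i) n).
  by apply: continuous_L1 => //; exact: recovery_z_continuous.
have rowE x i : recovery_row th b z n x ord0 i = (recovery_p (b i) n x, recovery_z th (z i) n x).
  by rewrite [LHS]mxE.
(* The measures have integrable densities, so the singular part is the zero measure, for which every
   property holds almost everywhere, the normalization of its density included. *)
exists (recovery_row th b z n), (fun=> 0), mzero; split; last first.
  by move=> f cf; rewrite [X in _ + X]/Rintegral integral_measure_zero addr0.
split.
- move=> i; split=> [j k|].
    rewrite (_ : (fun x => _) = (fun x => recovery_p (b i) n x j k)); first exact: ip.
    by apply/funext => x; rewrite rowE.
  rewrite (_ : (fun x => _) = recovery_z th (z i) n); first exact: iz.
  by apply/funext => x; rewrite rowE.
- split => //; first by rewrite /mzero ltry.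
  by exists set0; split => //; rewrite measure0.
- by split=> [i j k|i]; exact: measurable_cst.
- by exists setT; split.
- move=> B mB BO i; split=> [j k|].
    rewrite /recovery_pm densE// integral_measure_zero adde0.
    by apply: eq_integral => x _; rewrite rowE.
  rewrite densE// integral_measure_zero adde0.
  by apply: eq_integral => x _; rewrite rowE.
Qed.

(** At each point at most one of [rp n] and [rm n] is nonzero, so the increment of f from the base
    row to the recovery row is the sum of the increments due to each family. [concentration] applies
    to both, with psi rp and psi rm in the role of [rho]. *)
Lemma recovery_gy_cvg m th (b z : 'I_m -> R) :
  gy_cvg Omega (fun n => delta Omega (recovery_row th b z n))
    (twin Omega (\row_i (0, th)) (\row_i (b i *: A, z i)) (\row_i (b i *: A, - z i))).
Proof.
set c := \row_i (0, th); set q := \row_i (_, z i); set q' := \row_i (_, - z i).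
have dc : MDrow c by move=> i; rewrite mxE; exact: MD_0.
have dq : MDrow q by move=> i; rewrite mxE; exact: MD_scale.
have dq' : MDrow q' by move=> i; rewrite mxE; exact: MD_scale.
move=> f cf.
have conc p (r : nat -> plane R -> R) : MDrow p -> (forall n, continuous (r n)) ->
    (forall n x, 0 <= r n x) ->
    (forall h : plane R -> R, {within closure Omega, continuous h} ->
      (fun n => \int[L2]_(x in Omega) (h x * (psi n x * r n x))) @ \oo -->
      2^-1 * \int[L2]_(x in Omega) h x) ->
    (fun n => vol (Omega `&` [set x | r n x != 0])) @ \oo --> (0 : R) ->
    (forall n, L1fun Omega (fun x => f (x, rowaff (psi n x * r n x) p c, 1) - f (x, c, 1))) /\
    (fun n => \int[L2]_(x in Omega) (f (x, rowaff (psi n x * r n x) p c, 1) - f (x, c, 1))) @ \oo -->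
      2^-1 * slab Omega p 0 f.
  move=> dp cr r0 rw rv.
  apply: (@concentration R Omega m f p c (fun n x => psi n x * r n x) oO bO cf dp dc).
  - by move=> n; apply: continuous_mul2; [exact: cpsi|exact: cr].
  - by move=> n x; rewrite mulr_ge0//; have /andP[] := psi_01 pf n x.
  - by move=> n; apply: continuous_L1 => //; apply: continuous_mul2; [exact: cpsi|exact: cr].
  - exact: rw.
  - have mS (h : plane R -> R) : continuous h -> measurable (Omega `&` [set x | h x != 0] : set (mplane R)).
      by move=> ch; apply: measurableI => //; apply: open_measurable2; exact: continuous_neq0_open.
    have fS (S : set (mplane R)) : measurable (Omega `&` S) -> L2 (Omega `&` S) \is a fin_num.
      by move=> mOS; rewrite ge0_fin_numE// (le_lt_trans _ O0)// le_measure ?inE.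
    have cr' n : continuous (fun x => psi n x * r n x).
      by apply: continuous_mul2; [exact: cpsi|exact: cr].
    apply: (@squeeze_cvgr _ _ _ _ (fun=> 0) (fun n => vol (Omega `&` [set x | r n x != 0]))) => //.
      apply: nearW => n; rewrite fine_ge0//=; apply: fine_le.
      + by apply: fS; exact: mS.
      + by apply: fS; exact: mS.
      + rewrite le_measure ?inE//; try exact: mS.
        by apply: setIS => x /=; apply: contra => /eqP ->; rewrite mulr0.
    exact: cvg_cst.
have [i1 c1] := conc q rp dq crp (rp_ge0 pf) (rp_weak pf) (rp_vol pf).
have [i2 c2] := conc q' rm dq' crm (rm_ge0 pf) (rm_weak pf) (rm_vol pf).
have i0 := Chom_L1 oO bO 1 cf dc.
have E n : delta Omega (recovery_row th b z n) f = slab Omega c 1 f +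
    \int[L2]_(x in Omega) (f (x, rowaff (psi n x * rp n x) q c, 1) - f (x, c, 1)) +
    \int[L2]_(x in Omega) (f (x, rowaff (psi n x * rm n x) q' c, 1) - f (x, c, 1)).
  rewrite /slab -(RintegralD mO i0 (i1 n)) -(RintegralD mO (L1funD mO i0 (i1 n)) (i2 n)).
  apply: eq_Rintegral => x _.
  have r0 p : rowaff 0 p c = c.
    by apply/rowP => i; rewrite !mxE scale0r mul0r !add0r.
  have /eqP := rp_rm pf n x; rewrite mulf_eq0 => /orP[/eqP p0|/eqP m0].
    rewrite p0 mulr0 r0 subrr addr0 addrCA subrr addr0; congr (f (x, _, _)).
    apply/rowP => i; rewrite !mxE /recovery_p /recovery_z p0 /= scalerA addr0 add0r sub0r.
    by congr (_, _); [congr (_ *: _)|]; ring.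
  rewrite m0 mulr0 r0 subrr addr0 addrCA subrr addr0; congr (f (x, _, _)).
  apply/rowP => i; rewrite !mxE /recovery_p /recovery_z m0 /= scalerA !addr0 subr0.
  by congr (_, _); [congr (_ *: _)|]; ring.
rewrite (funext E) /twin; apply: cvgD => //; apply: cvgD => //; exact: cvg_cst.
Qed.

End recovery.

(** * Constitutive functions *)

Section constitutive.
Variable R : realType.
Implicit Types (A B : 'M[R]_2) (mu kappa : R).

Lemma tr2 A : \tr A = A ord0 ord0 + A ord_max ord_max.
Proof. by rewrite /mxtrace !big_ord_recl big_ord0 addr0 (_ : lift ord0 ord0 = ord_max)//; exact: val_inj. Qed.

Lemma elasticity_entry mu kappa A i j : elasticity mu kappa A i j =
  2 * mu * (A i j - (i == j)%:R * (2^-1 * \tr A)) + (i == j)%:R * (kappa * \tr A).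
Proof. by rewrite !mxE; case: (i == j); rewrite /= ?mulr1n ?mulr0n; ring. Qed.

Definition ord2E := (eqxx (ord0 : 'I_2), eqxx (ord_max : 'I_2),
  erefl : ((ord0 : 'I_2) == ord_max) = false, erefl : ((ord_max : 'I_2) == ord0) = false).

Lemma quadratic_ge0 (a b p q r s : R) : 0 <= a -> 0 <= b ->
  0 <= a * (p ^+ 2 + 2 * q ^+ 2 + 2 * r ^+ 2) + b * s ^+ 2.
Proof.
move=> a0 b0; have [p2 q2] := (sqr_ge0 p, sqr_ge0 q); have [r2 s2] := (sqr_ge0 r, sqr_ge0 s).
apply: addr_ge0; apply: mulr_ge0 => //; apply: addr_ge0; last by rewrite mulr_ge0.
by apply: addr_ge0 => //; rewrite mulr_ge0.
Qed.

(** Expanding the elastic form at a A, the difference of the two sides is the form evaluated at B, a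
    sum of squares with the coefficients mu and kappa. The matrix B is arbitrary, hence two separate
    off-diagonal squares. *)
Lemma elastic_lower mu kappa a A B : 0 <= mu -> 0 <= kappa -> MD A ->
  2 * mu * a ^+ 2 * inner A A + 4 * mu * a * inner A B <=
  inner (elasticity mu kappa (a *: A + B)) (a *: A + B).
Proof.
move=> mu0 k0 /MD_entries[e1 e2]; rewrite !inner2 !elasticity_entry !tr2 !ord2E !mxE e1 e2.
rewrite -subr_ge0.
set x := A ord0 ord0; set y := A ord0 ord_max; set p := B _ _; set q := B _ _; set r := B _ _.
set s := B _ _.
rewrite [X in 0 <= X](_ : _ = mu * ((p - s) ^+ 2 + 2 * q ^+ 2 + 2 * r ^+ 2) + kappa * (p + s) ^+ 2).
  exact: quadratic_ge0.
by rewrite /=; field.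
Qed.

Lemma elastic_form mu kappa B : inner (elasticity mu kappa B) B =
  mu * ((B ord0 ord0 - B ord_max ord_max) ^+ 2 + 2 * B ord0 ord_max ^+ 2 + 2 * B ord_max ord0 ^+ 2) +
  kappa * (B ord0 ord0 + B ord_max ord_max) ^+ 2.
Proof. by rewrite !inner2 !elasticity_entry !tr2 !ord2E /=; field. Qed.

Lemma elastic_MD mu kappa a A : MD A ->
  inner (elasticity mu kappa (a *: A)) (a *: A) = 2 * mu * a ^+ 2 * inner A A.
Proof.
by move=> /MD_entries[e1 e2]; rewrite !inner2 !elasticity_entry !tr2 !ord2E !mxE e1 e2 /=; field.
Qed.

Lemma elastic_MD_inner mu kappa a A B : MD A ->
  inner (elasticity mu kappa (a *: A)) B = 2 * mu * a * inner A B.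
Proof.
by move=> /MD_entries[e1 e2]; rewrite !inner2 !elasticity_entry !tr2 !ord2E !mxE e1 e2 /=; field.
Qed.

Lemma dissip_form_ge0 (a b c : R) : 0 <= 2^-1 * a ^+ 2 + 2^-1 * b ^+ 2 + c ^+ 2.
Proof. by have := sqr_ge0 a; have := sqr_ge0 b; have := sqr_ge0 c; lra. Qed.

(* The norm of the projection of [v] on the space of trace-free symmetric matrices. *)
Definition dissip (v : Xi R) : R :=
  Num.sqrt (2^-1 * (v.1 ord0 ord0 - v.1 ord_max ord_max) ^+ 2 +
            2^-1 * (v.1 ord0 ord_max + v.1 ord_max ord0) ^+ 2 + v.2 ^+ 2).

(** Cauchy-Schwarz against the projection of [v], with the defect written as a sum of squares by
    Lagrange's identity. *)
Lemma Kball_le (s v : Xi R) : Kball s -> inner s.1 v.1 + s.2 * v.2 <= dissip v.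
Proof.
move=> [/MD_entries[e1 e2]]; rewrite !inner2 e1 e2 => h.
rewrite (le_trans (ler_norm _))// -sqrtr_sqr ler_wsqrtr//.
set x := s.1 ord0 ord0 in h *; set y := s.1 ord0 ord_max in h *; set z := s.2 in h *.
set p := v.1 _ _; set q := v.1 _ _; set r := v.1 _ _; set t := v.1 _ _; set c := v.2.
set N := (X in _ <= X); have N0 : 0 <= N by exact: dissip_form_ge0.
apply: le_trans (_ : (2 * x ^+ 2 + 2 * y ^+ 2 + z ^+ 2) * N <= N); last first.
  by rewrite ler_piMl//; move: h; lra.
rewrite -subr_ge0 [X in 0 <= X](_ : _ = 2^-1 * (2 * x * c - z * (p - t)) ^+ 2 +
    2^-1 * (2 * y * c - z * (q + r)) ^+ 2 + (x * (q + r) - y * (p - t)) ^+ 2).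
  exact: dissip_form_ge0.
by rewrite /N; field.
Qed.

Lemma dissip_attained (v : Xi R) : exists2 s, Kball s & inner s.1 v.1 + s.2 * v.2 = dissip v.
Proof.
pose p := v.1 ord0 ord0 - v.1 ord_max ord_max; pose q := v.1 ord0 ord_max + v.1 ord_max ord0.
set D := dissip v.
have D2 : D ^+ 2 = 2^-1 * p ^+ 2 + 2^-1 * q ^+ 2 + v.2 ^+ 2.
  by rewrite sqr_sqrtr//; exact: dissip_form_ge0.
(* The maximizer is the projection of [v] divided by its norm D. For D = 0 the inverse is 0 and the
   witness becomes the zero element, which also attains the value. *)
pose S : 'M[R]_2 := \matrix_(i, j) (D^-1 * (2^-1 * (if i == j then (-1) ^+ i * p else q))).
have S00 : S ord0 ord0 = D^-1 * (2^-1 * p) by rewrite mxE /= expr0 mul1r.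
have S11 : S ord_max ord_max = D^-1 * (2^-1 * - p) by rewrite mxE /= expr1 mulN1r.
have S01 : S ord0 ord_max = D^-1 * (2^-1 * q) by rewrite mxE.
have S10 : S ord_max ord0 = D^-1 * (2^-1 * q) by rewrite mxE.
exists (S, D^-1 * v.2); last first.
  rewrite inner2 /= S00 S01 S10 S11.
  have [D0|D0] := eqVneq D 0; first by rewrite D0 invr0; ring.
  apply: (mulfI D0); rewrite -[RHS]expr2 D2 /p /q; field.
  exact: D0.
split.
  split; last by rewrite tr2 S00 S11; ring.
  by apply/matrixP; apply: ord2P; apply: ord2P; rewrite [LHS]mxE // S01 S10.
rewrite inner2 /= S00 S01 S10 S11.
have [D0|D0] := eqVneq D 0.
  by rewrite D0 invr0 !mul0r expr0n /= !addr0 ler01.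
rewrite le_eqVlt; apply/orP; left; apply/eqP.
have D20 : D ^+ 2 != 0 by rewrite expf_neq0.
apply: (mulfI D20); rewrite mulr1 [RHS]D2; field.
exact: D0.
Qed.

Lemma HdissE v : Hdiss (@Kball R) v = dissip v.
Proof.
have [s0 Ks0 s0E] := dissip_attained v.
apply/eqP; rewrite eq_le; apply/andP; split.
  by apply: ge_sup; [exists (inner s0.1 v.1 + s0.2 * v.2), s0|move=> _ [s Ks <-]; exact: Kball_le].
rewrite -s0E; apply: ub_le_sup; last by exists s0.
by exists (dissip v) => _ [s Ks <-]; exact: Kball_le.
Qed.

(** The supremum defining the dissipation is tested with (a A, c), where c is 1/2 with the sign of
    [v.2]; the bound 3/4 is what the unit ball leaves to the stress when c^2 = 1/4. *)
Lemma dissip_lower A a (v : Xi R) : MD A -> a ^+ 2 * inner A A <= 3 / 4 ->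
  a * inner A v.1 + 2^-1 * `|v.2| <= dissip v.
Proof.
move=> dA aA.
have [c [c2 cE]] : exists c : R, c ^+ 2 = 4^-1 /\ 2^-1 * `|v.2| = c * v.2.
  have [v0|v0] := leP 0 v.2.
    by exists 2^-1; rewrite ger0_norm//; split => //; field.
  by exists (- 2^-1); rewrite ltr0_norm//; split; field.
have Ks : Kball (a *: A, c).
  split; first exact: MD_scale.
  by rewrite /= innerZ -expr2 c2; lra.
have := Kball_le v Ks; rewrite /= cE; apply: le_trans.
by rewrite !inner2 !mxE le_eqVlt; apply/orP; left; apply/eqP; ring.
Qed.

Lemma dissip_scale (r : R) (v : Xi R) : dissip (r *: v.1, r * v.2) = `|r| * dissip v.
Proof.
rewrite /dissip /= !mxE -sqrtr_sqr -sqrtrM ?sqr_ge0//; congr Num.sqrt; ring.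
Qed.

Lemma dissip_bound (v : Xi R) : dissip v <=
  `|v.1 ord0 ord0| + `|v.1 ord_max ord_max| + `|v.1 ord0 ord_max| + `|v.1 ord_max ord0| + `|v.2|.
Proof.
have [s [/MD_entries[e1 e2] sn] <-] := dissip_attained v.
have n1 (x : R) : x ^+ 2 <= 1 -> `|x| <= 1.
  by move=> x1; rewrite -(@ler_pXn2r _ 2) ?nnegrE// real_normK ?num_real// expr1n.
move: sn; rewrite !inner2 e1 e2.
set x := s.1 ord0 ord0; set y := s.1 ord0 ord_max; set z := s.2 => sn.
have x2 := sqr_ge0 x; have y2 := sqr_ge0 y; have z2 := sqr_ge0 z.
have x1 : `|x| <= 1 by apply: n1; rewrite expr2 in x2 y2 z2 *; lra.
have y1 : `|y| <= 1 by apply: n1; rewrite expr2 in x2 y2 z2 *; lra.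
have z1 : `|z| <= 1 by apply: n1; rewrite expr2 in x2 y2 z2 sn *; lra.
have m (a b : R) : `|a| <= 1 -> a * b <= `|b|.
  by move=> a1; rewrite (le_trans (ler_norm _))// normrM ler_piMl.
have := m _ (v.1 ord0 ord0) x1; have := m (- x) (v.1 ord_max ord_max); rewrite normrN => /(_ x1).
have := m _ (v.1 ord0 ord_max) y1; have := m _ (v.1 ord_max ord0) y1; have := m _ v.2 z1.
lra.
Qed.

(** A uniform distance from - |x| / 2; after division by t it squeezes the recession function in
    [VinftyE]. *)
Lemma Vsoft_bounds (x : R) : 0 <= Vsoft x + 2^-1 * `|x| <= 2^-1.
Proof.
have s2 : Num.sqrt (1 + x ^+ 2) ^+ 2 = 1 + x ^+ 2 by rewrite sqr_sqrtr// addr_ge0// sqr_ge0.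
have s0 : 0 <= Num.sqrt (1 + x ^+ 2) by exact: sqrtr_ge0.
have x2 : `|x| ^+ 2 = x ^+ 2 by rewrite real_normK// num_real.
have x0 := normr_ge0 x.
rewrite /Vsoft; apply/andP; split.
  have : Num.sqrt (1 + x ^+ 2) <= 1 + `|x|.
    by rewrite -(@ler_pXn2r _ 2) ?nnegrE ?addr_ge0// s2 -x2; nra.
  by lra.
have : `|x| <= Num.sqrt (1 + x ^+ 2).
  by rewrite -(@ler_pXn2r _ 2) ?nnegrE// s2 x2; lra.
by lra.
Qed.

Lemma VinftyE (x : R) : Vinfty (@Vsoft R) x = - (2^-1 * `|x|).
Proof.
apply/cvg_lim; first exact: norm_hausdorff.
apply: (@squeeze_cvgr _ _ _ _ (fun t : R => - (2^-1 * `|x|)) (fun t : R => - (2^-1 * `|x|) + 2^-1 * t^-1)).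
- near=> t.
  have t0 : 0 < t by near: t; exact: nbhs_pinfty_gt.
  have := Vsoft_bounds (t * x); rewrite normrM (gtr0_norm t0) => /andP[h1 h2].
  by rewrite ler_pdivlMr// ler_pdivrMr// mulrDl divfK ?gt_eqF//; apply/andP; split; lra.
- exact: cvg_cst.
- rewrite -[X in _ --> X](_ : - (2^-1 * `|x|) + 2^-1 * 0 = - (2^-1 * `|x|)); last by rewrite mulr0 addr0.
  apply: cvgD; first exact: cvg_cst.
  apply: cvgMr; apply/gtr0_cvgV0; last exact: cvg_id.
  exact: nbhs_pinfty_gt.
Unshelve. all: by end_near. Qed.

(** Truncating [eta] at 0 merges the two branches of [Vpersp] into one formula, from which
    continuity and homogeneity can be read off; for eta <= 0 it is the recession function - |th| /
    2. *)
Definition Vhom (th eta : R) : R :=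
  2^-1 * Num.max eta 0 - 2^-1 * Num.sqrt (Num.max eta 0 ^+ 2 + th ^+ 2).

Lemma VperspE th eta : Vpersp (@Vsoft R) th eta = Vhom th eta.
Proof.
rewrite /Vpersp /Vhom; have [e0|e0] := ltP 0 eta.
  rewrite /Vsoft.
  have -> : Num.sqrt (eta ^+ 2 + th ^+ 2) = eta * Num.sqrt (1 + (th / eta) ^+ 2).
    rewrite -{2}(gtr0_norm e0) -sqrtr_sqr -sqrtrM ?sqr_ge0//; congr Num.sqrt.
    by field; rewrite gt_eqF.
  by ring.
by rewrite VinftyE expr0n /= add0r sqrtr_sqr mulr0 sub0r.
Qed.

Lemma Vhom_lip th th' eta : Vhom th eta - 2^-1 * `|th' - th| <= Vhom th' eta.
Proof.
rewrite /Vhom; set e := Num.max _ _.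
suff : Num.sqrt (e ^+ 2 + th' ^+ 2) <= Num.sqrt (e ^+ 2 + th ^+ 2) + `|th' - th| by lra.
have s2 : Num.sqrt (e ^+ 2 + th ^+ 2) ^+ 2 = e ^+ 2 + th ^+ 2 by rewrite sqr_sqrtr// addr_ge0// sqr_ge0.
have s0 := sqrtr_ge0 (e ^+ 2 + th ^+ 2); have d0 := normr_ge0 (th' - th).
rewrite -(@ler_pXn2r _ 2) ?nnegrE ?addr_ge0 ?sqrtr_ge0// sqr_sqrtr ?addr_ge0 ?sqr_ge0//.
rewrite sqrrD s2 real_normK ?num_real//.
have th1 : th * (th' - th) <= Num.sqrt (e ^+ 2 + th ^+ 2) * `|th' - th|.
  rewrite (le_trans (ler_norm _))// normrM ler_wpM2r// -sqrtr_sqr ler_wsqrtr// lerDr.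
  exact: sqr_ge0.
by rewrite -mulr_natr; nra.
Qed.

Lemma Vhom_le0 th eta : Vhom th eta <= 0.
Proof.
rewrite /Vhom -mulrBr mulr_ge0_le0// subr_le0.
by rewrite (le_trans (ler_norm _))// -sqrtr_sqr ler_wsqrtr// lerDl sqr_ge0.
Qed.

Lemma Vhom_scale r th eta : 0 <= r -> Vhom (r * th) (r * eta) = r * Vhom th eta.
Proof.
move=> r0; rewrite /Vhom -[in LHS](mulr0 r) -maxr_pMr// !exprMn -mulrDr sqrtrM ?sqr_ge0//.
by rewrite sqrtr_sqr (ger0_norm r0); ring.
Qed.

End constitutive.

(** * Representing measures *)

Section finite_density.
Local Open Scope ereal_scope.
Context d (T : measurableType d) (R : realType).
Variable m : {measure set T -> \bar R}.
Hypothesis mfin : m setT < +oo.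
Variable g : T -> \bar R.
Hypotheses (ig : m.-integrable setT g) (g0 : forall x, 0 <= g x).

(** The proof of finiteness is an argument, so that the finite measure structure can be attached to
    an arbitrary measure; [density_measure] carries integrability and positivity in the same way. *)
Definition finite_copy of m setT < +oo : set T -> \bar R := m.

HB.instance Definition _ := Measure.on (finite_copy mfin).

Let finite_copy_fin : fin_num_fun (finite_copy mfin).
Proof.
move=> A mA; rewrite ge0_fin_numE// (le_lt_trans _ mfin)// le_measure ?inE//.
Qed.

HB.instance Definition _ := Measure_isFinite.Build d T R (finite_copy mfin) finite_copy_fin.

Definition density_measure of m.-integrable setT g & (forall x, 0 <= g x) : set T -> \bar R :=
  fun A => \int[m]_(x in A) g x.

Let density_measure0 : density_measure ig g0 set0 = 0.
Proof. exact: integral_set0. Qed.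

Let density_measure_ge0 A : 0 <= density_measure ig g0 A.
Proof. by apply: integral_ge0 => x _; exact: g0. Qed.

Let density_measure_sigma : semi_sigma_additive (density_measure ig g0).
Proof. by apply: semi_sigma_additive_nng_induced => //; exact: measurable_int ig. Qed.

HB.instance Definition _ := isMeasure.Build d T R (density_measure ig g0)
  density_measure0 density_measure_ge0 density_measure_sigma.

Let density_measure_fin : fin_num_fun (density_measure ig g0).
Proof. by move=> A mA; apply: integrable_fin_num => //; apply: integrableS ig. Qed.

HB.instance Definition _ := Measure_isFinite.Build d T R (density_measure ig g0)
  density_measure_fin.

Lemma integral_density_measure f E : measurable E -> (density_measure ig g0).-integrable E f ->
  \int[density_measure ig g0]_(x in E) f x = \int[m]_(x in E) (f x * g x).
Proof.
move=> mE i_f.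
exact: (@integral_density _ _ _ (density_measure ig g0) (finite_copy mfin) g f E).
Qed.

Context d' (Y : measurableType d') (phi : T -> Y).
Hypothesis mphi : measurable_fun setT phi.

(** The image under [phi] of the measure with density [g] is [mu] restricted to D, so integrals of
    [h] over D can be computed on the source. Integrability is transported along with the value,
    which allows an unbounded [h]. *)
Lemma integral_image_density (mu : {measure set Y -> \bar R}) (D : set Y) (h : Y -> R) :
  measurable D -> (forall B, measurable B -> \int[m]_(x in phi @^-1` B) g x = mu (B `&` D)) ->
  mu.-integrable D (EFin \o h) -> (forall y, ~ D y -> h y = 0%R) ->
  m.-integrable setT (fun x => (h (phi x))%:E * g x) /\
  \int[m]_x ((h (phi x))%:E * g x) = \int[mu]_(y in D) (h y)%:E.
Proof.
move=> mD mE ih h0.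
have mh : measurable_fun setT h.
  have : measurable_fun D h by apply/measurable_EFinP; exact: measurable_int ih.
  move=> /(measurable_restrictT _ mD).1; congr (measurable_fun _ _).
  by apply/funext => y; rewrite patchE; case: ifPn => // /negP; rewrite inE => /h0.
have pfE (f : Y -> \bar R) : (forall y, ~ D y -> f y = 0) ->
    \int[pushforward (density_measure ig g0) phi]_y f y = \int[mu]_(y in D) f y.
  move=> f0.
  have -> : \int[pushforward (density_measure ig g0) phi]_y f y =
      \int[pushforward (density_measure ig g0) phi]_(y in D) f y.
    rewrite [RHS]integral_mkcond; apply: eq_integral => y _.
    by rewrite patchE; case: ifPn => // /negP; rewrite inE => /f0.
  apply: (@eq_measure_integral _ _ _ D mu (pushforward (density_measure ig g0) phi)).
  by move=> B mB BD; rewrite -[in RHS](setIidl BD) -mE.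
have mhp : measurable_fun setT (h \o phi) by exact: measurableT_comp.
have i1 : (density_measure ig g0).-integrable setT (EFin \o (h \o phi)).
  apply/integrableP; split; first exact/measurable_EFinP.
  have := @ge0_integral_pushforward _ _ _ _ _ phi mphi (density_measure ig g0) setT
    (fun y => `|(h y)%:E|).
  rewrite preimage_setT => <-//; last first.
    by apply: measurableT_comp => //; exact/measurable_EFinP.
  rewrite pfE => [|y /h0 ->]; last by rewrite abse0.
  by have /integrableP[] := ih.
have E := integral_density_measure measurableT i1.
split; last first.
  have <- : \int[density_measure ig g0]_x (EFin \o (h \o phi)) x = \int[mu]_(y in D) (h y)%:E.
    rewrite -pfE => [|y /h0 -> //].
    have := @integral_pushforward _ _ _ _ _ phi mphi (density_measure ig g0) setT (EFin \o h).
    rewrite preimage_setT => -> //.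
    exact/measurable_EFinP.
  by rewrite E.
have i2 : (density_measure ig g0).-integrable setT (fun x => (`|h (phi x)|%R)%:E).
  by apply/integrable_abse: i1.
have E2 := integral_density_measure measurableT i2.
apply/integrableP; split.
  apply: emeasurable_funM; first exact/measurable_EFinP.
  exact: measurable_int ig.
have -> : \int[m]_x `|(h (phi x))%:E * g x| = \int[m]_x ((`|h (phi x)|%R)%:E * g x).
  by apply: eq_integral => x _; rewrite abseM (gee0_abs (g0 x)).
by rewrite -E2; have /integrableP[] := i1.
Qed.

End finite_density.

Section borel_sets.
Variable R : realType.
Local Notation L2 := (lebesgue2 R).

Lemma cvg_sumr T (F : set_system T) (FF : Filter F) (I : Type) (r : seq I)
    (f : I -> T -> R) (l : I -> R) :
  (forall i, f i @ F --> l i) -> (fun t => \sum_(i <- r) f i t) @ F --> \sum_(i <- r) l i.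
Proof.
move=> fl; elim: r => [|i r ih].
  by rewrite big_nil (funext (fun t => big_nil _ _ _ _)); exact: cvg_cst.
by rewrite big_cons (funext (fun t => big_cons _ _ _ _ _ _)); exact: cvgD (fl i) ih.
Qed.

Lemma cvg_sqr T (F : set_system T) (FF : Filter F) (f : T -> R) (l : R) :
  f @ F --> l -> (fun t => f t ^+ 2) @ F --> l ^+ 2.
Proof. by move=> fl; exact: (cvgM fl fl). Qed.

Lemma borel_measurable d (T : measurableType d) (U : topologicalType) (i : T -> U) (f : U -> R) :
  (forall O, open O -> measurable (i @^-1` O)) -> continuous f ->
  measurable_fun setT (fun x => f (i x)).
Proof.
move=> mi cf; apply: (measurability _ (RGenOpens.measurableE R)).
move=> _ [_ [a [b ->] <-]]; rewrite setTI; apply: (mi (f @^-1` `]a, b[%classic)).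
by apply: open_comp => [x _|]; [exact: cf|exact: interval_open].
Qed.

(** Representing measures live on Borel sets, [lebesgue2] on a product sigma-algebra; the uniqueness
    argument of [marginal] needs the latter to be generated by the open sets. *)
Lemma mplane_open : (@measurable _ (mplane R)) = <<s @open (plane R) >>.
Proof.
apply/seteqP; split=> [B mB|].
  have mid : measurable_fun [set: g_sigma_algebraType (@open (plane R))]
      (fun x : g_sigma_algebraType (@open (plane R)) => ((x.1, x.2) : mplane R)).
    have c1 : continuous (fun x : plane R => x.1) by move=> x; exact: cvg_fst.
    have c2 : continuous (fun x : plane R => x.2) by move=> x; exact: cvg_snd.
    have id_open O : open O -> measurable (id @^-1` O : set (g_sigma_algebraType (@open (plane R)))).
      exact: sub_sigma_algebra.
    exact: measurable_fun_pair (borel_measurable id_open c1) (borel_measurable id_open c2).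
  have := mid measurableT B mB; rewrite setTI.
  by rewrite (_ : _ @^-1` B = B)//; apply/seteqP; split => -[].
apply: smallest_sub; first exact: sigma_algebra_measurable.
exact: open_measurable2.
Qed.

End borel_sets.

(** * The pairing with a shift that is only integrable *)

Section pairing.
Variable R : realType.
Variable Omega : set (plane R).
Hypotheses (oO : open Omega) (bO : bounded_set Omega).
Local Notation L2 := (lebesgue2 R).
Variable m : nat.
Local Notation S := (@gysphere R Omega m).
Local Notation gyborel := (g_sigma_algebraType (@open (gypoint R m))).
Variable lambda : {measure set gyborel -> \bar R}.
Variable F : functional R m.
Hypothesis repF : represents Omega lambda F.

Let mO : measurable (Omega : set (mplane R)). Proof. exact: open_measurable2. Qed.
Let O0 : (L2 Omega < +oo)%E. Proof. exact: bounded_lebesgue2_fin. Qed.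

Let fst1_continuous : continuous (fun y : gypoint R m => y.1.1).
Proof. by move=> y; apply: continuous_comp; [exact: cvg_fst|exact: cvg_fst]. Qed.

Let snd_continuous : continuous (fun y : gypoint R m => y.2).
Proof. by move=> y; exact: cvg_snd. Qed.

Lemma gy_entry_continuous i (a b : 'I_2) : continuous (fun y : gypoint R m => (y.1.2 ord0 i).1 a b).
Proof.
move=> y.
apply: (@continuous_comp _ _ _ (fun y : gypoint R m => (y.1.2 ord0 i).1) (fun M : 'M[R]_2 => M a b)); last exact: mx_entry_continuous.
apply: (@continuous_comp _ _ _ (fun y : gypoint R m => y.1.2 ord0 i) fst); last exact: cvg_fst.
apply: (@continuous_comp _ _ _ (fun y : gypoint R m => y.1.2) (fun q => q ord0 i)); last exact: mx_entry_continuous.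
by apply: (@continuous_comp _ _ _ fst snd); [exact: cvg_fst|exact: cvg_snd].
Qed.

Lemma gy_theta_continuous i : continuous (fun y : gypoint R m => (y.1.2 ord0 i).2).
Proof.
move=> y.
apply: (@continuous_comp _ _ _ (fun y : gypoint R m => y.1.2 ord0 i) snd); last exact: cvg_snd.
apply: (@continuous_comp _ _ _ (fun y : gypoint R m => y.1.2) (fun q => q ord0 i)); last exact: mx_entry_continuous.
by apply: (@continuous_comp _ _ _ fst snd); [exact: cvg_fst|exact: cvg_snd].
Qed.

Let id_open O : open O -> measurable (id @^-1` O : set gyborel).
Proof. exact: sub_sigma_algebra. Qed.

Let mfst1 : measurable_fun [set: gyborel] (fun y : gyborel => (y.1.1 : mplane R)).
Proof.
have -> : (fun y : gyborel => (y.1.1 : mplane R)) = fun y => (y.1.1.1, y.1.1.2).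
  by apply/funext => y; rewrite -surjective_pairing.
have c1 : continuous (fun y : gypoint R m => y.1.1.1).
  by move=> y; apply: (@continuous_comp _ _ _ (fun y : gypoint R m => y.1.1) fst); [exact: fst1_continuous|exact: cvg_fst].
have c2 : continuous (fun y : gypoint R m => y.1.1.2).
  by move=> y; apply: (@continuous_comp _ _ _ (fun y : gypoint R m => y.1.1) snd); [exact: fst1_continuous|exact: cvg_snd].
exact: measurable_fun_pair (borel_measurable id_open c1) (borel_measurable id_open c2).
Qed.

Lemma gypoint_fst_measurable : measurable_fun [set: gyborel] (fun y : gyborel => (y.1.1 : mplane R)).
Proof. exact: mfst1. Qed.

Lemma gysphere_measurable : measurable (S : set gyborel).
Proof.
have m0 (f : gypoint R m -> R) (c : R) : continuous f -> measurable ([set y | f y = c] : set gyborel).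
  move=> cf; have := @borel_measurable R _ gyborel _ id f id_open cf measurableT _ (measurable_set1 c).
  by rewrite setTI.
pose d i (y : gypoint R m) := ((y.1.2 ord0 i).1 ord0 ord_max - (y.1.2 ord0 i).1 ord_max ord0) ^+ 2 +
  ((y.1.2 ord0 i).1 ord0 ord0 + (y.1.2 ord0 i).1 ord_max ord_max) ^+ 2.
have -> : S = (fun y : gyborel => (y.1.1 : mplane R)) @^-1` closure Omega `&`
    [set y : gyborel | \sum_i d i y = 0] `&` [set y : gyborel | Xinorm2 y.1.2 + y.2 ^+ 2 = 1].
  apply/seteqP; split=> [y [[Oy dy] y1]|y [[Oy dy] y1]].
    split => //; split => //; rewrite /= big1// => i _.
    have [e1 e2] := MD_entries (dy i); rewrite /d e1 e2 !subrr expr0n /= addr0.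
    by [].
  split => //; split => // i; have := dy => /eqP; rewrite psumr_eq0; last first.
    by move=> j _; rewrite /d addr_ge0// sqr_ge0.
  move=> /allP/(_ i (mem_index_enum i))/=; rewrite /d paddr_eq0 ?sqr_ge0// !sqrf_eq0.
  move=> /andP[/eqP h1 /eqP h2]; split; last by rewrite tr2.
  by apply/matrixP; apply: ord2P; apply: ord2P; rewrite mxE //; lra.
have cXi : continuous (fun y : gypoint R m => Xinorm2 y.1.2).
  move=> y; apply: (@cvg_sumr _ _ (nbhs y) _ _ _ (fun i (y : gypoint R m) =>
    inner (y.1.2 ord0 i).1 (y.1.2 ord0 i).1 + (y.1.2 ord0 i).2 ^+ 2)) => i.
  apply: cvgD; last by apply: cvg_sqr; exact: gy_theta_continuous.
  by apply: cvg_inner => a b; exact: gy_entry_continuous.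
apply: measurableI; first apply: measurableI.
- rewrite -[X in measurable X]setTI; apply: mfst1 => //.
  by apply: closed_measurable2; exact: closed_closure.
- apply: m0 => y; apply: (@cvg_sumr _ _ (nbhs y) _ _ _ d) => i; apply: cvgD; apply: cvg_sqr.
    by apply: cvgB; exact: gy_entry_continuous.
  by apply: cvgD; exact: gy_entry_continuous.
- by apply: m0 => y; apply: cvgD; [exact: cXi|apply: cvg_sqr; exact: snd_continuous].
Qed.

(** The absolute value makes the density nonnegative on the whole sphere, so that it defines a
    measure; [marginal] computes its projection to the plane. *)
Definition gyeta (y : gyborel) : \bar R := (`|y.2| * \1_S y)%:E.

Lemma gyeta_ge0 y : (0 <= gyeta y)%E.
Proof. by rewrite lee_fin mulr_ge0. Qed.

Lemma gyeta_integrable : lambda.-integrable setT gyeta.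
Proof.
have [lfin _ _] := repF.
have mg : measurable_fun [set: gyborel] (fun y : gyborel => `|y.2| * \1_S y).
  apply: measurable_funM.
    apply: measurableT_comp => //.
    exact: (@borel_measurable R _ gyborel _ id (fun y : gypoint R m => y.2) id_open).
  by apply: measurable_indic; exact: gysphere_measurable.
have i1 := @finite_measure_integrable_cst _ _ _ (finite_copy lfin) setT 1 measurableT.
apply: le_integrable i1 => //; first exact/measurable_EFinP.
move=> y _; rewrite /gyeta /= normr1 lee_fin normrM normr_id.
rewrite indicE; case: (boolP (y \in _)) => [|_]; last by rewrite normr0 mulr0 ler01.
rewrite inE normr1 mulr1 => -[_ y1].
rewrite -(@ler_pXn2r _ 2) ?nnegrE// real_normK ?num_real// expr1n.
by rewrite -y1 lerDr Xinorm2_ge0.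
Qed.

Hypothesis Fphi : forall phi : plane R -> R, continuous phi ->
  F (fun y => phi y.1.1 * `|y.2|) = \int[L2]_(x in Omega) phi x.

Lemma Chom_abs_eta (phi : plane R -> R) : continuous phi ->
  Chom Omega (fun y : gypoint R m => phi y.1.1 * `|y.2|).
Proof.
move=> cphi; split; last first.
  by move=> s y s0 _; rewrite /gyscale /= normrM (ger0_norm s0) mulrCA.
apply: continuous_subspaceT => y; apply: cvgM.
  by apply: (@continuous_comp _ _ _ (fun y : gypoint R m => y.1.1) phi); [exact: fst1_continuous|exact: cphi].
by apply: cvg_norm; exact: snd_continuous.
Qed.

Local Notation proj := (fun y : gyborel => (y.1.1 : mplane R)).
Local Notation geta y := (`|y.2| * \1_S y).

Let igeta : lambda.-integrable setT (EFin \o (fun y : gyborel => geta y)).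
Proof. exact: gyeta_integrable. Qed.

Lemma Rintegral_sphere (f : gyborel -> R) :
  \int[lambda]_(y in S) f y = \int[lambda]_y (f y * \1_S y).
Proof.
rewrite Rintegral_mkcond; apply: eq_Rintegral => y _.
by rewrite patchE indicE; case: (y \in S); rewrite ?mulr1 ?mulr0.
Qed.

(** Smooth cutoffs of [U] tend to its indicator. For each of them the known action of [F] on phi(x)
    |eta| equates an integral against [lambda] with a Lebesgue integral, and dominated convergence
    applies on both sides. *)
Lemma marginal_open (U : set (plane R)) : open U ->
  (\int[lambda]_(y in proj @^-1` U) gyeta y = L2 (U `&` Omega))%E.
Proof.
move=> oU; have mU := open_measurable2 oU.
have [psi [tpsi psi01 psi1]] := smooth_cutoff oU.
have cpsi n : continuous (psi n) by have [/(_ [::])/C1_continuous] := tpsi n.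
have psi0 n x : ~ U x -> psi n x = 0.
  by move=> Ux; have [_ [K [_ KU] K0]] := tpsi n; apply: K0 => /KU.
have psile n x : `|psi n x| <= 1 by have /andP[p0 p1] := psi01 n x; rewrite ger0_norm.
have psi_cvg1 x : psi ^~ x @ \oo --> (\1_U x : R).
  have [Ux|Ux] := pselect (U x); first by rewrite indicE mem_set//; exact: psi1.
  rewrite indicE memNset// (_ : psi ^~ x = fun=> 0); first exact: cvg_cst.
  by apply/funext => n; exact: psi0.
have mpi (f : plane R -> R) : continuous f -> measurable_fun [set: gyborel] (fun y => f (proj y)).
  move=> cf; apply: (@borel_measurable R _ gyborel _ id (fun y : gypoint R m => f y.1.1)) => //.
  by move=> y; apply: (@continuous_comp _ _ _ (fun y : gypoint R m => y.1.1) f); [exact: fst1_continuous|exact: cf].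
have mgeta : measurable_fun [set: gyborel] (fun y : gyborel => geta y).
  by apply/measurable_EFinP; exact: measurable_int gyeta_integrable.
have [] := @Rintegral_dct R _ gyborel lambda setT (fun n y => psi n (proj y) * geta y)
  (fun y => \1_U (proj y) * geta y) (fun y => geta y) measurableT.
- by move=> n; apply: measurable_funM => //; exact: mpi.
- by move=> y _; apply: cvgMl; exact: psi_cvg1.
- exact: igeta.
- by move=> n y _; rewrite normrM (ger0_norm (_ : 0 <= geta y)) ?mulr_ge0// ler_piMl ?mulr_ge0.
move=> iU cvU.
have : (fun n => \int[lambda]_y (psi n (proj y) * geta y)) @ \oo --> vol (Omega `&` U).
  have -> : (fun n => \int[lambda]_y (psi n (proj y) * geta y)) =
      fun n => \int[L2]_(x in Omega) psi n x.
    apply/funext => n; have [_ _ rF] := repF.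
    rewrite -Fphi// rF; last exact: Chom_abs_eta.
    by rewrite Rintegral_sphere; apply: eq_Rintegral => y _; rewrite mulrA.
  rewrite -Rintegral_indic//.
  apply: (@bounded_dct R Omega psi (\1_U) 1) => //.
  by move=> n; exact: continuous_measurable_domain.
move=> /(cvg_unique (@norm_hausdorff _ R) cvU) E.
have fU : L2 (U `&` Omega) \is a fin_num.
  rewrite ge0_fin_numE// (le_lt_trans _ O0)// le_measure ?inE//; exact: measurableI.
have mpU : measurable (proj @^-1` U) by rewrite -[X in measurable X]setTI; exact: mfst1.
have E2 : (\int[lambda]_(y in proj @^-1` U) gyeta y = \int[lambda]_y (\1_U (proj y) * geta y)%:E)%E.
  rewrite integral_mkcond; apply: eq_integral => y _; rewrite patchE indicE.
  have -> : (y \in proj @^-1` U) = (proj y \in U) by apply/idP/idP; rewrite !inE.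
  by case: ifP => _; rewrite ?mul1r ?mul0r.
have fE := integrable_fin_num measurableT iU.
by rewrite E2 -(fineK fE) -(fineK fU) setIC; congr EFin.
Qed.

(** The open sets generate the sigma-algebra and are stable under intersection, so two finite
    measures that agree on them are equal. *)
Lemma marginal (B : set (mplane R)) : measurable B ->
  (\int[lambda]_(y in proj @^-1` B) gyeta y = L2 (B `&` Omega))%E.
Proof.
move=> mB.
have H := @measure_unique _ R (mplane R) (@open (plane R)) (fun=> setT) (mplane_open R) _ _ _
  (pushforward (density_measure gyeta_integrable gyeta_ge0) proj) (mrestr L2 mO) _ _ B mB.
apply: H.
- exact: openI.
- by move=> _; exact: openT.
- by rewrite bigcup_const.
- by move=> U oU; exact: marginal_open.
- by move=> _; rewrite -ge0_fin_numE; [exact: integrable_fin_num gyeta_integrable|exact: measure_ge0].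
Qed.

(** The shifted integrand [fz] is merely measurable, so the value of [F] says nothing about it
    directly. It differs from the continuous [f0] by at most h |eta| / 2, whose integral against
    [lambda] is, by [marginal], half the Lebesgue integral of [h]. *)
Lemma pairing_lower (f0 fz : gypoint R m -> R) (h : plane R -> R) (C : R) :
  Chom Omega f0 -> continuous f0 -> (forall y, S y -> `|f0 y| <= C) ->
  L1fun Omega h -> (forall x, ~ Omega x -> h x = 0) ->
  measurable_fun [set: gyborel] (fz : gyborel -> R) ->
  (forall y, `|fz y - f0 y| <= 2^-1 * (h y.1.1 * `|y.2|)) ->
  F f0 - 2^-1 * \int[L2]_(x in Omega) h x <= \int[lambda]_(y in S) fz y.
Proof.
move=> cf0 c0 f0C ih h0 mz zh.
have [lfin _ rF] := repF; rewrite rF//.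
have [i1 E1] := integral_image_density lfin gyeta_integrable gyeta_ge0 mfst1 mO marginal ih h0.
have mS := gysphere_measurable.
pose w (y : gyborel) := h (proj y) * geta y.
have iw : lambda.-integrable S (EFin \o w).
  by apply: (integrableS measurableT) => //; apply: eq_integrable i1.
have wE : \int[lambda]_(y in S) w y = \int[L2]_(x in Omega) h x.
  rewrite /Rintegral -E1 integral_mkcond; congr fine; apply: eq_integral => y _.
  rewrite patchE -EFinM /w; case: ifPn => // yS.
  by rewrite indicE (negbTE yS) !mulr0.
have mf0 : measurable_fun [set: gyborel] (f0 : gyborel -> R).
  exact: (@borel_measurable R _ gyborel _ id f0 id_open).
have if0 : lambda.-integrable S (EFin \o (f0 : gyborel -> R)).
  have iC := @finite_measure_integrable_cst _ _ _ (finite_copy lfin) S `|C| mS.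
  apply: le_integrable iC => //.
    by apply/measurable_EFinP; exact: measurable_funTS.
  by move=> y Sy; rewrite /= lee_fin normr_id (le_trans (f0C y Sy))// ler_norm.
have w0 y : S y -> 2^-1 * w y = 2^-1 * (h y.1.1 * `|y.2|).
  by move=> Sy; rewrite /w indicE mem_set// mulr1.
have ih2 : lambda.-integrable S (EFin \o (fun y => 2^-1 * w y)).
  by apply: eq_integrable (integrableZl mS 2^-1 iw).
have ifz : lambda.-integrable S (EFin \o (fz : gyborel -> R)).
  have id : lambda.-integrable S (EFin \o (fun y => fz y - f0 y)).
    apply: le_integrable ih2 => //.
      by apply/measurable_EFinP; apply: measurable_funTS; exact: measurable_funB.
    by move=> y Sy; rewrite /= lee_fin w0// (le_trans (zh y))// ler_norm.
  have := integrableD mS id if0; apply: eq_integrable => // y _.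
  by rewrite /= -EFinD subrK.
rewrite -wE -(RintegralZl _ mS iw) -(RintegralB mS if0 ih2).
apply: le_Rintegral => //.
  exact: (integrableB mS if0 ih2).
by move=> y Sy; rewrite w0//; have := zh y; rewrite ler_norml => /andP[? ?]; lra.
Qed.

End pairing.

(** * Global stability *)

Section global_stability.
Variable R : realType.
Variable Omega : set (plane R).
Hypotheses (oO : open Omega) (bO : bounded_set Omega).
Local Notation L2 := (lebesgue2 R).
Implicit Types (A : 'M[R]_2) (te tp : plane R -> 'M[R]_2).

Let mO : measurable (Omega : set (mplane R)). Proof. exact: open_measurable2. Qed.

Lemma cst_L1 (c : R) : L1fun Omega (fun=> c).
Proof. by apply: continuous_L1 => //; exact: cst_continuous. Qed.

Lemma L2fun_L1fun f : L2fun Omega f -> L1fun Omega f.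
Proof.
move=> [mf if2]; have i1 := L1funD mO (cst_L1 1) if2.
have [] // := L1fun_le mO mf i1 => x _.
have := sqr_ge0 (`|f x| - 1); rewrite sqrrB1 real_normK ?num_real//.
by have := normr_ge0 (f x); rewrite -mulr_natr; nra.
Qed.

(** The total strain is a boundary term: the Green formula tested with 1 gives the integral of the
    trace, which by the Dirichlet condition is the mass of [p] on the boundary, and this is zero
    because [p] has a density on the open set [Omega]. *)
Lemma mean_zero (tu : plane R -> plane R) te tp :
  admissible_reg Omega (bdry Omega) (fun=> 0) tu te tp ->
  forall i j, \int[L2]_(x in Omega) te x i j + \int[L2]_(x in Omega) tp x i j = 0.
Proof.
move=> [itp _ [p [[Lu _] [Lte _] _ [E sE Ep] [T [_ iT [E' sE' green]] pT]] pE]] i j.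
have mb : measurable (bdry Omega : set (mplane R)).
  apply: measurableD; first by apply: closed_measurable2; exact: closed_closure.
  by apply: open_measurable2; exact: open_interior.
have ite : L1fun Omega (fun x => te x i j) by exact: L2fun_L1fun.
have T0 : (\int[@hausdorff1_measure R]_(x in bdry Omega) (odot (T x) (outward_normal Omega x) i j)%:E = 0)%E.
  by rewrite -pT// pE// (bdry_open_disjoint oO)// integral_set0.
have [C11 C1p] := C1_cst (1 : R).
have E'0 : charge_integral (E' i j) Omega (fun=> 1) = 0.
  have := green (fun=> 1) C11 i j; rewrite !C1p.
  rewrite Rintegral_eq0//; last by move=> x _; rewrite !mulr0 addr0 mulr0.
  rewrite addr0 => ->; rewrite /Rintegral (_ : (fun x => _) = fun x => (odot (T x) (outward_normal Omega x) i j)%:E).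
    by rewrite T0.
  by apply/funext => x; rewrite mul1r.
(* [E] and [E'] come from two different existential statements and are related on test functions
   only; cutoffs tending to 1 transfer the vanishing total mass from [E'] to [E]. *)
have [psi [tpsi psi01 psi1]] := smooth_cutoff oO.
have mpsi n : measurable_fun (Omega : set (mplane R)) (psi n : mplane R -> R).
  by apply: continuous_measurable_domain; have [/(_ [::])/C1_continuous] := tpsi n.
have psile n x : Omega x -> `|psi n x| <= 1.
  by have /andP[p0 p1] := psi01 n x; rewrite ger0_norm.
have cE := charge_integral_cvg (nu := E i j) (f := fun=> 1) mO mpsi psile psi1.
have cE' := charge_integral_cvg (nu := E' i j) (f := fun=> 1) mO mpsi psile psi1.
have iu1 n k l : L1fun Omega (fun x => coord2 (tu x) k * partial l (psi n) x).
  have [/(_ [::])/= cp [K [cK _] psi0]] := tpsi n.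
  have cp' := C1_partial_continuous (i := l) cp.
  have [M _ pM] := continuous_bounded_domain bO cp'.
  have := L1fun_bounded_mul mO (continuous_measurable_domain cp') pM (Lu k).
  by congr (L1fun _ _); apply/funext => x; rewrite mulrC.
have iu n := L1funZ 2^-1 mO (L1funD mO (iu1 n i j) (iu1 n j i)).
have EE' n : charge_integral (E i j) Omega (psi n) = - charge_integral (E' i j) Omega (psi n).
  rewrite (sE _ (tpsi n)) (sE' _ (tpsi n)) opprK.
  rewrite -mulN1r -(RintegralZl _ mO (iu n)); apply: eq_Rintegral => x _.
  have cN k : coord2 (0 - tu x) k = - coord2 (tu x) k.
    by rewrite /coord2; case: ifP => _ /=; rewrite sub0r.
  by rewrite !cN; ring.
have E0 : charge_integral (E i j) Omega (fun=> 1) = 0.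
  rewrite (funext EE') in cE.
  have cE'' : (fun n => - charge_integral (E' i j) Omega (psi n)) @ \oo --> (0 : R).
    by rewrite -[X in _ --> X]oppr0 -E'0; exact: cvgN cE'.
  exact: (cvg_unique (@norm_hausdorff _ R) cE cE'').
move: E0; rewrite charge_integral1// Ep// pE// setIid.
have f1 := integrable_fin_num mO ite; have f2 := integrable_fin_num mO (itp i j).
by rewrite (fineD f1 f2).
Qed.

Lemma L2funD f g : L2fun Omega f -> L2fun Omega g -> L2fun Omega (fun x => f x + g x).
Proof.
move=> [mf if2] [mg ig2]; have mfg := measurable_funD mf mg; split => //.
have i1 := L1funZ 2 mO (L1funD mO if2 ig2).
have [] // := L1fun_le mO (measurable_funM mfg mfg) i1 => x _.
rewrite -[X in `|X|]expr2 ger0_norm ?sqr_ge0//.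
by have := sqr_ge0 (f x - g x); rewrite sqrrB sqrrD; lra.
Qed.

Lemma L2funZ f (c : R) : L2fun Omega f -> L2fun Omega (fun x => c * f x).
Proof.
move=> [mf if2]; split; first exact: measurable_funM.
have := L1funZ (c ^+ 2) mO if2; congr (L1fun _ _); apply/funext => x.
by rewrite exprMn.
Qed.

Lemma L2fun_cst (c : R) : L2fun Omega (fun=> c).
Proof. by split; [exact: measurable_cst|exact: cst_L1]. Qed.

Lemma integral_inner A g : L1mat Omega g -> L1fun Omega (fun x => inner A (g x)) /\
  \int[L2]_(x in Omega) inner A (g x) =
  A ord0 ord0 * \int[L2]_(x in Omega) g x ord0 ord0 +
  A ord0 ord_max * \int[L2]_(x in Omega) g x ord0 ord_max +
  (A ord_max ord0 * \int[L2]_(x in Omega) g x ord_max ord0 +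
   A ord_max ord_max * \int[L2]_(x in Omega) g x ord_max ord_max).
Proof.
move=> ig; rewrite (funext (fun x => inner2 A (g x))).
have iz i j := L1funZ (A i j) mO (ig i j).
have id i j k l := L1funD mO (iz i j) (iz k l).
split; first exact: (L1funD mO (id _ _ _ _) (id _ _ _ _)).
by rewrite (RintegralD mO (id _ _ _ _) (id _ _ _ _)) !(RintegralD mO (iz _ _) (iz _ _))
  !(RintegralZl _ mO (ig _ _)).
Qed.

Lemma elastic_L1 mu kappa (X : plane R -> 'M[R]_2) : L2mat Omega X ->
  L1fun Omega (fun x => inner (elasticity mu kappa (X x)) (X x)).
Proof.
move=> LX; rewrite (funext (fun x => elastic_form mu kappa (X x))).
have sq f : L2fun Omega f -> L1fun Omega (fun x => f x ^+ 2) by case.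
apply: (L1funD mO); apply: (L1funZ _ mO); last by apply: sq; exact: L2funD.
apply: (L1funD mO); last by apply: (L1funZ _ mO); exact: sq.
apply: (L1funD mO); last by apply: (L1funZ _ mO); exact: sq.
have := L2funD (LX ord0 ord0) (L2funZ (-1) (LX ord_max ord_max)) => /sq.
by congr (L1fun _ _); apply/funext => x; rewrite mulN1r.
Qed.

Lemma Qel_lower mu kappa a A te : 0 <= mu -> 0 <= kappa -> MD A -> L2mat Omega te ->
  Qel Omega (elasticity mu kappa) (fun=> a *: A) +
    2 * mu * a * \int[L2]_(x in Omega) inner A (te x) <=
  Qel Omega (elasticity mu kappa) (fun x => a *: A + te x).
Proof.
move=> mu0 k0 dA Lte.
have Lte1 : L1mat Omega te by move=> i j; exact: L2fun_L1fun.
have [iA _] := integral_inner A Lte1.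
have LX : L2mat Omega (fun x => a *: A + te x).
  move=> i j; have := L2funD (L2fun_cst (a * A i j)) (Lte i j).
  by congr (L2fun _ _); apply/funext => x; rewrite !mxE.
rewrite /Qel; under eq_Rintegral do rewrite elastic_MD//.
have i1 := L1funD mO (cst_L1 (2 * mu * a ^+ 2 * inner A A)) (L1funZ (4 * mu * a) mO iA).
have := le_Rintegral mO i1 (elastic_L1 mu kappa LX) (fun x _ => elastic_lower a (te x) mu0 k0 dA).
rewrite (RintegralD mO (cst_L1 _) (L1funZ _ mO iA)) (RintegralZl _ mO iA).
by lra.
Qed.

Lemma dissip_L1 tp tz : L1mat Omega tp -> L1fun Omega tz ->
  L1fun Omega (fun x => dissip (tp x, tz x)).
Proof.
move=> itp itz.
have ia f : L1fun Omega f -> L1fun Omega (fun x => `|f x|).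
  by move=> i_f; apply/integrable_abse: i_f.
have i1 := L1funD mO (L1funD mO (L1funD mO (L1funD mO (ia _ (itp ord0 ord0)) (ia _ (itp ord_max ord_max)))
  (ia _ (itp ord0 ord_max))) (ia _ (itp ord_max ord0))) (ia _ itz).
have m i j : measurable_fun (Omega : set (mplane R)) ((fun x => tp x i j) : mplane R -> R).
  exact: L1fun_measurable (itp i j).
have mz := L1fun_measurable itz.
have [|x _|//] := L1fun_le (f := fun x => dissip (tp x, tz x)) mO _ i1.
  apply: (@measurableT_comp _ _ _ _ _ _ (@Num.sqrt R)).
    by apply: continuous_measurable_fun; exact: sqrt_continuous.
  apply: measurable_funD; last exact: measurable_funM.
  apply: measurable_funD; apply: measurable_funM => //.
    by apply: measurable_funM; exact: measurable_funB.
  by apply: measurable_funM; exact: measurable_funD.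
by rewrite ger0_norm ?sqrtr_ge0//; exact: dissip_bound.
Qed.

Lemma Hcal_lower a A tp tz : MD A -> a ^+ 2 * inner A A <= 3 / 4 -> L1mat Omega tp ->
  L1fun Omega tz ->
  a * \int[L2]_(x in Omega) inner A (tp x) + 2^-1 * \int[L2]_(x in Omega) `|tz x| <=
  Hcal Omega (@Kball R) tp tz.
Proof.
move=> dA aA itp itz; rewrite /Hcal.
have -> : \int[L2]_(x in Omega) Hdiss (@Kball R) (tp x, tz x) =
    \int[L2]_(x in Omega) dissip (tp x, tz x).
  by apply: eq_Rintegral => x _; rewrite HdissE.
have [iA _] := integral_inner A itp.
have iz : L1fun Omega (fun x => `|tz x|) by apply/integrable_abse: itz.
rewrite -(RintegralZl _ mO iA) -(RintegralZl _ mO iz) -(RintegralD mO (L1funZ _ mO iA) (L1funZ _ mO iz)).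
apply: le_Rintegral => //.
- exact: L1funD mO (L1funZ _ mO iA) (L1funZ _ mO iz).
- exact: dissip_L1.
- by move=> x _; exact: (dissip_lower (tp x, tz x) dA aA).
Qed.

Definition Vpoint (y : gypoint R 1) : R := Vhom (y.1.2 ord0 ord0).2 y.2.

Lemma Vhom_continuous : continuous (fun v : R * R => Vhom v.1 v.2).
Proof.
have cm : continuous (fun v : R * R => Num.max v.2 0).
  by move=> v; apply: (@continuous_max R _ snd (fun=> 0)); [exact: cvg_snd|exact: cvg_cst].
move=> v; rewrite /Vhom; apply: cvgB; apply: cvgMr; first exact: cm.
apply: (@continuous_comp _ _ _ (fun v : R * R => Num.max v.2 0 ^+ 2 + v.1 ^+ 2) (@Num.sqrt R)); last exact: sqrt_continuous.
by apply: cvgD; apply: cvg_sqr; [exact: cm|exact: cvg_fst].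
Qed.

Lemma Vpoint_continuous : continuous Vpoint.
Proof.
move=> y; apply: (@continuous_comp _ _ _ (fun y : gypoint R 1 => ((y.1.2 ord0 ord0).2, y.2)) (fun v : R * R => Vhom v.1 v.2)); last exact: Vhom_continuous.
have c1 := @gy_theta_continuous R 1 ord0 y; have c2 : (fun y : gypoint R 1 => y.2) @ y --> y.2 by exact: cvg_snd.
exact: cvg_pair c1 c2.
Qed.

Lemma Vpoint_Chom : Chom Omega Vpoint.
Proof.
split; first by apply: continuous_subspaceT; exact: Vpoint_continuous.
by move=> s y s0 _; rewrite /Vpoint /gyscale /= mxE /= Vhom_scale.
Qed.

Lemma Vhom_dist th th' eta : `|Vhom th' eta - Vhom th eta| <= 2^-1 * `|th' - th| :> R.
Proof.
have := Vhom_lip th th' eta; have := Vhom_lip th' th eta; rewrite (distrC th th') ler_norml.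
by move=> *; apply/andP; split; lra.
Qed.

Lemma Vpoint_bound y : @gysphere R Omega 1 y -> `|Vpoint y| <= 1.
Proof.
move=> [_]; rewrite /Xinorm2 big_ord1 => y1.
have t1 : `|(y.1.2 ord0 ord0).2| <= 1.
  rewrite -(@ler_pXn2r _ 2) ?nnegrE// real_normK ?num_real// expr1n -y1.
  by rewrite -addrA addrCA lerDl addr_ge0 ?sqr_ge0// inner_ge0.
have V0 : Vhom 0 y.2 = 0.
  by rewrite /Vhom expr0n addr0 sqrtr_sqr ger0_norm ?subrr// le_max lexx orbT.
have := Vhom_dist 0 (y.1.2 ord0 ord0).2 y.2; rewrite V0 !subr0 => /le_trans; apply; lra.
Qed.

Lemma twin_abs_eta m (c q q' : 'rV[Xi R]_m) (phi : plane R -> R) :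
  twin Omega c q q' (fun y => phi y.1.1 * `|y.2|) = \int[L2]_(x in Omega) phi x.
Proof.
rewrite /twin /slab /=.
have -> : \int[L2]_(x in Omega) (phi x * `|1 : R|) = \int[L2]_(x in Omega) phi x.
  by apply: eq_Rintegral => x _; rewrite normr1 mulr1.
have z : \int[L2]_(x in Omega) (phi x * `|0 : R|) = 0.
  by apply: Rintegral_eq0 => // x _; rewrite normr0 mulr0.
by rewrite z mulr0 !addr0.
Qed.

Lemma softening_lower (c q q' : 'rV[Xi R]_1) (tz : plane R -> R) :
  MDrow c -> MDrow q -> MDrow q' -> L1fun Omega tz ->
  twin Omega c q q' Vpoint - 2^-1 * \int[L2]_(x in Omega) `|tz x| <=
  pairing Omega (twin Omega c q q')
    (fun y => Vpersp (@Vsoft R) ((y.1.2 ord0 ord0).2 + y.2 * (tz \_ Omega) y.1.1) y.2).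
Proof.
move=> dc dq dq' itz.
have iz : L1fun Omega (fun x => `|tz x|) by apply/integrable_abse: itz.
have z0 : 0 <= \int[L2]_(x in Omega) `|tz x| by apply: Rintegral_ge0.
(* In the absence of a representing measure [pairing] takes the default value 0, and the inequality
   holds because both terms of the left-hand side are nonpositive. *)
rewrite /pairing; case: xgetP => [r _ [lambda rep ->]|_]; last first.
  have s0 p eta : MDrow p -> slab Omega p eta Vpoint <= 0.
    move=> dp; have Vle x : Omega x -> Vpoint (x, p, eta) <= 0 by move=> _; exact: Vhom_le0.
    have := le_Rintegral mO (Chom_L1 oO bO eta Vpoint_Chom dp) (cst_L1 0) Vle.
    by rewrite Rintegral_cst// mul0r.
  by have := s0 c 1 dc; have := s0 q 0 dq; have := s0 q' 0 dq'; rewrite /twin; lra.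
have mz : measurable_fun [set: mplane R] (tz \_ Omega : mplane R -> R).
  exact: L1fun_measurable (L1fun_patch oO itz).
pose h x := `|(tz \_ Omega) x|.
have hE : \int[L2]_(x in Omega) `|tz x| = \int[L2]_(x in Omega) h x.
  by apply: eq_Rintegral => x xO; rewrite /h patchE xO.
rewrite hE; apply: (@pairing_lower R Omega oO bO 1 lambda _ rep _ Vpoint _ h 1).
- by move=> phi _; exact: twin_abs_eta.
- exact: Vpoint_Chom.
- exact: Vpoint_continuous.
- exact: Vpoint_bound.
- have [|x Ox|//] := L1fun_le (f := h) mO _ iz.
    by apply: measurableT_comp => //; exact: measurable_funTS.
  by rewrite /h normr_id patchE mem_set.
- by move=> x Ox; rewrite /h patchE memNset// normr0.
- have id_open O : open O -> measurable (id @^-1` O : set (g_sigma_algebraType (@open (gypoint R 1)))).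
    exact: sub_sigma_algebra.
  have mV : measurable_fun [set: mplane R] ((fun v => Vhom v.1 v.2) : mplane R -> R).
    by apply: continuous_measurable2T; exact: Vhom_continuous.
  have mt := borel_measurable id_open (@gy_theta_continuous R 1 ord0).
  have meta : measurable_fun setT (fun y : g_sigma_algebraType (@open (gypoint R 1)) => y.2).
    by apply: (borel_measurable (f := fun y : gypoint R 1 => y.2) id_open) => y; exact: cvg_snd.
  have mzp := measurableT_comp mz (@gypoint_fst_measurable R 1).
  have := measurableT_comp mV (measurable_fun_pair (measurable_funD mt (measurable_funM meta mzp)) meta).
  by congr (measurable_fun _ _); apply/funext => y /=; rewrite VperspE.
- move=> y; rewrite VperspE; apply: (le_trans (Vhom_dist _ _ _)).
  by rewrite (addrC (y.1.2 ord0 ord0).2) addrK normrM (mulrC `|y.2|).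
Qed.

End global_stability.

(** * The slip system *)

Section evolution_example.
Variable R : realType.
Variable Omega : set (plane R).
Hypotheses (oO : open Omega) (bO : bounded_set Omega).
Variables (xi0 : 'M[R]_2) (th : R) (a b z : R -> R).
Hypotheses (dA : MD (sympart xi0)) (A0 : sympart xi0 != 0).
Local Notation A := (sympart xi0).
Local Notation L2 := (lebesgue2 R).

Let mO : measurable (Omega : set (mplane R)). Proof. exact: open_measurable2. Qed.

Definition base_row m : 'rV[Xi R]_m := \row_i (0, th).

(** [s] is the sign of the internal variable: 1 and -1 give the two concentrated parts, which share
    the plastic strain. *)
Definition slip_row m (s : R) (ts : m.-tuple R) : 'rV[Xi R]_m :=
  \row_i (b (tnth ts i) *: A, s * z (tnth ts i)).

Definition slip_system : system R := fun m ts =>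
  twin Omega (base_row m) (slip_row 1 ts) (slip_row (-1) ts).

Lemma MDrow_base m : MDrow (base_row m).
Proof. by move=> i; rewrite mxE; exact: MD_0. Qed.

Lemma MDrow_slip m s (ts : m.-tuple R) : MDrow (slip_row s ts).
Proof. by move=> i; rewrite mxE; exact: MD_scale. Qed.

Lemma slip_system_SGY : SGY Omega (@nonneg R) slip_system.
Proof.
split=> [m ts _|m n ts j _ ss _ f cf].
  by apply: twin_GY => //; [exact: MDrow_base|exact: MDrow_slip|exact: MDrow_slip].
have ssE s : slip_row s ss = \row_i slip_row s ts ord0 (j i).
  by apply/rowP => i; rewrite !mxE /ss tnth_mktuple.
have bE : base_row n = \row_i base_row m ord0 (j i) by apply/rowP => i; rewrite !mxE.
by rewrite /slip_system /twin !ssE bE.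
Qed.

Lemma affine_strain (t : R) : C1field (fun x => t *: matvec xi0 x) /\
  forall i j, sym_partial (fun x => t *: matvec xi0 x) i j = fun=> t * A i j.
Proof.
have [mC mp] := matvec_C1 xi0.
have E i : (fun x => coord2 (t *: matvec xi0 x) i) = fun x => t * coord2 (matvec xi0 x) i.
  by apply/funext => x; rewrite /coord2; case: ifP.
have H i := C1_scale t (mC i).
split=> [i|i j]; first by rewrite E; exact: (H i).1.
apply/funext => x; rewrite /sym_partial !E !(H _).2 !mp -sympart_entry; ring.
Qed.

Lemma affine_sym_grad (t : R) :
  sym_grad Omega (fun x => t *: matvec xi0 x) (fun i j => dens Omega (fun=> t * A i j)).
Proof.
have [cU sU] := affine_strain t.
by have := sym_grad_C1 oO bO cU; congr sym_grad; apply/funext => i; apply/funext => j; rewrite sU.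
Qed.

Lemma slip_system_AY : (forall t, a t + b t = t) ->
  AY Omega (bdry Omega) (@nonneg R) (fun t x => t *: matvec xi0 x)
    (fun t x => t *: matvec xi0 x) (fun t _ => a t *: A) slip_system.
Proof.
move=> abt.
have [v1 [v2 [i0 [Av v2i]]]] := odot_decomp dA A0.
have [psi [g [rp [rm pf]]]] := profile_exists oO bO v2i.
split.
- by move=> t _; apply: C1field_BD => //; exact: (affine_strain t).1.
- move=> t _; split; first by move=> i j; apply: continuous_L2fun => //; exact: cst_continuous.
  by apply: aeW => x _; have [] := MD_scale (a t) dA.
- exact: slip_system_SGY.
- move=> m ts _; pose T i := tnth ts i.
  exists (fun i => recovery_u xi0 v1 psi g (T i) (b (T i))),
    (fun i => recovery_e xi0 v1 psi g (a (T i)) (b (T i))),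
    (fun i => recovery_pm Omega xi0 psi rp rm (b (T i))),
    (fun i n => dens Omega (recovery_z psi rp rm th (z (T i)) n)),
    (fun n => delta Omega (recovery_row xi0 psi rp rm th (b \o T) (z \o T) n)).
  split.
  + move=> i k; split; first exact: (recovery_admissible oO bO Av dA pf).
    apply: dens_concentrated => //; apply: continuous_L1 => //.
    exact: (recovery_z_continuous pf).
  + by move=> i; exact: (recovery_u_weakstar oO bO Av pf).
  + by move=> i; exact: (recovery_e_strong xi0 v1 oO bO pf).
  + by move=> k; exact: (recovery_is_delta xi0 oO bO pf).
  + have e1 : slip_row 1 ts = \row_i ((b \o T) i *: A, (z \o T) i).
      by apply/rowP => i; rewrite [LHS]mxE [RHS]mxE mul1r.
    have e2 : slip_row (-1) ts = \row_i ((b \o T) i *: A, - (z \o T) i).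
      by apply/rowP => i; rewrite [LHS]mxE [RHS]mxE mulN1r.
    rewrite /slip_system e1 e2; exact: (recovery_gy_cvg oO bO dA pf).
Qed.

Hypotheses (ca : continuous a) (cb : continuous b) (cz : continuous z).

Let cmatvec i : continuous (fun x => coord2 (matvec xi0 x) i).
Proof. exact: (C1_continuous ((matvec_C1 xi0).1 i)). Qed.

Lemma matvec_enorm_L1 : L1fun Omega (fun x => enorm (matvec xi0 x)).
Proof.
apply: continuous_L1 => // x.
apply: (@continuous_comp _ _ _ (fun x => dot2 (matvec xi0 x) (matvec xi0 x)) (@Num.sqrt R)).
  by apply: cvgD; apply: cvgM; [exact: (@cmatvec ord0)|exact: (@cmatvec ord0)|exact: (@cmatvec ord_max)|exact: (@cmatvec ord_max)].
exact: sqrt_continuous.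
Qed.

Lemma cvg_slip_row m s (t : nat -> m.-tuple R) (t0 : m.-tuple R) :
  (forall i, (fun k => tnth (t k) i) @ \oo --> tnth t0 i) ->
  (fun k => slip_row s (t k)) @ \oo --> slip_row s t0.
Proof.
move=> tt; apply: cvg_mx_entries => i j; rewrite mxE.
rewrite (funext (fun k => mxE _ _ i j : slip_row s (t k) i j = _)).
have c1 : (fun k => b (tnth (t k) j) *: A) @ \oo --> b (tnth t0 j) *: A.
  by apply: cvgZr_tmp; apply: (@cvg_comp _ _ _ (fun k => tnth (t k) j) b _ _ _ (tt j)); exact: cb.
have c2 : (fun k => s * z (tnth (t k) j)) @ \oo --> s * z (tnth t0 j).
  by apply: cvgMr; apply: (@cvg_comp _ _ _ (fun k => tnth (t k) j) z _ _ _ (tt j)); exact: cz.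
exact: cvg_pair c1 c2.
Qed.

(** Time enters the stress and the rows through the continuous scalars [a], [b], [z], and the
    displacement linearly; thus the rows converge and [twin_cvg] applies, while the fields are
    multiples of fixed ones. *)
Lemma slip_system_left_continuous :
  left_continuous Omega (fun t x => t *: matvec xi0 x) (fun t _ => a t *: A) slip_system.
Proof.
split=> [t s _ st|m t s _ _ _ st]; last first.
  by apply: twin_cvg => //; try exact: MDrow_base; try (move=> *; exact: MDrow_slip); exact: cvg_slip_row.
split; last first.
  move=> g Lg; have [iA _] := integral_inner oO A (fun i j => L2fun_L1fun oO bO (Lg i j)).
  have E c : \int[L2]_(x in Omega) inner (c *: A) (g x) = c * \int[L2]_(x in Omega) inner A (g x).
    rewrite -(RintegralZl _ mO iA); apply: eq_Rintegral => x _.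
    by rewrite -[g x in LHS]scale1r innerZ mulr1.
  rewrite E (funext (fun k => E (a (s k)))); apply: cvgMl.
  by apply: (@cvg_comp _ _ _ s a _ _ _ st); exact: ca.
split.
- by move=> k; apply: C1field_L1 => //; exact: (affine_strain _).1.
- by apply: C1field_L1 => //; exact: (affine_strain _).1.
- have E k : \int[L2]_(x in Omega) enorm (s k *: matvec xi0 x - t *: matvec xi0 x) =
      `|s k - t| * \int[L2]_(x in Omega) enorm (matvec xi0 x).
    rewrite -(RintegralZl _ mO matvec_enorm_L1); apply: eq_Rintegral => x _.
    rewrite -scalerBl /enorm -sqrtr_sqr -sqrtrM ?sqr_ge0//; congr Num.sqrt.
    by rewrite /dot2 /= /GRing.scale/=; ring.
  rewrite (funext E) -[X in _ --> X](mul0r (\int[L2]_(x in Omega) enorm (matvec xi0 x))).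
  apply: cvgMl; rewrite -[X in _ --> X](normr0 R) -(subrr t); apply: cvg_norm.
  by apply: cvgB; [exact: st|exact: cvg_cst].
- exists (fun k i j => dens Omega (fun=> s k * A i j)), (fun i j => dens Omega (fun=> t * A i j)).
  split=> [k||phi [cphi _] i j]; [exact: affine_sym_grad|exact: affine_sym_grad|].
  have iphi := continuous_L1 oO bO cphi.
  have E c : charge_integral (dens Omega (fun=> c * A i j)) Omega phi =
      c * (A i j * \int[L2]_(x in Omega) phi x).
    rewrite charge_integral_dens//; last exact: cst_L1.
    rewrite mulrA -(RintegralZl _ mO iphi); apply: eq_Rintegral => x _; exact: mulrC.
  by rewrite E (funext (fun k => E (s k))); apply: cvgMl; exact: st.
Qed.

Lemma slip_system_stability (mu kappa : R) : 0 <= mu -> 0 <= kappa ->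
  (forall t, 0 <= t -> (2 * mu * a t) ^+ 2 * inner A A <= 3 / 4) ->
  global_stability Omega (bdry Omega) (elasticity mu kappa) (@Kball R) (@Vsoft R)
    (fun t _ => a t *: A) slip_system.
Proof.
have arith (Q0 Q1 S0 S1 H I J Z k : R) : Q0 + k * I <= Q1 -> k * J + 2^-1 * Z <= H ->
    S0 - 2^-1 * Z <= S1 -> k * (I + J) = 0 -> Q0 + S0 <= Q1 + H + S1 by lra.
move=> mu0 k0 aA t t0 tu te tp tz adm itz.
have [itp _ [p [_ [Lte _] _ _ _] _]] := adm.
have mz := mean_zero oO bO adm.
have ite i j := L2fun_L1fun oO bO (Lte i j).
have h1 := Qel_lower oO bO (a t) mu0 k0 dA Lte.
have h2 := Hcal_lower oO dA (aA t t0) itp itz.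
have h3 := softening_lower oO bO (MDrow_base (m := 1)) (MDrow_slip 1 [tuple t]) (MDrow_slip (-1) [tuple t]) itz.
have VE : (fun y : gypoint R 1 => Vpersp (@Vsoft R) (y.1.2 ord0 ord0).2 y.2) = @Vpoint R.
  by apply/funext => y; rewrite VperspE.
rewrite /softening VE; apply: arith h1 h2 h3 _.
rewrite (integral_inner oO A ite).2 (integral_inner oO A itp).2.
rewrite [X in _ * X](_ : _ = 0) ?mulr0//.
have m i j := congr1 (fun r => A i j * r) (mz i j).
have m00 := m ord0 ord0; have m01 := m ord0 ord_max; have m10 := m ord_max ord0; have m11 := m ord_max ord_max.
by rewrite !mulrDr !mulr0 in m00 m01 m10 m11; lra.
Qed.

(* Along a proportional loading every variation sum telescopes. *)
Lemma slip_system_variation (G : Xi R -> R) (k T : R) : 0 < T ->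
  (forall r v, 0 <= r -> G (r *: v.1, r * v.2) = r * G v) ->
  {homo b : s t / s <= t} -> (forall t, z t = k * b t) ->
  variation_of G slip_system 0 T =
  (vol Omega * (2^-1 * (G (A, k) + G (A, - k))) * (b T - b 0))%:E.
Proof.
move=> T0 hG bm zk.
set c := vol Omega * _.
(* The base row cancels in the increment, and each slip row contributes (b t - b s) times (A, k) or
   (A, - k), so homogeneity of [G] makes the term proportional to b t - b s. *)
have term s t : s <= t -> slip_system [tuple s; t]
    (fun y => G (y.1.2 ord0 ord_max - y.1.2 ord0 ord0)) = c * (b t - b s).
  move=> st; have bst : 0 <= b t - b s by rewrite subr_ge0 bm.
  have G0 : G 0 = 0 by have := hG 0 0 (lexx 0); rewrite /= scale0r !mul0r.
  have slipE e : slip_row e [tuple s; t] ord0 ord_max - slip_row e [tuple s; t] ord0 ord0 =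
      ((b t - b s) *: A, (b t - b s) * (e * k)).
    rewrite !mxE /= !(tnth_nth 0) /= !zk; congr (_, _); first by rewrite -scalerBl.
    by rewrite /=; ring.
  rewrite /slip_system /twin /slab /= !slipE.
  have -> : base_row 2 ord0 ord_max - base_row 2 ord0 ord0 = 0 by rewrite !mxE subrr.
  have GE e : G ((b t - b s) *: A, (b t - b s) * (e * k)) = (b t - b s) * G (A, e * k).
    exact: hG (A, e * k) bst.
  by rewrite G0 !GE mul1r mulN1r !Rintegral_cst// /c /vol; ring.
have sum s : path <%R 0 s -> last 0 s = T ->
    \sum_(i < size s) slip_system [tuple nth 0 (0 :: s) i; nth 0 s i]
      (fun y => G (y.1.2 ord0 ord_max - y.1.2 ord0 ord0)) = c * (b T - b 0).
  move=> /(pathP 0) ps lT.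
  have -> : \sum_(i < size s) slip_system [tuple nth 0 (0 :: s) i; nth 0 s i]
      (fun y => G (y.1.2 ord0 ord_max - y.1.2 ord0 ord0)) =
      \sum_(0 <= i < size s) (c * b (nth 0 (0 :: s) i.+1) - c * b (nth 0 (0 :: s) i)).
    rewrite big_mkord; apply: eq_bigr => i _; rewrite term; last by apply: ltW; exact: ps.
    by rewrite mulrBr.
  rewrite telescope_sumr// -mulrBr; congr (_ * (b _ - b _)).
  by rewrite -last_nth.
rewrite /variation_of [X in ereal_sup X](_ : _ = [set (c * (b T - b 0))%:E]) ?ereal_sup1//.
apply/seteqP; split=> [x [s [ps lT ->]]|x ->] /=; first by rewrite sum.
by exists [:: T]; rewrite /= T0; split => //; rewrite (sum [:: T])//= T0.
Qed.

Lemma slip_system_softening t :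
  softening (@Vsoft R) slip_system t = vol Omega * (Vhom th 1 - 2^-1 * `|z t|).
Proof.
have V0 x : Vhom x 0 = - (2^-1 * `|x|) :> R.
  by rewrite /Vhom maxxx expr0n add0r mulr0 sub0r sqrtr_sqr.
rewrite /softening /slip_system /twin /slab /= !mxE /= !(tnth_nth 0) /= !VperspE !Rintegral_cst//.
by rewrite !V0 !normrM normrN normr1 mul1r /vol; field.
Qed.

End evolution_example.

(** * The loading path and its time integral *)

Section loading.
Variable R : realType.
Variable t0 : R.
Hypothesis t0_ge0 : 0 <= t0.

Lemma betaE t : beta t0 t = pos (t - t0).
Proof.
rewrite /beta; case: ifPn => [tt|]; first by rewrite pos_le// subr_le0.
by rewrite -ltNge => tt; rewrite pos_ge// subr_ge0 ltW.
Qed.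

Lemma alpha_beta t : alpha t0 t + beta t0 t = t.
Proof. by rewrite /alpha /beta; case: ifP => _; rewrite ?addr0// addrC subrK. Qed.

Lemma alphaE t : alpha t0 t = t - pos (t - t0).
Proof. by have := alpha_beta t; rewrite -betaE; lra. Qed.

Lemma beta_ge0 t : 0 <= beta t0 t.
Proof. by rewrite /beta; case: ifPn => //; rewrite -ltNge subr_ge0 => /ltW. Qed.

Lemma beta0 : beta t0 0 = 0.
Proof. by rewrite /beta t0_ge0. Qed.

Lemma beta_homo : {homo beta t0 : s t / s <= t}.
Proof.
move=> s t st; rewrite /beta; case: ifPn => [_|].
  exact: (beta_ge0 t).
by rewrite -ltNge => ts; rewrite (leNgt t t0) (lt_le_trans ts st) /= lerD2r.
Qed.

Lemma alpha_bounds t : 0 <= t -> 0 <= alpha t0 t <= t0.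
Proof. by move=> t1; rewrite /alpha; case: ifPn => h; rewrite ?t1 ?h ?t0_ge0 ?lexx. Qed.

Lemma beta_continuous : continuous (beta t0).
Proof.
rewrite (funext betaE) => t; apply: (@continuous_comp _ _ _ (fun t => t - t0) (@pos R)); last exact: pos_continuous.
by apply: cvgB; [exact: cvg_id|exact: cvg_cst].
Qed.

Lemma alpha_continuous : continuous (alpha t0).
Proof.
rewrite (_ : alpha t0 = fun t => t - beta t0 t); last by apply/funext => t; have := alpha_beta t; lra.
by move=> t; apply: cvgB; [exact: cvg_id|exact: beta_continuous].
Qed.

Lemma integral_alpha (T c : R) : 0 < T ->
  \int[@lebesgue_measure R]_(t in `[0, T]) (c * alpha t0 t) =
  c * (2^-1 * alpha t0 T ^+ 2 + t0 * beta t0 T).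
Proof.
move=> T0.
(* A primitive that is C^1 across t0, because [alpha] is t minus the positive part of t - t0; the
   fundamental theorem then applies on the whole interval without splitting it. *)
pose P t := c * (2^-1 * t ^+ 2 - 2^-1 * pos (t - t0) ^+ 2).
have dP t : is_derive t (1 : R) P (c * alpha t0 t).
  have d0 : is_derive t (1 : R) (fun t => t - t0) 1 by apply: is_derive_eq; rewrite subr0.
  have d1 := pos_sqr_derive (t - t0).
  have d2 : is_derive t (1 : R) (fun t => pos (t - t0) ^+ 2) (2 * pos (t - t0) * 1).
    exact: (@is_derive1_comp R (fun t => pos t ^+ 2) (fun t => t - t0)).
  by rewrite alphaE; apply: is_derive_eq; rewrite /GRing.scale/=; field.
have cP : continuous P.
  by move=> t; apply: differentiable_continuous; apply/derivable1_diffP; case: (dP t).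
have ca : continuous (fun t => c * alpha t0 t).
  by move=> t; apply: cvgMr; exact: alpha_continuous.
rewrite /Rintegral (@continuous_FTC2 R (fun t => c * alpha t0 t) P)//.
- rewrite /= /P !alphaE betaE sub0r (pos_le (s := - t0)) ?oppr_le0//.
  have [h|h] := leP T t0; last by rewrite pos_ge; [field|rewrite subr_ge0 ltW].
  by rewrite pos_le; [field|rewrite subr_le0].
- exact: continuous_subspaceT.
- split=> [t _||]; first by case: (dP t).
    by apply: cvg_at_right_filter; exact: cP.
  by apply: cvg_at_left_filter; exact: cP.
- by move=> t _; rewrite derive1E; case: (dP t).
Qed.

End loading.

(** * Energy balance *)

Section affine_fields.
Variable R : realType.
Variable Omega : set (plane R).
Hypotheses (oO : open Omega) (bO : bounded_set Omega).
Variable xi0 : 'M[R]_2.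
Local Notation L2 := (lebesgue2 R).

Let mO : measurable (Omega : set (mplane R)). Proof. exact: open_measurable2. Qed.

Lemma affine_H1 (t : R) : H1vec Omega (fun x => t *: matvec xi0 x) (fun=> t *: xi0).
Proof.
have cU := (affine_strain xi0 t).1.
split.
- by move=> i; apply: continuous_L2fun => //; exact: (C1_continuous (cU i)).
- by move=> i j; exact: L2fun_cst.
- move=> phi [/(_ [::])/= cphi [K [cK KO] phi0]] i j.
  have [mC mp] := matvec_C1 xi0.
  have E : (fun x => coord2 (t *: matvec xi0 x) i) = fun x => t * coord2 (matvec xi0 x) i.
    by apply/funext => x; rewrite /coord2; case: ifP.
  have pE : partial j (fun x => coord2 (t *: matvec xi0 x) i) = fun=> t * xi0 i j.
    by rewrite E (C1_scale t (mC i)).2 mp.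
  have := integral_partial_mul0 j mO cK KO cphi (cU i) phi0.
  rewrite pE => /(congr1 (fun r => - r)); rewrite opprK => <-; congr (- _).
  by apply: eq_Rintegral => x _; rewrite mxE mulrC.
Qed.

Lemma affine_H1norm (r : R) : H1norm Omega (fun x => r *: matvec xi0 x) (fun=> r *: xi0) =
  `|r| * H1norm Omega (matvec xi0) (fun=> xi0).
Proof.
have c i : continuous (fun x => coord2 (matvec xi0 x) i) by exact: (C1_continuous ((matvec_C1 xi0).1 i)).
have i1 : L1fun Omega (fun x => dot2 (matvec xi0 x) (matvec xi0 x) + inner xi0 xi0).
  apply: continuous_L1 => // x; apply: cvgD; last exact: cvg_cst.
  by apply: cvgD; apply: cvgM; [exact: (@c ord0)|exact: (@c ord0)|exact: (@c ord_max)|exact: (@c ord_max)].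
rewrite /H1norm -sqrtr_sqr -sqrtrM ?sqr_ge0//; congr Num.sqrt.
rewrite -(RintegralZl _ mO i1); apply: eq_Rintegral => x _.
by rewrite innerZ /dot2 /= /GRing.scale/=; ring.
Qed.

Lemma affine_ACloc : ACloc_H1 Omega (fun t x => t *: matvec xi0 x) (fun t _ => t *: xi0).
Proof.
split=> [t _|T eps _ e0]; first exact: affine_H1.
pose N := H1norm Omega (matvec xi0) (fun=> xi0).
have N0 : 0 <= N by exact: sqrtr_ge0.
exists (eps / (N + 1)); first by rewrite divr_gt0// ltr_wpDl.
move=> n a b ab _ sab.
have -> : \sum_i H1norm Omega (fun x => b i *: matvec xi0 x - a i *: matvec xi0 x)
    (fun x => b i *: xi0 - a i *: xi0) = (\sum_i (b i - a i)) * N.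
  rewrite mulr_suml; apply: eq_bigr => i _.
  have [/andP[_ abi] _] := ab i.
  rewrite -[X in _ = X * _]ger0_norm ?subr_ge0// -affine_H1norm; congr H1norm.
    by apply/funext => x; rewrite scalerBl.
  by apply/funext => x; rewrite scalerBl.
have s0 : 0 <= \sum_i (b i - a i).
  by apply: sumr_ge0 => i _; rewrite subr_ge0; have [/andP[]] := ab i.
move: sab; rewrite ltr_pdivlMr ?ltr_wpDl//; apply: le_lt_trans.
by rewrite ler_wpM2l// lerDl.
Qed.

Lemma affine_H1_derivative : H1_derivative Omega (fun t x => t *: matvec xi0 x)
  (fun _ => matvec xi0) (fun t _ => t *: xi0) (fun _ _ => xi0).
Proof.
apply: aeW => t _; split.
  by have := affine_H1 1; rewrite scale1r; congr H1vec; apply/funext => x; rewrite scale1r.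
apply: cvg_near_cst; near=> h.
have h0 : h != 0 by near: h; exact: nbhs_dnbhs_neq.
have quot (V : lmodType R) (v : V) : h^-1 *: ((t + h) *: v - t *: v) - v = 0 *: v.
  by rewrite -scalerBl (addrC t) addrK scalerA mulVf// scale1r subrr scale0r.
rewrite (_ : H1norm _ _ _ = H1norm Omega (fun x => 0 *: matvec xi0 x) (fun=> 0 *: xi0)).
  by rewrite affine_H1norm normr0 mul0r.
by congr H1norm; apply/funext => x; exact: quot.
Unshelve. all: by end_near. Qed.

End affine_fields.

Section energy.
Variable R : realType.
Variable Omega : set (plane R).
Hypotheses (oO : open Omega) (bO : bounded_set Omega).
Variables (xi0 : 'M[R]_2) (mu kappa th : R).
Hypotheses (mu0 : 0 < mu) (dA : MD (sympart xi0)) (A0 : sympart xi0 != 0).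
Local Notation A := (sympart xi0).
Local Notation L2 := (lebesgue2 R).

Let mO : measurable (Omega : set (mplane R)). Proof. exact: open_measurable2. Qed.

Let t0 : R := Num.sqrt 3 / (4 * mu * fnorm A).

Let s3 : Num.sqrt 3 ^+ 2 = 3 :> R. Proof. by rewrite sqr_sqrtr. Qed.

Let nA : 0 < fnorm A. Proof. exact: fnorm_gt0. Qed.

Lemma yield_time : 2 * mu * t0 * fnorm A = Num.sqrt 3 / 2.
Proof. by rewrite /t0; field; rewrite !gt_eqF. Qed.

Lemma yield_time_ge0 : 0 <= t0.
Proof. by rewrite divr_ge0 ?ltW ?mulr_gt0. Qed.

Let k := (Num.sqrt 3)^-1 * fnorm A.

(** The square is |A|^2 + |A|^2 / 3 for either sign, so both concentrated parts dissipate
    equally. *)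
Lemma slip_dissip e : e ^+ 2 = 1 -> dissip (A, e * k) = 2 / Num.sqrt 3 * fnorm A.
Proof.
move=> e1; have [h1 h2] := MD_entries dA.
have A2 := fnorm_sqr A; rewrite inner2 h1 h2 in A2.
rewrite /dissip /= h1 h2.
rewrite (_ : _ + _ = (2 / Num.sqrt 3 * fnorm A) ^+ 2).
  by rewrite sqrtr_sqr ger0_norm// mulr_ge0 ?divr_ge0 ?ltW.
by rewrite exprMn e1 /k !exprMn !exprVn s3 A2; field.
Qed.

(** Up to t0 all the work is stored as elastic energy. Afterwards, per unit of volume and of [beta],
    the work is 2 mu t0 |A|^2 = 3 k / 2; the dissipation takes 2 k, of which softening supplies k /
    2. *)
Lemma slip_energy_balance :
  energy_balance Omega (elasticity mu kappa) (@Kball R) (@Vsoft R) (fun _ _ => xi0)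
    (fun t _ => alpha t0 t *: A)
    (slip_system Omega xi0 th (beta t0) (fun t => k * beta t0 t)).
Proof.
move=> T T0; have t0_ge0 := yield_time_ge0.
have bm : {homo beta t0 : s t / s <= t} by exact: beta_homo.
have k0 : 0 < k by rewrite mulr_gt0// invr_gt0.
have zk t : k * beta t0 t = k * beta t0 t by [].
split.
  rewrite /Var (slip_system_variation oO xi0 th T0 _ bm zk) ?ltry// => r v r0 /=.
  by rewrite innerZ exprMn -expr2 -mulrDr sqrtrM ?sqr_ge0// sqrtr_sqr ger0_norm.
rewrite /DH (slip_system_variation oO xi0 th T0 _ bm zk); last first.
  by move=> r v r0; rewrite !HdissE dissip_scale ger0_norm.
rewrite !slip_system_softening// !beta0//.
rewrite -!EFinD; congr EFin.
have Qe s : Qel Omega (elasticity mu kappa) (fun=> alpha t0 s *: A) =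
    mu * alpha t0 s ^+ 2 * fnorm A ^+ 2 * vol Omega.
  by rewrite /Qel Rintegral_cst// elastic_MD// fnorm_sqr /vol; field.
have int_t t : \int[L2]_(x in Omega) inner (elasticity mu kappa (alpha t0 t *: A)) (sympart xi0) =
    (2 * mu * fnorm A ^+ 2 * vol Omega) * alpha t0 t.
  by rewrite Rintegral_cst// elastic_MD_inner// fnorm_sqr /vol; ring.
rewrite (funext int_t) integral_alpha// !Qe !HdissE.
have e1 : dissip (A, k) = 2 / Num.sqrt 3 * fnorm A by rewrite -[k]mul1r slip_dissip// expr1n.
have e2 : dissip (A, - k) = 2 / Num.sqrt 3 * fnorm A by rewrite -mulN1r slip_dissip// sqrrN expr1n.
have a0 : alpha t0 0 = 0 by rewrite /alpha yield_time_ge0.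
have kE : k = fnorm A * Num.sqrt 3 / 3 by rewrite /k -[X in _ = _ / X]s3; field; rewrite gt_eqF.
have e3 : 2 / Num.sqrt 3 * fnorm A = 2 * k by rewrite /k mulrA.
have key : 2 * mu * t0 * fnorm A ^+ 2 = 3 / 2 * k.
  by rewrite expr2 mulrA yield_time kE; field.
rewrite e1 e2 e3 a0 (ger0_norm (mulr_ge0 (ltW k0) (beta_ge0 t0 T))) [k * 0]mulr0 normr0.
rewrite (_ : 2 * mu * fnorm A ^+ 2 * vol Omega * (2^-1 * alpha t0 T ^+ 2 + t0 * beta t0 T) =
  mu * alpha t0 T ^+ 2 * fnorm A ^+ 2 * vol Omega + 2 * mu * t0 * fnorm A ^+ 2 * vol Omega * beta t0 T).
  by rewrite key; field.
by field.
Qed.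

End energy.

(** * Identification of the given system with the slip system *)

Lemma sympart_MD (R : realType) (xi0 : 'M[R]_2) : \tr xi0 = 0 -> MD (sympart xi0).
Proof.
move=> t0; split; last by rewrite linearZ linearD /= mxtrace_tr t0 addr0 mulr0.
by rewrite /sympart linearZ /= linearD /= trmxK addrC.
Qed.

(** Homogeneity with factor 0. At time 0 both [omega] terms are evaluated at this point, so only
    [delta] remains in the initial condition. *)
Lemma Chom0 (R : realType) (Omega : set (plane R)) m (f : gypoint R m -> R) x :
  Chom Omega f -> closure Omega x -> f (x, \row_i (0, 0), 0) = 0.
Proof.
move=> [_ fh] Ox.
have yd : gydom Omega ((x, \row_i (0, 0), 0) : gypoint R m) by split => // i; rewrite mxE; exact: MD_0.
rewrite -[RHS](mul0r (f (x, \row_i (0, 0), 0))) -fh//; congr f; rewrite /gyscale /= mulr0.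
by congr (_, _, _); apply/rowP => i; rewrite !mxE /= scaler0 mulr0.
Qed.

Theorem theorem5p1 (R : realType) (Omega : set (R * R)%type) (mu kappa theta0 : R)
    (xi0 : 'M[R]_2) :
  open Omega -> connected Omega -> bounded_set Omega -> C2boundary Omega ->
  0 < mu -> 0 < kappa -> 0 < theta0 ->
  \tr xi0 = 0 -> sympart xi0 != 0 ->
  let t0 : R := Num.sqrt 3 / (4 * mu * fnorm (sympart xi0)) in
  let w (t : R) (x : (R * R)%type) := t *: matvec xi0 x in
  let u := w in
  let e (t : R) (x : (R * R)%type) := alpha t0 t *: sympart xi0 in
  let p (t : R) (x : (R * R)%type) := beta t0 t *: sympart xi0 in
  let zinf (t : R) (x : (R * R)%type) := (Num.sqrt 3)^-1 * fnorm (p t x) in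
  let p0 (x : (R * R)%type) : 'M[R]_2 := 0 in
  let z0 (x : (R * R)%type) := theta0 in
  let bmu : system R := fun m (ts : m.-tuple R) f =>
    delta Omega (fun x => \row_(i < m) (p0 x, z0 x)) f
    + 2^-1 * omega Omega (fun x => \row_i (p (tnth ts i) x, zinf (tnth ts i) x)) f
    + 2^-1 * omega Omega (fun x => \row_i (p (tnth ts i) x, - zinf (tnth ts i) x)) f in
  quasistatic_evolution Omega (bdry Omega) (elasticity mu kappa) (@Kball R) (@Vsoft R)
    w u e bmu /\
  (forall f, Chom Omega f ->
     bmu 1%N [tuple 0] f = delta Omega (fun x => \row_(i < 1) (p0 x, z0 x)) f).
Proof.
move=> oO _ bO _ mu0 /ltW kappa0 _ tr0 A0 t0 w u e p zinf p0 z0 bmu.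
have dA := sympart_MD tr0.
have t0_ge0 : 0 <= t0 := yield_time_ge0 mu0 A0.
have nA := fnorm_gt0 A0.
pose k : R := (Num.sqrt 3)^-1 * fnorm (sympart xi0).
have zE t x : zinf t x = k * beta t0 t.
  by rewrite /zinf /p fnormZ ger0_norm ?beta_ge0// mulrCA mulrC.
have bmuE : bmu = slip_system Omega xi0 theta0 (beta t0) (fun t => k * beta t0 t).
  apply: functional_extensionality_dep => m; apply/funext => ts; apply/funext => f.
  rewrite /bmu /slip_system /twin /delta /omega /slab.
  congr (_ + _ * _ + _ * _); apply: eq_Rintegral => x _; congr (f (x, _, _)); apply/rowP => i.
    by rewrite [LHS]mxE [RHS]mxE zE mul1r.
  by rewrite [LHS]mxE [RHS]mxE zE mulN1r.
have cz : continuous (fun t => k * beta t0 t).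
  by move=> t; apply: cvgMr; exact: beta_continuous.
split; last first.
  move=> f cf.
  have p0E x : p (tnth [tuple 0] ord0) x = 0 by rewrite /p beta0// scale0r.
  have z0E x : zinf (tnth [tuple 0] ord0) x = 0 by rewrite zE beta0// mulr0.
  rewrite /bmu /omega !Rintegral_eq0// ?mulr0 ?addr0// => x Ox.
    rewrite (_ : \row_i _ = \row_i (0, 0)); first exact: (Chom0 cf (subset_closure Ox)).
    by apply/rowP => i; rewrite [LHS]mxE [RHS]mxE ord1 p0E z0E oppr0.
  rewrite (_ : \row_i _ = \row_i (0, 0)); first exact: (Chom0 cf (subset_closure Ox)).
  by apply/rowP => i; rewrite [LHS]mxE [RHS]mxE ord1 p0E z0E.
rewrite bmuE; split.
- exact: slip_system_AY (alpha_beta t0).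
- by apply: slip_system_left_continuous => //; first [exact: alpha_continuous|exact: beta_continuous].
- apply: slip_system_stability => //; first exact: ltW.
  move=> t t_ge0; rewrite -fnorm_sqr -exprMn.
  have /andP[a0 at0] := alpha_bounds t0_ge0 t_ge0.
  (* As alpha never exceeds t0, the stress is bounded by its value at the yield time. *)
  have h : 2 * mu * alpha t0 t * fnorm (sympart xi0) <= Num.sqrt 3 / 2.
    rewrite -(yield_time mu0 A0) ler_wpM2r ?(ltW nA)// ler_wpM2l// mulr_ge0 ?(ltW mu0)//.
  have -> : 3 / 4 = (Num.sqrt 3 / 2) ^+ 2 :> R.
    by rewrite expr_div_n sqr_sqrtr// -natrX.
  by rewrite lerXn2r ?nnegrE// ?mulr_ge0 ?divr_ge0 ?sqrtr_ge0 ?(ltW mu0) ?(ltW nA).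
- exists (fun t _ => t *: xi0), (fun _ => matvec xi0), (fun _ _ => xi0); split.
  + exact: affine_ACloc.
  + exact: affine_H1_derivative.
  + exact: slip_energy_balance.
Qed.
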